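(* Let $\ell,\ell'\in\mathbb{N}$. For $k=1,\dots,\ell$ let $\theta_k\in(0,1)$ and let $\mathcal{M}_k$ be a compact hereditary family of finite subsets of $\mathbb{N}$ with $i(\mathcal{M}_k)=n_k\in\mathbb{N}$; for $k=1,\dots,\ell'$ let $\theta'_k\in(0,1)$ and let $\mathcal{M}'_k$ be a compact hereditary family of finite subsets of $\mathbb{N}$ with $i(\mathcal{M}'_k)=n'_k\in\mathbb{N}$. Then $T[(\mathcal{M}_k,\theta_k)_{k=1}^{\ell}]$ and $T[(\mathcal{M}'_k,\theta'_k)_{k=1}^{\ell'}]$ are totally incomparable if and only if one of the following situations occurs: 1. $\theta_k\le\frac1{n_k}$ for all $k=1,\dots,\ell$ and $\theta'_k>\frac1{n'_k}$ for some $k\in\{1,\dots,\ell'\}$; or 2. $\theta'_k\le\frac1{n'_k}$ for all $k=1,\dots,\ell'$ and $\theta_k>\frac1{n_k}$ for some $k\in\{1,\dots,\ell\}$; or 3. $\theta_k>\frac1{n_k}$ for some $k\in\{1,\dots,\ell\}$ and $\theta'_k>\frac1{n'_k}$ for some $k\in\{1,\dots,\ell'\}$ and $$\min\left\{\frac{1}{1-\log_{n_k}\frac1{\theta_k}}\ \Big|\ n_k\theta_k>1\right\}\neq\min\left\{\frac{1}{1-\log_{n'_k}\frac1{\theta'_k}}\ \Big|\ n'_k\theta'_k>1\right\}.$$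
   Context: $\mathbb{N}=\{1,2,\dots\}$; $c_{00}$ is the space of eventually zero real sequences with unit vector basis $(e_i)$. For $E\subset\mathbb{N}$ and $x=\sum a_ie_i\in c_{00}$, $Ex=\sum_{i\in E}a_ie_i$. For finite $E,F\subset\mathbb{N}$, $E<F$ (resp. $E\le F$) means $\max E<\min F$ (resp. $\max E\le\min F$); $n\le E$ means $\{n\}\le E$ (similarly for $<$). A family $\mathcal{M}$ of finite subsets of $\mathbb{N}$ is compact if the set of characteristic functions of its members is compact in $\{0,1\}^{\mathbb{N}}$ (product topology), and hereditary if $F\subseteq E\in\mathcal{M}$ implies $F\in\mathcal{M}$. Index: for $\mathcal{M}$ compact put $\mathcal{M}^{(0)}=\mathcal{M}$; $\mathcal{M}^{(\lambda+1)}$ is the set of $E\in\mathcal{M}$ whose characteristic function is a limit (accumulation) point of the set of characteristic functions of members of $\mathcal{M}^{(\lambda)}$; $\mathcal{M}^{(\lambda)}=\bigcap_{\mu<\lambda}\mathcal{M}^{(\mu)}$ for $\lambda$ a limit ordinal. The index $i(\mathcal{M})$ is the least ordinal $\lambda$ with $\mathcal{M}^{(\lambda)}\subseteq\{\emptyset\}$. Finite sets $E_1,\dots,E_n\subset\mathbb{N}$ are $\mathcal{M}$-admissible if there is $\{m_1,\dots,m_n\}\in\mathcal{M}$ with $m_1\le E_1<m_2\le E_2<\dots<m_n\le E_n$. Mixed Tsirelson space: given $I\subseteq\mathbb{N}$, compact hereditary families $\mathcal{M}_k$ and $\theta_k\in(0,1]$ ($k\in I$), $T[(\mathcal{M}_k,\theta_k)_{k\in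 I}]$ is the completion of $c_{00}$ under the norm $\|x\|=\sup_{s\ge0}|x|_s$, where $|x|_0=\|x\|_\infty$ and $|x|_{s+1}=\max\{|x|_s,\ \sup_{k\in I}\theta_k\sup\{\sum_{i=1}^n|E_ix|_s: n\in\mathbb{N},\ (E_i)_{i=1}^n\ \mathcal{M}_k\text{-admissible}\}\}$; this norm satisfies $\|x\|=\max\{\|x\|_\infty,\ \sup_{k\in I}\theta_k\sup\{\sum_{i=1}^n\|E_ix\|: n\in\mathbb{N},\ (E_i)_{i=1}^n\ \mathcal{M}_k\text{-admissible}\}\}$. ''Subspace'' means closed infinite-dimensional subspace. Two Banach spaces $X,Y$ are totally incomparable if no subspace of $X$ is isomorphic to any subspace of $Y$. *)

(* Defs.v *)
(* MathComp + MathComp-Analysis *)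
From HB Require Import structures.
From mathcomp Require Import all_boot all_order all_algebra finmap.
From mathcomp Require Import all_classical all_reals all_analysis.
Set Implicit Arguments.
Unset Strict Implicit.
Unset Printing Implicit Defensive.
Import Order.TTheory GRing.Theory Num.Theory.
Import numFieldNormedType.Exports.
Local Open Scope classical_set_scope.
Local Open Scope ring_scope.

(* The index set {1, 2, ...} is rendered by nat = {0, 1, ...} throughout, for
   the subsets as well as for the coordinates: every notion below depends only
   on the order of the index set, so relabelling i as i - 1 changes nothing. *)

Definition charfun (E : {fset nat}) : cantor_space := fun i => i \in E.

Definition compact_family (M : set {fset nat}) : Prop :=
  compact (charfun @` M).

Definition hereditary_family (M : set {fset nat}) : Prop :=
  forall E F : {fset nat}, M E -> (F `<=` E)%fset -> M F.

(* Only the finite stages of the transfinite derivation are needed, since only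
   finite values of the index occur below. *)
Fixpoint derived_family (M : set {fset nat}) (j : nat) : set {fset nat} :=
  if j is j'.+1
  then [set E | M E /\ limit_point (charfun @` derived_family M j') (charfun E)]
  else M.

Definition has_index (M : set {fset nat}) (n : nat) : Prop :=
  derived_family M n `<=` [set fset0] /\
  forall j, (j < n)%N -> ~ (derived_family M j `<=` [set fset0]).

(* The E i are required to be nonempty, so that min (E i) and max (E i) are
   meaningful. *)
Definition admissible (M : set {fset nat}) (n : nat) (E : 'I_n -> {fset nat}) :
    Prop :=
  (forall i, E i != fset0) /\
  exists m : 'I_n -> nat,
    [/\ M [fset m i | i in 'I_n]%fset,
        forall i a, a \in E i -> (m i <= a)%N &
        forall i j : 'I_n, j = i.+1 :> nat ->
          forall a, a \in E i -> (a < m j)%N].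

Definition c00 (R : realType) : set (nat -> R^o) :=
  [set x | exists N, forall i, (N <= i)%N -> x i = 0].

Definition restrict_to (R : realType) (E : {fset nat}) (x : nat -> R^o) :
    nat -> R^o :=
  fun i => if i \in E then x i else 0.

(* All norms are extended-real valued, so that the suprema are meaningful
   without a boundedness proof; they are finite on c00 when the theta k are in
   ]0, 1]. If there is no M k-admissible family, the corresponding supremum is
   -oo and does not contribute. *)
Section MixedTsirelson.
Context (R : realType) (I : Type) (M : I -> set {fset nat}) (theta : I -> R).

Fixpoint mt_norm_step (s : nat) (x : nat -> R^o) : \bar R :=
  if s is s'.+1 then
    maxe (mt_norm_step s' x)
      (ereal_sup (range (fun k : I => (theta k)%:E *
         ereal_sup [set y : \bar R | exists n (E : 'I_n -> {fset nat}),
           [/\ (0 < n)%N, admissible (M k) E &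
               y = (\sum_(i < n) mt_norm_step s' (restrict_to (E i) x))%E]])))%E
  else ereal_sup (range (fun i => (`|x i|)%:E)).

Definition mt_norm (x : nat -> R^o) : \bar R :=
  ereal_sup (range (fun s => mt_norm_step s x)).

End MixedTsirelson.

Definition linear_on (R : realType) (U W : lmodType R) (V : set U)
    (f : U -> W) : Prop :=
  forall (a : R) (x y : U), V x -> V y -> f (a *: x + y) = a *: f x + f y.

(* X is (up to isometric isomorphism) the completion of (c00, mt_norm M theta):
   a Banach space with a dense linear isometric image of c00. *)
Definition is_mixed_tsirelson (R : realType) (I : Type)
    (M : I -> set {fset nat}) (theta : I -> R) (X : completeNormedModType R) :
    Prop :=
  exists iota : (nat -> R^o) -> X,
    [/\ linear_on (@c00 R) iota,
        forall x, c00 x -> (`|iota x|)%:E = mt_norm M theta x &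
        dense (iota @` @c00 R)].

Definition linear_subspace (R : realType) (X : lmodType R) (V : set X) : Prop :=
  V 0 /\ forall (a : R) x y, V x -> V y -> V (a *: x + y).

Definition finite_dimensional (R : realType) (X : lmodType R) (V : set X) :
    Prop :=
  exists n (v : 'I_n -> X),
    V = [set x | exists a : 'I_n -> R, x = \sum_(i < n) a i *: v i].

Definition banach_subspace (R : realType) (X : completeNormedModType R)
    (V : set X) : Prop :=
  [/\ linear_subspace V, closed V & ~ finite_dimensional V].

Definition isomorphic_subspaces (R : realType) (X Y : completeNormedModType R)
    (V : set X) (W : set Y) : Prop :=
  exists T : X -> Y,
    [/\ linear_on V T, set_bij V W T,
        exists C : R, forall x, V x -> `|T x| <= C * `|x| &
        exists C : R, forall x, V x -> `|x| <= C * `|T x|].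

Definition totally_incomparable (R : realType) (X Y : completeNormedModType R) :
    Prop :=
  forall (V : set X) (W : set Y),
    banach_subspace V -> banach_subspace W -> ~ isomorphic_subspaces V W.

Definition log_base (R : realType) (b x : R) : R := ln x / ln b.

(* The minimum of 1 / (1 - log_{n k} (1 / theta k)) over the k such that
   n k * theta k > 1; the value +oo is taken exactly when there is no such k. *)
Definition min_exponent (R : realType) (l : nat) (theta : 'I_l -> R)
    (n : 'I_l -> nat) : \bar R :=
  \big[mine/+oo%E]_(k < l | 1 < (n k)%:R * theta k)
    (1 / (1 - log_base (n k)%:R (1 / theta k)))%:E.

(* Main.v *)
(* Define t_k = 1 / p_k by n_k^{t_k} = n_k theta_k.  Along supports that are far
   apart, M_k-admissible families behave like families of at most n_k successive
   sets, except that up to 2 n_k blocks may be cut into pieces, and conversely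
   all families of n_k successive sets are admissible.  Let t be the largest
   t_k, or 0 if no n_k theta_k exceeds 1, and let p = 1 / t.
   - Flat sums of N spread-out blocks have norm at most C N^{1/q} for every
     q < p, by induction on the level of the norm, and n_k-ary trees give a lower
     l_p estimate.
   - At the exponent p itself the cut blocks cost single coordinates only, which
     is harmless for blocks with small coordinates: some block sequence is
     equivalent to the unit basis of l_p (of c_0 if t = 0).
   Hence equal exponents give isomorphic subspaces.  If the exponents differ, a
   gliding hump run simultaneously in a subspace and in its isomorphic image
   contradicts N^{1/p} <= C N^{1/q} for large N. *)
Require Import Defs.
From mathcomp Require Import all_boot all_order all_algebra finmap.
From mathcomp Require Import all_classical all_reals all_analysis.
From mathcomp Require Import zify ring lra.
Set Implicit Arguments.
Unset Strict Implicit.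
Unset Printing Implicit Defensive.
Import Order.TTheory GRing.Theory Num.Theory.
Import numFieldNormedType.Exports.
Local Open Scope classical_set_scope.
Local Open Scope ring_scope.

(** * Ranks of nodes in a compact family *)

(** The difficulty is the critical exponent. For [q < p] every [theta_k n_k^(1-1/q)] is below 1, and
    this slack absorbs the cut blocks. At [p] itself the product may equal 1 and no slack remains.
    It is recovered from [theta_k < 1] alone: the cost of cutting is charged to the boundaries
    between blocks that a set straddles. Successive sets never straddle the same boundary, so the
    total charge shrinks by [theta_k] at each level, while the l_p term is merely preserved. This
    needs normalized blocks with tiny coordinates, which unit vectors do not provide. Their
    existence comes from a dichotomy on a sparse set of positions. Either the norm is dominated by a
    multiple of the l_p norm on some tail, and unit vectors already have the upper estimate; or the
    ratio of the two norms is unbounded on every tail, and a set where it is maximal gives a vector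
    of norm one, of l_p norm as small as desired, all of whose pieces obey the same ratio. The
    factor 2 in [2 n_k] arises because the start of a set may lie just behind the preceding set,
    before any gap has opened; only every second start is known to be far away. *)

Lemma seq_bound (T : eqType) (f : T -> nat) (s : seq T) :
  exists N, forall x, x \in s -> (f x <= N)%N.
Proof.
elim: s => [|a s [N IH]]; first by exists 0%N.
exists (maxn (f a) N) => x; rewrite inE leq_max => /orP[/eqP->|/IH->].
  by rewrite leqnn.
by rewrite orbT.
Qed.

Lemma nbhs_cylinder (f : cantor_space) N :
  nbhs f [set g : cantor_space | forall i, (i < N)%N -> g i = f i].
Proof.
elim: N => [|N IH]; first by apply: filterS filterT.
have nN : nbhs f [set g : cantor_space | g N = f N].
  apply: (@proj_continuous _ (fun _ : nat => bool) N f [set f N]).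
  by rewrite nbhs_principalE; apply/principal_filterP.
apply: filterS (filterI IH nN) => g /= [gi gN] i.
by rewrite ltnS leq_eqVlt => /orP[/eqP->|/gi].
Qed.

(** Heredity reduces nearby members to one-point extensions: a member that agrees with [E] up to
    beyond its maximum, and differs from it, contains some further [k], hence also the subset
    obtained from [E] by adding [k]. Conversely, extensions with [k] tending to infinity converge
    pointwise. From here on the derivation is handled as tree combinatorics. *)
Lemma limit_point_charfun (A : set {fset nat}) (E : {fset nat}) :
  hereditary_family A ->
  limit_point (charfun @` A) (charfun E) <->
  forall N, exists k, [/\ (N <= k)%N, k \notin E & A (k |` E)%fset].
Proof.
move=> hA; split=> [lim N|ext U nU].
  have [N0 EN0] := seq_bound id E; pose N' := maxn N N0.+1.
  have E_lt i : i \in E -> (i < N')%N.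
    by move=> /EN0 iN; rewrite leq_max ltnS iN orbT.
  have [y [/eqP neq [G AG Gy] UG]] := lim _ (nbhs_cylinder (charfun E) N').
  subst y.
  have GE i : (i < N')%N -> (i \in G) = (i \in E) by move=> iN; exact: UG.
  have [k kG kE] : exists2 k, k \in G & k \notin E.
    apply: contrapT => no; apply: neq; apply/funext => i; rewrite /charfun.
    have [iN|Ni] := ltnP i N'; first exact: GE.
    have iE : i \notin E by apply: contraL Ni => /E_lt; rewrite -ltnNge.
    by rewrite (negbTE iE); apply/negP => iG; apply: no; exists i.
  have Nk : (N' <= k)%N.
    by rewrite leqNgt; apply: contra kE => kN; rewrite -GE.
  exists k; split=> //; first by apply: leq_trans Nk; rewrite leq_maxl.
  apply: hA AG _; apply/fsubsetP => i; rewrite !inE => /orP[/eqP->//|iE].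
  by rewrite GE // E_lt.
pose k_ N := sval (cid (ext N)).
have kP N : [/\ (N <= k_ N)%N, k_ N \notin E & A (k_ N |` E)%fset].
  by rewrite /k_; case: cid.
have cvgk : (fun N => charfun (k_ N |` E)%fset) @ \oo --> charfun E.
  apply/cvg_sup => i V [W] [[B] oB <-] BE BW.
  apply: filterS BW _; rewrite nbhs_simpl; exists i.+1 => // N /= iN.
  suff -> : charfun (k_ N |` E)%fset i = charfun E i by [].
  rewrite /charfun !inE; have [le_k _ _] := kP N.
  by rewrite (_ : (i == k_ N) = false) //; apply/negbTE; rewrite neq_ltn; lia.
have [N _ UN] := cvgk _ nU; exists (charfun (k_ N |` E)%fset).
have [_ kE Ak] := kP N; split; [|by exists (k_ N |` E)%fset|exact: (UN N (leqnn N))].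
apply/eqP => /(congr1 (@^~ (k_ N))); rewrite /charfun !inE eqxx /=.
by rewrite (negbTE kE).
Qed.

Section Derived.
Variable M : set {fset nat}.
Hypothesis hM : hereditary_family M.

Lemma derived_hereditary j : hereditary_family (derived_family M j).
Proof.
elim: j => [//|j IH] E F [ME /(limit_point_charfun _ IH) limE] FE.
split; first exact: hM ME FE.
apply/(limit_point_charfun _ IH) => N; have [k [Nk kE Ek]] := limE N.
exists k; split=> //; first by apply: contra kE; apply/fsubsetP.
by apply: IH Ek _; apply: fsetUS.
Qed.

Lemma derivedS j E : derived_family M j.+1 E <-> M E /\
  forall N, exists k, [/\ (N <= k)%N, k \notin E & derived_family M j (k |` E)%fset].
Proof.
have hj := @derived_hereditary j.
split=> -[ME] lim; split=> //; first exact: (proj1 (limit_point_charfun _ hj)).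
exact: (proj2 (limit_point_charfun _ hj)).
Qed.

Lemma derived_le i j E : (i <= j)%N -> derived_family M j E ->
  derived_family M i E.
Proof.
have dec k F : derived_family M k.+1 F -> derived_family M k F.
  elim: k F => [|k IH] F; first by case.
  move=> /derivedS[MF limF]; apply/derivedS; split=> // N.
  by have [m [Nm mF /IH ?]] := limF N; exists m.
move=> /subnK <-; elim: (j - i)%N => [//|d IH]; rewrite addSn => /dec; exact: IH.
Qed.

Lemma derived_sub j E : derived_family M j E -> M E.
Proof. exact: (@derived_le 0 j). Qed.

(** Only finitely many [F] lie in {0, ..., t} and only finitely many [r] are below [n], so the
    largest of their bounds serves all. This is how a gap function comes to depend on the last
    position alone. *)
Lemma uniform_bound (P : nat -> {fset nat} -> nat -> nat -> Prop) n :
  (forall t F r b b', P t F r b -> (b <= b')%N -> P t F r b') ->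
  (forall t F r, (forall i, i \in F -> (i <= t)%N) -> exists b, P t F r b) ->
  exists g : nat -> nat, forall t F r, (r < n)%N ->
    (forall i, i \in F -> (i <= t)%N) -> P t F r (g t).
Proof.
move=> mono ex.
suff /boolp.choice[g gP] : forall t, exists b, forall F r, (r < n)%N ->
    (forall i, i \in F -> (i <= t)%N) -> P t F r b by exists g.
move=> t.
have {}ex (F : {fset nat}) r : exists b, (forall i, i \in F -> (i <= t)%N) -> P t F r b.
  have [Ft|nFt] := EM (forall i, i \in F -> (i <= t)%N).
    by have [b] := ex t F r Ft; exists b.
  by exists 0%N.
pose b_ (F : {fset nat}) r := sval (cid (ex F r)).
pose s := [seq (F, r) | F <- fpowerset [fset i in iota 0 t.+1]%fset, r <- iota 0 n].
have [B sB] := seq_bound (fun a : {fset nat} * nat => b_ a.1 a.2) s.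
exists B => F r rn Ft; apply: (@mono t F r (b_ F r)).
  by rewrite /b_; case: cid => /= b; apply.
apply: (sB (F, r)); apply: allpairs_f; last by rewrite mem_iota.
by rewrite fpowersetE; apply/fsubsetP => i /Ft it; rewrite !inE mem_iota; lia.
Qed.

Variable n : nat.
Hypothesis iM : has_index M n.

(** If arbitrarily large [k] gave extensions of [F] of rank [r], then [F] would have rank [r.+1] by
    [derivedS]. When [F] is not in [M], heredity excludes every extension. *)
Lemma rank_gap : exists g : nat -> nat, forall t F r k,
  (r < n)%N -> (forall i, i \in F -> (i <= t)%N) -> (g t <= k)%N -> (t < k)%N ->
  ~ derived_family M r.+1 F -> ~ derived_family M r (k |` F)%fset.
Proof.
pose P t F r b := forall k, (b <= k)%N -> (t < k)%N ->
  ~ derived_family M r.+1 F -> ~ derived_family M r (k |` F)%fset.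
have [||g gP] := @uniform_bound P n.
- by move=> t F r b b' PF bb k b'k; apply: PF; apply: leq_trans b'k.
- move=> t F r Ft; have [dF|ndF] := EM (derived_family M r.+1 F).
    by exists 0%N => k _ _ /(_ dF).
  apply: contrapT => no; apply: ndF; apply/derivedS; split.
    apply: contrapT => nMF; apply: no; exists 0%N => k _ _ _ /derived_sub.
    by move=> d; apply: nMF; exact: hM d (fsubsetUr _ _).
  move=> N; apply: contrapT => noN; apply: no; exists N => k Nk tk _ dk.
  by apply: noN; exists k; split=> //; apply/negP => /Ft; rewrite leqNgt tk.
by exists g => t F r k rn Ft gk tk; exact: (gP t F r rn Ft k gk tk).
Qed.

(* Along a chain of nodes that are far apart the Cantor-Bendixson rank drops
   strictly, hence the chain has at most n nodes. *)
Lemma rank_chain : exists g : nat -> nat, forall s : seq (nat * nat),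
  all (fun a => a.1 <= a.2)%N s ->
  pairwise (fun a b => (g a.2 <= b.1) && (a.2 < b.1))%N s ->
  M [fset a.1 | a in s]%fset -> (size s <= n)%N.
Proof.
have [g gP] := rank_gap; exists g => s0.
(* Here [F] collects the starts already passed. If the node ending in [a.1] is outside stage [r.+1],
   then [rank_gap] puts the next node outside stage [r], and stage 0 is [M] itself, which no node
   leaves. The chain begins with [r = n], a stage that contains no singleton. *)
suff aux : forall s a r F, (r <= n)%N -> all (fun a => a.1 <= a.2)%N (a :: s) ->
    pairwise (fun a b => (g a.2 <= b.1) && (a.2 < b.1))%N (a :: s) ->
    (forall i, i \in F -> (i <= a.2)%N) ->
    M (F `|` [fset a.1 | a in a :: s])%fset ->
    ~ derived_family M r (a.1 |` F)%fset -> (size (a :: s) <= r)%N.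
  case: s0 => [//|a s] le_s pw Ms; apply: (aux s a n fset0) => //.
  - by rewrite fset0U.
  - case: iM => + _ => /[apply] /= /fsetP /(_ a.1).
    by rewrite !inE eqxx.
elim=> [|b s IH] a r F rn.
  case: r rn => [|//] _ _ _ _ MF; case.
  by apply: hM MF _; apply/fsubsetP => i; rewrite !inE => /orP[/eqP->|->]//;
     apply/orP; right; apply/imfsetP; exists a; rewrite ?inE.
move=> /[dup] le_abs /= /and3P[le_a le_b le_s] /andP[/andP[/andP[gab ab] pa] pbs].
move=> Fa MF nd.
have MU : M ((a.1 |` F) `|` [fset a.1 | a in b :: s])%fset.
  apply: hM MF _; apply/fsubsetP => i; rewrite !inE -orbA => /or3P[/eqP->|->//|].
    by apply/orP; right; apply/imfsetP; exists a; rewrite ?inE ?eqxx.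
  move=> /imfsetP[c /= cs ->]; apply/orP; right; apply/imfsetP.
  by exists c => //=; rewrite inE cs orbT.
case: r rn nd => [_ nd|r rn nd].
  exfalso; apply: nd; apply: hM MU _; apply: fsubsetUl.
rewrite ltnS; apply: (IH b r (a.1 |` F)%fset) => //.
- exact: ltnW.
- by rewrite /= le_b.
- move=> i; rewrite !inE => /orP[/eqP->|/Fa ia]; lia.
- apply: (gP a.2) => //; move=> i; rewrite !inE => /orP[/eqP->//|/Fa //].
Qed.

(* Conversely the tree of M contains a full n-level tree above some node e. *)
Lemma spread_chain : (0 < n)%N -> exists (e : nat) (g : nat -> nat),
  forall (E E' : nat -> nat) r, (r < n)%N ->
    (e <= E 0)%N -> (forall i, (i <= r)%N -> (E i <= E' i)%N) ->
    (forall i, (i < r)%N -> (g (E' i) <= E i.+1)%N) ->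
    exists m : nat -> nat, [/\ M [fset x in map m (iota 0 r.+1)]%fset,
      forall i, (i <= r)%N -> (m i <= E i)%N &
      forall i, (i < r)%N -> (E' i < m i.+1)%N].
Proof.
move=> n_gt0.
(* Minimality of the index gives a nonempty member of stage [n - 1]; heredity shrinks it to a
   singleton, the root of the tree. *)
have [e de] : exists e, derived_family M n.-1 [fset e]%fset.
  have := iM.2 n.-1; rewrite prednK // => /(_ (leqnn _)) /existsNP[E].
  move=> /not_implyP[dE nE].
  have [E0|[e eE]] := fset_0Vmem E; first by case: nE; rewrite E0.
  by exists e; apply: derived_hereditary dE _; rewrite fsub1set.
pose P t F r b := derived_family M r.+1 F ->
  exists k, [/\ derived_family M r (k |` F)%fset, (t < k)%N & (k <= b)%N].
have [||g gP] := @uniform_bound P n.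
- move=> t F r b b' PF bb' /PF[k [dk tk kb]]; exists k; split=> //.
  exact: leq_trans bb'.
- move=> t F r Ft; have [/derivedS[_ /(_ t.+1)[k [tk kF dk]]]|ndF] := EM (derived_family M r.+1 F).
    by exists k => _; exists k.
  by exists 0%N => /ndF.
exists e, g => E E' r rn eE EE' gE.
(* The node formed by [j.+1] starts still has rank [n.-1 - j]. While this is positive it has
   extensions past [E' j], one of which is at most [g (E' j)] and so does not exceed [E j.+1]. *)
suff aux j : (j <= r)%N -> exists m : nat -> nat,
    [/\ derived_family M (n.-1 - j) [fset x in map m (iota 0 j.+1)]%fset,
      forall i, (i <= j)%N -> (m i <= E i)%N &
      forall i, (i < j)%N -> (E' i < m i.+1)%N].
  by have [m [/derived_sub ? ? ?]] := aux r (leqnn r); exists m.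
elim: j => [_|j IH jr].
  exists (fun _ => e); split=> //; last by move=> i; rewrite leqn0 => /eqP->.
  rewrite subn0; apply: derived_hereditary de _; apply/fsubsetP => i.
  by rewrite in_fset in_fset1 => /mapP[k _ ->].
have [m [dm mE E'm]] := IH (ltnW jr).
have rk : ((n.-1 - j.+1) < n)%N by lia.
have mt i : i \in [fset x in map m (iota 0 j.+1)]%fset -> (i <= E' j)%N.
  rewrite in_fset => /mapP[k]; rewrite mem_iota add0n ltnS => /andP[_ kj] ->.
  have Emono a : (k + a <= j)%N -> (E k <= E' (k + a))%N.
    elim: a => [|a IHa] kaj; first by rewrite addn0; apply: EE'; lia.
    have lt_k : (k + a < r)%N by lia.
    have := E'm (k + a)%N; have := mE (k + a).+1; have := EE' (k + a).+1.
    have := IHa; rewrite addnS; lia.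
  apply: leq_trans (mE _ kj) _; have := Emono (j - k)%N; rewrite subnKC //.
  exact.
have := gP (E' j) _ _ rk mt; rewrite /P (_ : (n.-1 - j.+1).+1 = (n.-1 - j)%N); last by lia.
move=> /(_ dm)[k [dk tk kb]]; exists (fun i => if i == j.+1 then k else m i); split.
- apply: derived_hereditary dk _; apply/fsubsetP => x; rewrite in_fsetU in_fset1 !in_fset.
  move=> /mapP[i + ->]; rewrite mem_iota add0n => /andP[_].
  have [->|ij] := eqVneq i j.+1; first by rewrite eqxx.
  move=> ij2; apply/orP; right; apply/mapP; exists i => //.
  by rewrite mem_iota; lia.
- move=> i ij; have [->|ne] := eqVneq i j.+1; first exact: leq_trans (gE _ jr).
  by apply: mE; lia.
- move=> i; rewrite ltnS => ij; rewrite eqSS; have [->//|ne] := eqVneq i j.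
  by apply: E'm; lia.
Qed.
End Derived.

(** * Norms on finitely supported sequences *)

Definition below (a b : nat * {fset nat}) : bool := all (fun x => x < b.1)%N a.2.

Definition is_node (a : nat * {fset nat}) : bool :=
  (a.2 != fset0) && all (fun x => a.1 <= x)%N a.2.

(* Admissible families as lists of pairs (m_i, E_i), so that they can be
   filtered. *)
Definition adm (M : set {fset nat}) (s : seq (nat * {fset nat})) : Prop :=
  [/\ M [fset x in map fst s]%fset, all is_node s & pairwise below s].

Lemma admissible_adm (M : set {fset nat}) n (E : 'I_n -> {fset nat}) :
  admissible M E -> exists m : 'I_n -> nat,
    adm M [seq (m i, E i) | i <- enum 'I_n].
Proof.
move=> [E0 [m [Mm mE Em]]]; exists m; split.
- rewrite (_ : [fset x in _]%fset = [fset m i | i in 'I_n]%fset) //.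
  apply/fsetP => x; rewrite in_fset -map_comp; apply/mapP/imfsetP => /=.
    by move=> [i _ ->]; exists i.
  by move=> [i _ ->]; exists i => //; rewrite mem_enum.
- apply/allP => _ /mapP[i _ ->]; rewrite /is_node /= E0 /=.
  by apply/allP => x /mE.
- have lt_m d (i j : 'I_n) : j = (i + d).+1 :> nat -> forall a, a \in E i -> (a < m j)%N.
    elim: d i => [|d IH] i jE a aE; first by apply: Em aE; rewrite jE addn0.
    have lt_i : (i.+1 < n)%N by apply: leq_ltn_trans (ltn_ord j); lia.
    have [E'0|[b bE]] := fset_0Vmem (E (Ordinal lt_i)).
      by have := E0 (Ordinal lt_i); rewrite E'0 eqxx.
    have := IH (Ordinal lt_i) _ b bE; rewrite /= jE.
    have -> : (i + d.+1).+1 = (i.+1 + d).+1 by lia.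
    move=> /(_ erefl); apply: leq_trans; apply: leq_trans (mE _ _ bE).
    by have := @Em i (Ordinal lt_i) erefl a aE; lia.
  rewrite pairwise_map; apply: (@sub_pairwise _ (fun i j : 'I_n => i < j)%N).
    move=> i j ij; apply/allP => a; apply: (lt_m (j - i.+1)%N); lia.
  rewrite -(pairwise_map val ltn) val_enum_ord -sorted_pairwise; last exact: ltn_trans.
  exact: iota_ltn_sorted.
Qed.

Lemma adm_admissible (M : set {fset nat}) s :
  adm M s -> admissible M (fun i : 'I_(size s) => (nth (0%N, fset0) s i).2).
Proof.
move=> [Ms sn pw]; split=> [i|].
  by have /allP/(_ _ (mem_nth (0%N, fset0) (ltn_ord i)))/andP[] := sn.
exists (fun i : 'I_(size s) => (nth (0%N, fset0) s i).1); split.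
- rewrite (_ : [fset _ | i in 'I_(size s)]%fset = [fset x in map fst s]%fset) //.
  apply/fsetP => x; rewrite in_fset; apply/imfsetP/mapP => /=.
    by move=> [i _ ->]; exists (nth (0%N, fset0) s i) => //; exact: mem_nth.
  move=> [a as_ ->]; have lt_a : (index a s < size s)%N by rewrite index_mem.
  by exists (Ordinal lt_a) => //=; rewrite nth_index.
- move=> i a; have /allP/(_ _ (mem_nth (0%N, fset0) (ltn_ord i)))/andP[_] := sn.
  by move=> /allP; apply.
- move=> i j ji a; have /(pairwiseP (0%N, fset0)) := pw.
  move=> /(_ i j (ltn_ord i) (ltn_ord j)).
  by rewrite ji leqnn => /(_ isT)/allP; apply.
Qed.

Lemma adm_sub M s s' : hereditary_family M -> subseq s' s -> adm M s -> adm M s'.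
Proof.
move=> hM ss [Ms sn pw]; split.
- apply: hM Ms _; apply/fsubsetP => x; rewrite !in_fset.
  by apply: mem_subseq; exact: map_subseq.
- by apply/allP => a /(mem_subseq ss); apply/allP.
- exact: subseq_pairwise ss pw.
Qed.

Lemma adm_lt M s : adm M s ->
  pairwise (fun a b : nat * {fset nat} => all (fun x => all (fun y => x < y)%N b.2) a.2) s.
Proof.
move=> [_ sn pw].
have : all (fun a => is_node a) s by [].
move: pw; rewrite /is_node; elim: s sn => [//|a s IH] /= /andP[an sn].
move=> /andP[ab pw] _; rewrite IH // andbT; apply/allP => b bs.
have /allP/(_ b bs)/allP lt_b := ab.
have /allP/(_ b bs)/andP[_ /allP le_b] := sn.
by apply/allP => x /lt_b xb; apply/allP => y /le_b; exact: leq_trans.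
Qed.

Lemma adm_count M s x : adm M s -> (count (fun a : nat * {fset nat} => x \in a.2) s <= 1)%N.
Proof.
move=> /adm_lt; elim: s => [//|a s IH] /= /andP[/allP ab pw].
have [xa|xa] := boolP (x \in a.2); last exact: IH.
rewrite (_ : count _ s = 0)%N //; apply/eqP; rewrite -leqn0 leqNgt -has_count.
apply/negP => /hasP[b bs xb].
by have /allP/(_ x xa)/allP/(_ x xb) := ab b bs; rewrite ltnn.
Qed.

Section Norm.
Context (R : realType) (l : nat) (M : 'I_l -> set {fset nat}) (theta : 'I_l -> R).
Hypothesis theta01 : forall k, 0 < theta k < 1.
Implicit Types (x y : nat -> R^o) (k : 'I_l) (s : seq (nat * {fset nat})).

Let N := mt_norm_step M theta.

Lemma c00_restrict E x : c00 x -> c00 (restrict_to E x).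
Proof.
by move=> [K xK]; exists K => i /xK xi; rewrite /restrict_to xi; case: ifP.
Qed.

Lemma c00_restrict_fset E x : c00 (restrict_to E x).
Proof.
have [K EK] := seq_bound id E; exists K.+1 => i Ki; rewrite /restrict_to.
by case: ifP => // /EK; rewrite leqNgt Ki.
Qed.

Lemma normr_restrict E x i : `|restrict_to E x i| <= `|x i|.
Proof. by rewrite /restrict_to; case: ifP => // _; rewrite normr0. Qed.

Lemma restrict_restrict E F x :
  restrict_to E (restrict_to F x) = restrict_to (E `&` F)%fset x.
Proof.
apply/funext => i; rewrite /restrict_to inE.
by case: (i \in E); case: (i \in F).
Qed.

Lemma mt_step0_le x B : (forall i, `|x i| <= B) -> (N 0 x <= B%:E)%E.
Proof. by move=> xB; apply: ge_ereal_sup => _ [i _ <-]; rewrite lee_fin. Qed.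

Lemma mt_step_incr t x : (N t x <= N t.+1 x)%E.
Proof. by rewrite /N /= le_max lexx. Qed.

Lemma mt_step_ge t x i : (`|x i|%:E <= N t x)%E.
Proof.
elim: t => [|t IH]; last exact: le_trans IH (mt_step_incr _ _).
by apply: ereal_sup_ubound; exists i.
Qed.

Lemma mt_step_ge0 t x : (0 <= N t x)%E.
Proof. exact: le_trans (mt_step_ge t x 0). Qed.

Lemma mt_step_adm t x k s : adm (M k) s ->
  ((theta k)%:E * \sum_(a <- s) N t (restrict_to a.2 x) <= N t.+1 x)%E.
Proof.
move=> as_; have [->|s0] := eqVneq s [::].
  by rewrite big_nil mule0 mt_step_ge0.
have /andP[t0 _] := theta01 k.
rewrite /N /= le_max; apply/orP; right.
apply: le_trans (ereal_sup_ubound _); last by exists k.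
rewrite lee_pmul2l // ?lte_fin //.
apply: ereal_sup_ubound; exists (size s).
exists (fun i : 'I_(size s) => (nth (0%N, fset0) s i).2); split.
- by rewrite lt0n size_eq0.
- exact: adm_admissible.
- by rewrite (big_nth (0%N, fset0)) big_mkord.
Qed.

Lemma mt_stepS_le t x B : (N t x <= B%:E)%E ->
  (forall k s, adm (M k) s ->
    ((theta k)%:E * \sum_(a <- s) N t (restrict_to a.2 x) <= B%:E)%E) ->
  (N t.+1 x <= B%:E)%E.
Proof.
move=> xB sB; rewrite /N /= ge_max xB /=.
apply: ge_ereal_sup => _ [k _ <-]; have /andP[t0 _] := theta01 k.
rewrite -lee_pdivlMl //; apply: ge_ereal_sup => _ [n [E [n0 aE ->]]].
rewrite lee_pdivlMl //; have [m am] := admissible_adm aE.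
by have := sB k _ am; rewrite big_map big_enum.
Qed.

(** Every coordinate lies in at most one set of an admissible family and [theta k < 1], so the l_1
    norm dominates all levels. The resulting finiteness on [c00] allows the real-valued [nrms] and
    [nrm]. *)
Lemma mt_step_sum t x K : (forall i, (K <= i)%N -> x i = 0) ->
  (N t x <= (\sum_(i < K) `|x i|)%:E)%E.
Proof.
elim: t x => [|t IH] x xK.
  apply: mt_step0_le => i; have [/xK->|iK] := leqP K i.
    by rewrite normr0 sumr_ge0.
  by rewrite (bigD1 (Ordinal iK)) //= lerDl sumr_ge0.
apply: mt_stepS_le => [|k s as_]; first exact: IH.
have /andP[t0 t1] := theta01 k.
have : (\sum_(a <- s) N t (restrict_to a.2 x) <= (\sum_(i < K) `|x i|)%:E)%E.
  apply: (@le_trans _ _ (\sum_(a <- s) (\sum_(i < K) `|restrict_to a.2 x i|)%:E)%E).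
    apply: lee_sum => a _; apply: IH => i /xK xi; rewrite /restrict_to xi.
    by case: ifP.
  rewrite sumEFin lee_fin exchange_big /=; apply: ler_sum => i _.
  have : \sum_(a <- s) `|restrict_to a.2 x i| = `|x i| *+ count (fun a : nat * {fset nat} => val i \in a.2) s.
    rewrite -iter_addr_0 -big_const_seq [RHS]big_mkcond /=; apply: eq_bigr => a _.
    by rewrite /restrict_to; case: ifP => //; rewrite normr0.
  move=> ->; have := adm_count (val i) as_; case: (count _ _) => [|[|//]] _.
    by rewrite mulr0n.
  by rewrite mulr1n.
move=> le_s; apply: le_trans (_ : (theta k)%:E * (\sum_(i < K) `|x i|)%:E <= _)%E.
  by rewrite lee_pmul2l // lte_fin.
by rewrite -EFinM lee_fin ler_piMl ?sumr_ge0 // ltW.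
Qed.

Definition nrms t x : R := fine (N t x).

Definition nrm x : R := fine (mt_norm M theta x).

Lemma nrmsE t x : c00 x -> (nrms t x)%:E = N t x.
Proof.
move=> [K xK]; rewrite /nrms fineK // ge0_fin_numE ?mt_step_ge0 //.
by apply: le_lt_trans (mt_step_sum t xK) _; rewrite ltry.
Qed.

Lemma nrmE x : c00 x -> (nrm x)%:E = mt_norm M theta x.
Proof.
move=> [K xK]; rewrite /nrm fineK // ge0_fin_numE; last first.
  by apply: le_trans (mt_step_ge0 0 x) _; apply: ereal_sup_ubound; exists 0%N.
apply: (@le_lt_trans _ _ (\sum_(i < K) `|x i|)%:E); last by rewrite ltry.
by apply: ge_ereal_sup => _ [t _ <-]; exact: mt_step_sum.
Qed.

Lemma nrms_ge t x i : c00 x -> `|x i| <= nrms t x.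
Proof. by move=> cx; rewrite -lee_fin nrmsE ?mt_step_ge. Qed.

Lemma nrms_ge0 t x : c00 x -> 0 <= nrms t x.
Proof. by move=> cx; apply: le_trans (nrms_ge t 0 cx). Qed.

Lemma nrms0_le x B : c00 x -> (forall i, `|x i| <= B) -> nrms 0 x <= B.
Proof. by move=> cx xB; rewrite -lee_fin nrmsE // mt_step0_le. Qed.

Lemma nrmsS t x : c00 x -> nrms t x <= nrms t.+1 x.
Proof. by move=> cx; rewrite -lee_fin !nrmsE // mt_step_incr. Qed.

Lemma nrms_le t t' x : c00 x -> (t <= t')%N -> nrms t x <= nrms t' x.
Proof.
move=> cx /subnK <-; elim: (t' - t)%N => [//|d IH]; rewrite addSn.
exact: le_trans IH (nrmsS _ cx).
Qed.

Lemma nrms_adm t x k s : c00 x -> adm (M k) s ->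
  theta k * \sum_(a <- s) nrms t (restrict_to a.2 x) <= nrms t.+1 x.
Proof.
move=> cx as_; rewrite -lee_fin EFinM -sumEFin nrmsE //.
rewrite (eq_bigr (fun a => N t (restrict_to a.2 x))); first exact: mt_step_adm.
by move=> a _; rewrite nrmsE //; exact: c00_restrict.
Qed.

Lemma nrmsS_le t x B : c00 x -> nrms t x <= B ->
  (forall k s, adm (M k) s ->
    theta k * \sum_(a <- s) nrms t (restrict_to a.2 x) <= B) ->
  nrms t.+1 x <= B.
Proof.
move=> cx xB sB; rewrite -lee_fin nrmsE //; apply: mt_stepS_le => [|k s as_].
  by rewrite -nrmsE // lee_fin.
have := sB k s as_; rewrite -lee_fin EFinM -sumEFin.
rewrite (eq_bigr (fun a => N t (restrict_to a.2 x))) // => a _.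
by rewrite nrmsE //; exact: c00_restrict.
Qed.

Lemma nrms_nrm t x : c00 x -> nrms t x <= nrm x.
Proof.
by move=> cx; rewrite -lee_fin nrmsE // nrmE //; apply: ereal_sup_ubound; exists t.
Qed.

Lemma nrm_le x B : c00 x -> (forall t, nrms t x <= B) -> nrm x <= B.
Proof.
move=> cx xB; rewrite -lee_fin nrmE //; apply: ge_ereal_sup => _ [t _ <-].
by rewrite -/(N t x) -nrmsE // lee_fin.
Qed.

Lemma nrm_ge x i : c00 x -> `|x i| <= nrm x.
Proof. by move=> cx; apply: le_trans (nrms_nrm 0 cx); exact: nrms_ge. Qed.

Lemma nrm_ge0 x : c00 x -> 0 <= nrm x.
Proof. by move=> cx; apply: le_trans (nrm_ge 0 cx). Qed.

Lemma nrm_approx x e : c00 x -> 0 < e -> exists t, nrm x - e <= nrms t x.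
Proof.
move=> cx e0; apply: contrapT => no; suff : nrm x <= nrm x - e by lra.
apply: nrm_le => // t; rewrite leNgt; apply/negP => lt_t; apply: no; exists t.
exact: ltW.
Qed.

(** The levels increase, so a single level is nearly optimal for finitely many sets at once. This
    lets the level-wise inequality [nrms_adm] pass to the norm itself. *)
Lemma nrm_approx_seq (F : seq {fset nat}) x e : c00 x -> 0 < e -> exists t,
  \sum_(E <- F) nrm (restrict_to E x) - e <= \sum_(E <- F) nrms t (restrict_to E x).
Proof.
move=> cx; elim: F e => [|E F IH] e e0.
  by exists 0%N; rewrite !big_nil; lra.
have e2 : 0 < e / 2 by rewrite divr_gt0.
have [t1 tF] := IH _ e2.
have [t2 tE] := nrm_approx (c00_restrict E cx) e2.
exists (maxn t1 t2); rewrite !big_cons.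
have := nrms_le (c00_restrict E cx) (leq_maxr t1 t2).
have : \sum_(E <- F) nrms t1 (restrict_to E x) <=
    \sum_(E <- F) nrms (maxn t1 t2) (restrict_to E x).
  by apply: ler_sum => G _; apply: nrms_le; [exact: c00_restrict|exact: leq_maxl].
by lra.
Qed.

Lemma nrm_adm x k s : c00 x -> adm (M k) s ->
  theta k * \sum_(a <- s) nrm (restrict_to a.2 x) <= nrm x.
Proof.
move=> cx as_; have /andP[t0 t1] := theta01 k.
apply/ler_addgt0Pr => e e0.
have [t] := nrm_approx_seq (map snd s) cx e0; rewrite !big_map => le_t.
have := nrms_adm t cx as_; have := nrms_nrm t.+1 cx.
move: le_t; set A := \sum_(_ <- _) _; set B := \sum_(_ <- _) _ => AB le1 le2.
apply: le_trans (_ : theta k * (B + e) <= _); first by rewrite ler_wpM2l ?(ltW t0) //; lra.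
rewrite mulrDr; apply: lerD; first exact: le_trans le1.
by rewrite ler_piMl // ltW.
Qed.

Lemma nrms_mono t x y : c00 y -> (forall i, `|x i| <= `|y i|) -> nrms t x <= nrms t y.
Proof.
elim: t x y => [|t IH] x y cy xy.
  have cx : c00 x.
    have [K yK] := cy; exists K => i /yK yi; apply/eqP.
    by rewrite -normr_le0 (le_trans (xy i)) // yi normr0.
  by apply: nrms0_le => // i; apply: le_trans (xy i) _; exact: nrms_ge.
have cx : c00 x.
  have [K yK] := cy; exists K => i /yK yi; apply/eqP.
  by rewrite -normr_le0 (le_trans (xy i)) // yi normr0.
apply: nrmsS_le => // [|k s as_].
  by apply: le_trans (nrmsS _ cy); exact: IH.
apply: le_trans (nrms_adm t cy as_); have /andP[t0 _] := theta01 k.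
rewrite ler_wpM2l ?(ltW t0) //; apply: ler_sum => a _.
apply: IH; first exact: c00_restrict.
by move=> i; rewrite /restrict_to; case: ifP.
Qed.

Lemma nrm_mono x y : c00 y -> (forall i, `|x i| <= `|y i|) -> nrm x <= nrm y.
Proof.
move=> cy xy; have cx : c00 x.
  have [K yK] := cy; exists K => i /yK yi; apply/eqP.
  by rewrite -normr_le0 (le_trans (xy i)) // yi normr0.
by apply: nrm_le => // t; apply: le_trans (nrms_nrm t cy); exact: nrms_mono.
Qed.

Lemma c00D x y : c00 x -> c00 y -> c00 (fun i => x i + y i).
Proof.
move=> [K xK] [L yL]; exists (maxn K L) => i; rewrite geq_max => /andP[Ki Li].
by rewrite xK // yL // addr0.
Qed.

Lemma nrms_triangle t x y : c00 x -> c00 y ->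
  nrms t (fun i => x i + y i) <= nrms t x + nrms t y.
Proof.
elim: t x y => [|t IH] x y cx cy; have cxy := c00D cx cy.
  apply: nrms0_le => // i; apply: le_trans (ler_normD _ _) _.
  by apply: lerD; exact: nrms_ge.
apply: nrmsS_le => // [|k s as_].
  by apply: le_trans (IH _ _ cx cy) _; apply: lerD; exact: nrmsS.
have /andP[t0 _] := theta01 k.
apply: le_trans (lerD (nrms_adm t cx as_) (nrms_adm t cy as_)).
rewrite -mulrDr -big_split /= ler_wpM2l ?(ltW t0) //; apply: ler_sum => a _.
rewrite (_ : restrict_to a.2 _ =
  (fun i => restrict_to a.2 x i + restrict_to a.2 y i)).
  by apply: IH; exact: c00_restrict.
by apply/funext => i; rewrite /restrict_to; case: ifP; rewrite ?addr0.
Qed.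

Lemma nrms_zero t : nrms t (fun _ => 0) = 0.
Proof.
have c0 : c00 (fun _ : nat => 0 : R^o) by exists 0%N.
apply/le_anti; rewrite nrms_ge0 // andbT; elim: t => [|t IH].
  by apply: nrms0_le => // i; rewrite normr0.
apply: nrmsS_le => // k s _; rewrite big1 ?mulr0 // => a _; apply/le_anti.
rewrite (_ : restrict_to _ _ = (fun=> 0)) ?IH ?nrms_ge0 //.
by apply/funext => i; rewrite /restrict_to; case: ifP.
Qed.

Lemma nrm_unit x i : (forall j, j != i -> x j = 0) -> nrm x = `|x i|.
Proof.
move=> xi; have cx : c00 x.
  by exists i.+1 => j ij; apply: xi; rewrite neq_ltn ij orbT.
apply/le_anti; rewrite nrm_ge // andbT; apply: nrm_le => // t.
elim: t => [|t IH].
  apply: nrms0_le => // j; have [->//|/xi ->] := eqVneq j i.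
  by rewrite normr0.
apply: nrmsS_le => // k s as_; have /andP[t0 t1] := theta01 k.
apply: le_trans (_ : 1 * `|x i| <= _); last by rewrite mul1r.
apply: ler_pM => //; [exact: ltW| |exact: ltW|].
  by apply: sumr_ge0 => a _; apply: nrms_ge0; exact: c00_restrict.
have -> : \sum_(a <- s) nrms t (restrict_to a.2 x) =
    nrms t x *+ count (fun a : nat * {fset nat} => i \in a.2) s.
  rewrite -iter_addr_0 -big_const_seq [RHS]big_mkcond /=; apply: eq_bigr => a _.
  case: ifP => ia; last rewrite -(nrms_zero t).
    congr nrms; apply/funext => j; rewrite /restrict_to; case: ifP => // ja.
    by rewrite xi //; apply: contraFneq ja => ->.
  congr nrms; apply/funext => j; rewrite /restrict_to; case: ifP => // ja.
  by rewrite xi //; apply: contraFneq ia => <-.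
apply: le_trans IH; have := adm_count i as_; case: (count _ _) => [|[|//]] _.
  by rewrite mulr0n nrms_ge0.
by rewrite mulr1n.
Qed.

End Norm.

(** * Admissible families on spread-out blocks *)

Lemma fset_min (A : {fset nat}) : A != fset0 ->
  exists2 m, m \in A & forall x, x \in A -> (m <= x)%N.
Proof.
move=> /fset0Pn A0; exists (ex_minn A0); first by case: ex_minnP.
by move=> x; case: ex_minnP => m _; exact.
Qed.

Lemma fset_max (A : {fset nat}) : A != fset0 ->
  exists2 m, m \in A & forall x, x \in A -> (x <= m)%N.
Proof.
move=> /fset0Pn A0; have [N AN] := seq_bound id A.
exists (ex_maxn A0 AN); first by case: ex_maxnP.
by move=> x; case: ex_maxnP => m _; exact.
Qed.

Fixpoint alternate (T : Type) (s : seq T) : seq T :=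
  if s is a :: s' then a :: (if s' is _ :: s'' then alternate s'' else [::])
  else [::].

Lemma alternate_ind (T : Type) (P : seq T -> Prop) :
  P [::] -> (forall a, P [:: a]) -> (forall a b s, P s -> P (a :: b :: s)) ->
  forall s, P s.
Proof.
move=> P0 P1 P2 s; have [n le_n] := ubnP (size s).
elim: n s le_n => [//|n IH] [|a [|b s]] //= le_n.
by apply: P2; apply: IH; rewrite ltnW.
Qed.

Lemma alternate_size (T : Type) (s : seq T) : (size s <= (size (alternate s)).*2)%N.
Proof. by elim/alternate_ind: s => [//|//|a b s IH] /=; rewrite doubleS !ltnS. Qed.

Lemma alternate_subseq (T : eqType) (s : seq T) : subseq (alternate s) s.
Proof.
elim/alternate_ind: s => [//|a|a b s IH]; first by rewrite /= eqxx.
have : subseq (alternate s) (b :: s) := subseq_trans IH (subseq_cons s b).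
change (subseq (alternate s) (b :: s) ->
  subseq ([:: a] ++ alternate s) ([:: a] ++ (b :: s))).
exact: cat_subseq.
Qed.

(** Keeping every second term replaces a relation between neighbours by its composite with the next
    one. The price, [alternate_size], is the factor 2 in the number of cut blocks. *)
Lemma alternate_pairwise (T : eqType) (P Q : rel T) (s : seq T) :
  (forall a b c, P a b -> P b c -> Q a c) ->
  pairwise P s -> pairwise Q (alternate s).
Proof.
move=> PQ; elim/alternate_ind: s => [//|//|a b s IH] /=.
move=> /andP[/andP[ab _] /andP[bs ps]]; rewrite IH // andbT.
apply/allP => c /(mem_subseq (alternate_subseq s)) cs.
by apply: PQ ab _; move/allP: bs; apply.
Qed.

Section UpperCombinatorics.
Variables (M : set {fset nat}) (n : nat).
Hypothesis hM : hereditary_family M.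
Hypothesis iM : has_index M n.

(* The set H collects the blocks in which some member of the family starts. *)
Lemma admissible_blocks : exists g : nat -> nat,
  forall (S : {fset nat}) (beta : nat -> nat),
  (forall x y, x \in S -> y \in S -> (x <= y)%N -> (beta x <= beta y)%N) ->
  (forall x y, x \in S -> y \in S -> (beta x < beta y)%N -> (g x <= y)%N) ->
  forall s, adm M s -> exists H : seq nat,
  let J := [seq [fset x in a.2 | (x \in S) && (beta x \notin H)]%fset | a : nat * {fset nat} <- s] in
  [/\ (size H <= n.*2)%N, forall i, i \in H -> exists2 x, x \in S & beta x = i,
      (count (fun A => A != fset0) J <= n)%N &
      pairwise (fun A B : {fset nat} =>
        all (fun x => all (fun y => beta x < beta y)%N B) A) J].
Proof.
have [g gP] := rank_chain hM iM; exists g => S beta mono spread s as_.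
have /boolp.choice[mu muP] (A : {fset nat}) : exists m, A != fset0 ->
    m \in A /\ forall x, x \in A -> (m <= x)%N.
  have [->|/fset_min[m mA le_m]] := eqVneq A fset0.
    by exists 0%N.
  by exists m.
pose m_ (a : nat * {fset nat}) := mu (a.2 `&` S)%fset.
pose touch (a : nat * {fset nat}) := (a.2 `&` S)%fset != fset0.
pose f a := beta (m_ a).
have mP a : touch a -> [/\ m_ a \in a.2, m_ a \in S &
    forall x, x \in a.2 -> x \in S -> (m_ a <= x)%N].
  move=> /muP[]; rewrite inE => /andP[mA mS] le_m; split=> // x xA xS.
  by apply: le_m; rewrite inE xA.
have touchP a x : x \in a.2 -> x \in S -> touch a.
  by move=> xA xS; apply/fset0Pn; exists x; rewrite inE xA.
pose s1 := [seq a <- s | touch a].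
pose H := undup (map f s1).
have fH a : a \in s -> touch a -> f a \in H.
  by move=> sa ta; rewrite mem_undup; apply: map_f; rewrite mem_filter ta.
(* Each set is represented by its start and its first point in [S]. Then [rank_chain] limits the
   number of sets whose starts lie far beyond the first points of the earlier ones. *)
have chain s' : subseq s' s -> all touch s' ->
    pairwise (fun a b => (g (m_ a) <= b.1) && (m_ a < b.1))%N s' -> (size s' <= n)%N.
  move=> ss tch pw; rewrite -(size_map (fun a => (a.1, m_ a))).
  have [Ms sn _] := adm_sub hM ss as_; apply: gP.
  - apply/allP => _ /mapP[a sa ->] /=; have /allP/(_ a sa)/andP[_ /allP] := sn.
    by apply; have /allP/(_ a sa)/mP[] := tch.
  - by rewrite pairwise_map.
  - apply: hM Ms _; apply/fsubsetP => x /imfsetP[_ /= /mapP[a sa ->] ->].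
    by rewrite in_fset; exact: map_f.
pose before a b := below a b && all (fun x => all (fun y => x < y)%N b.2) a.2.
have pw_before s' : subseq s' s -> pairwise before s'.
  move=> /(adm_sub hM)/(_ as_) as'; rewrite pairwise_relI (adm_lt as') andbT.
  by case: as'.
pose F (a : nat * {fset nat}) : {fset nat} :=
  [fset x in a.2 | (x \in S) && (beta x \notin H)]%fset.
have FP a x : x \in F a -> [/\ x \in a.2, x \in S & beta x \notin H].
  by rewrite !inE => /and3P[].
(* The block of the first point of [a] is in [H], whereas [F a] avoids [H]. Hence [F a] lies in
   strictly later blocks, a full gap beyond [m_ a]. *)
have Fbeta a x : a \in s -> x \in F a -> (f a < beta x)%N.
  move=> sa /FP[xa xS xH]; have ta := touchP a x xa xS; have [ma maS le_m] := mP a ta.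
  rewrite ltn_neqAle mono ?le_m // andbT; apply: contraNneq xH => <-; exact: fH.
exists H; split.
(* One set [a] is kept for each block of [H], so that the values [f a] become strictly increasing
   along [s3]. *)
- have /subseqP[msk _ Hmsk] := undup_subseq (map f s1).
  rewrite -/H -map_mask in Hmsk; set s3 := mask msk s1 in Hmsk.
  have ss3 : subseq s3 s1 by exact: mask_subseq.
  have ss : subseq s3 s by apply: subseq_trans ss3 (filter_subseq _ _).
  have t3 : all touch s3.
    by apply/allP => a /(mem_subseq ss3); rewrite mem_filter => /andP[].
  have pw3 : pairwise (fun a b => [&& touch a, touch b, before a b & f a < f b]%N) s3.
    have : pairwise (fun a b => before a b && (f a != f b)) s3.
      rewrite pairwise_relI pw_before // -(pairwise_map f (fun x y => x != y)).
      by rewrite -uniq_pairwise -Hmsk undup_uniq.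
    apply: (sub_in_pairwise _ t3) => a b ta tb /andP[ab fab].
    rewrite [touch a]ta [touch b]tb ab /= ltn_neqAle fab /=.
    have [ma maS _] := mP a ta; have [mb mbS _] := mP b tb.
    have /andP[_ /allP/(_ _ ma)/allP/(_ _ mb) lt_ab] := ab.
    by rewrite mono // ltnW.
  rewrite Hmsk size_map; apply: leq_trans (alternate_size _) _; rewrite leq_double.
  apply: chain; first exact: subseq_trans (alternate_subseq _) ss.
    by apply/allP => a /(mem_subseq (alternate_subseq _)); apply/allP.
  (* Between [a] and [b] only the first points are a gap apart; the start [b.1] may come right after
     [a]. The start [c.1] lies beyond [m_ b], hence beyond [g (m_ a)]. *)
  apply: alternate_pairwise pw3 => a b c /and4P[ta tb /andP[_ ab] fab].
  move=> /and4P[_ _ /andP[bc _] _].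
  have [ma maS _] := mP a ta; have [mb mbS _] := mP b tb.
  have /allP/(_ _ mb) ltb := bc; have /allP/(_ _ ma)/allP/(_ _ mb) lta := ab.
  apply/andP; split; last exact: ltn_trans ltb.
  exact: leq_trans (spread _ _ maS mbS fab) (ltnW ltb).
- move=> i; rewrite mem_undup => /mapP[a]; rewrite mem_filter => /andP[ta _] ->.
  by have [_ mS _] := mP a ta; exists (m_ a).
- rewrite count_map -size_filter; set s2 := seq.filter _ s.
  have ss2 : subseq s2 s by exact: filter_subseq.
  have F2 : all (fun a => (F a != fset0) && (a \in s)) s2.
    by apply/allP => a; rewrite mem_filter .
  apply: chain => //.
    by apply: sub_all F2 => a /andP[/fset0Pn[x /FP[xa xS _]] _]; exact: touchP xa xS.
  apply: (sub_in_pairwise _ F2) (pw_before _ ss2).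
  move=> a b /andP[/fset0Pn[x xF] sa] _ /andP[/allP ab _].
  have [xa xS xH] := FP _ _ xF; have [ma maS le_m] := mP a (touchP a x xa xS).
  have lt_x := ab _ xa; apply/andP; split; last exact: ab.
  by apply: leq_trans (ltnW lt_x); apply: spread => //; exact: Fbeta.
- rewrite pairwise_map; have sall : all (mem s) s by apply/allP.
  apply: (sub_in_pairwise _ sall) (pw_before _ (subseq_refl s)).
  move=> a b sa sb /andP[_ /allP ab]; apply/allP => x xF; apply/allP => y yF.
  have [xa xS xH] := FP _ _ xF; have [yb yS yH] := FP _ _ yF.
  apply: leq_ltn_trans (Fbeta _ _ sb yF).
  have [mb mbS _] := mP b (touchP b y yb yS); apply: mono => //.
  by apply/ltnW; have /allP := ab _ xa; apply.
Qed.
End UpperCombinatorics.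

(** * One-step norm inequalities on spread-out sets *)

Section NormEstimates.
Context (R : realType) (l : nat) (M : 'I_l -> set {fset nat}) (theta : 'I_l -> R)
  (n : 'I_l -> nat).
Hypothesis theta01 : forall k, 0 < theta k < 1.
Hypothesis hM : forall k, hereditary_family (M k).
Hypothesis n_gt0 : forall k, (0 < n k)%N.
Hypothesis iM : forall k, has_index (M k) (n k).
Implicit Types (x y : nat -> R^o) (k : 'I_l) (S F A : {fset nat}).

Notation nrms := (nrms M theta).
Notation nrm := (nrm M theta).

Lemma restrict0 x : restrict_to fset0 x = (fun _ => 0).
Proof. by apply/funext => i; rewrite /restrict_to inE. Qed.

Lemma nrms_sub t x A S : (A `<=` S)%fset ->
  nrms t (restrict_to A x) <= nrms t (restrict_to S x).
Proof.
move=> /fsubsetP AS; apply: nrms_mono => //; first exact: c00_restrict_fset.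
move=> i; rewrite /restrict_to; case: ifP => [/AS->//|_].
by rewrite normr0.
Qed.

Lemma nrm_sub x A S : (A `<=` S)%fset ->
  nrm (restrict_to A x) <= nrm (restrict_to S x).
Proof.
move=> /fsubsetP AS; apply: nrm_mono => //; first exact: c00_restrict_fset.
move=> i; rewrite /restrict_to; case: ifP => [/AS->//|_].
by rewrite normr0.
Qed.

Lemma nrms_cover t x A (G : seq {fset nat}) :
  (forall i, i \in A -> exists2 B, B \in G & i \in B) ->
  nrms t (restrict_to A x) <= \sum_(B <- G) nrms t (restrict_to B x).
Proof.
elim: G A => [|B G IH] A AG.
  suff -> : A = fset0 by rewrite restrict0 nrms_zero // big_nil.
  by apply/fsetP => i; rewrite inE; apply/negP => /AG[].
rewrite big_cons.
have -> : restrict_to A x =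
    (fun i => restrict_to (A `&` B)%fset x i + restrict_to (A `\` B)%fset x i).
  apply/funext => i; rewrite /restrict_to !inE.
  by case: (i \in A); case: (i \in B); rewrite ?addr0 ?add0r.
have := nrms_triangle M theta01 t (c00_restrict_fset (A `&` B)%fset x)
  (c00_restrict_fset (A `\` B)%fset x).
move=> /le_trans; apply; apply: lerD; first by apply: nrms_sub; exact: fsubsetIr.
apply: IH => i; rewrite inE => /andP[iB /AG[C]]; rewrite inE => /orP[/eqP->|CG iC].
  by rewrite (negbTE iB).
by exists C.
Qed.

(* The blocks in H are those in which some member of the admissible family
   starts: an admissible sum over one of them is at most its norm, so that the
   factor theta k is only needed for the remaining sets in J. *)
Lemma up_step : exists g : nat -> nat,
  forall S (beta : nat -> nat),
  (forall i j, i \in S -> j \in S -> (i <= j)%N -> (beta i <= beta j)%N) ->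
  (forall i j, i \in S -> j \in S -> (beta i < beta j)%N -> (g i <= j)%N) ->
  forall x t B, nrms t (restrict_to S x) <= B ->
  (forall k (H : seq nat) (J : seq {fset nat}),
    (size H <= (n k).*2)%N -> (forall b, b \in H -> exists2 i, i \in S & beta i = b) ->
    (size J <= n k)%N -> (forall F, F \in J -> (F `<=` S)%fset) ->
    pairwise (fun F G : {fset nat} =>
      all (fun i => all (fun j => beta i < beta j)%N G) F) J ->
    \sum_(b <- H) nrm (restrict_to [fset i in S | beta i == b]%fset x) +
      theta k * \sum_(F <- J) nrms t (restrict_to F x) <= B) ->
  nrms t.+1 (restrict_to S x) <= B.
Proof.
have /boolp.choice[g_ gP] k := admissible_blocks (@hM k) (iM k).
exists (fun i => \max_(k < l) g_ k i)%N => S beta mono spread x t B xB HJ.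
apply: nrmsS_le => // [|k s as_]; first exact: c00_restrict_fset.
have [|H /= [sH HS sJ pJ]] := gP k S beta mono _ s as_.
  move=> i j iS jS ij; apply: leq_trans _ (spread i j iS jS ij).
  exact: (leq_bigmax (F := fun k => g_ k i) k).
move: sJ pJ; set J := map _ s => sJ pJ.
have /andP[t0 t1] := theta01 k.
pose J' := [seq A <- J | A != fset0].
suff le_s : theta k * \sum_(a <- s) nrms t (restrict_to a.2 (restrict_to S x)) <=
    \sum_(b <- H) nrm (restrict_to [fset i in S | beta i == b]%fset x) +
      theta k * \sum_(F <- J') nrms t (restrict_to F x).
  apply: le_trans le_s (HJ k H J' sH HS _ _ _).
- by rewrite size_filter.
- move=> F; rewrite mem_filter => /andP[_ /mapP[a _ ->]].
  by apply/fsubsetP => i; rewrite !inE => /and3P[].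
- by apply: subseq_pairwise pJ; exact: filter_subseq.
pose Sb b := [fset i in S | beta i == b]%fset.
have -> : \sum_(F <- J') nrms t (restrict_to F x) =
    \sum_(F <- J) nrms t (restrict_to F x).
  rewrite big_filter [RHS](bigID (fun F => F != fset0)) /=.
  rewrite [X in _ = _ + X]big1 ?addr0 // => F /negPn/eqP->.
  by rewrite restrict0 nrms_zero.
apply: (@le_trans _ _ (\sum_(b <- H) (theta k *
    \sum_(a <- s) nrms t (restrict_to a.2 (restrict_to (Sb b) x))) +
    theta k * \sum_(F <- J) nrms t (restrict_to F x))); last first.
  rewrite lerD2r; apply: ler_sum => b _.
  apply: le_trans (nrms_adm theta01 t (c00_restrict_fset _ _) as_) _.
  by apply: nrms_nrm => //; exact: c00_restrict_fset.
rewrite -mulr_sumr -mulrDr ler_wpM2l ?(ltW t0) //.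
rewrite exchange_big /= /J big_map -big_split /=; apply: ler_sum => a _.
rewrite restrict_restrict.
apply: le_trans (nrms_cover t x (G := [fset i in a.2 | (i \in S) && (beta i \notin H)]%fset
   :: [seq (a.2 `&` Sb b)%fset | b <- H]) _) _.
  move=> i; rewrite inE => /andP[ia iS]; have [bH|bH] := boolP (beta i \in H).
    exists (a.2 `&` Sb (beta i))%fset; last by rewrite !inE ia iS eqxx.
    by rewrite inE; apply/orP; right; apply/mapP; exists (beta i).
  exists [fset i in a.2 | (i \in S) && (beta i \notin H)]%fset.
    by rewrite inE eqxx.
  by rewrite !inE ia iS.
rewrite big_cons big_map [leLHS]addrC; apply: lerD; last by [].
by apply: ler_sum => b _; rewrite restrict_restrict.
Qed.

(** The starts come from [spread_chain], applied to the minima and the maxima of the sets in [J]: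
    the gap [g] past one maximum leaves room for a legal start before the next minimum. *)
Lemma low_step k : exists (e : nat) (g : nat -> nat),
  forall (J : seq {fset nat}) S x, (size J <= n k)%N ->
  (forall F, F \in J -> (F `<=` S)%fset) ->
  (forall F, F \in J -> forall i, i \in F -> (e <= i)%N) ->
  pairwise (fun F G : {fset nat} =>
    all (fun i => all (fun j => g i <= j)%N G) F) J ->
  theta k * \sum_(F <- J) nrm (restrict_to F x) <= nrm (restrict_to S x).
Proof.
have [e [g egP]] := spread_chain (@hM k) (iM k) (n_gt0 k).
exists e, g => J S x sJ JS eJ pJ; have /andP[t0 t1] := theta01 k.
(* Empty sets have neither minimum nor maximum and are not allowed in an admissible family; they
   contribute zero to the sum. *)
wlog J0 : J sJ JS eJ pJ / forall F, F \in J -> F != fset0.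
  move=> wl; have -> : \sum_(F <- J) nrm (restrict_to F x) =
      \sum_(F <- [seq F <- J | F != fset0]) nrm (restrict_to F x).
    rewrite big_filter [LHS](bigID (fun F => F != fset0)) /=.
    rewrite [X in _ + X]big1 ?addr0 // => F /negPn/eqP->.
    apply/le_anti; rewrite restrict0 (nrm_ge0 M theta01) ?andbT; last by exists 0%N.
    apply: (nrm_le theta01); first by exists 0%N.
    by move=> t; rewrite nrms_zero.
  apply: wl.
  - by rewrite size_filter; apply: leq_trans (count_size _ _) sJ.
  - by move=> F; rewrite mem_filter => /andP[_]; exact: JS.
  - by move=> F; rewrite mem_filter => /andP[_]; exact: eJ.
  - by apply: subseq_pairwise pJ; exact: filter_subseq.
  - by move=> F; rewrite mem_filter => /andP[].
case: (posnP (size J)) => [/size0nil->|J_gt0].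
  by rewrite big_nil mulr0 nrm_ge0 //; exact: c00_restrict_fset.
have /boolp.choice[mn mnP] (A : {fset nat}) : exists m, A != fset0 ->
    m \in A /\ forall z, z \in A -> (m <= z)%N.
  have [->|/fset_min[m mA le_m]] := eqVneq A fset0; first by exists 0%N.
  by exists m.
have /boolp.choice[mx mxP] (A : {fset nat}) : exists m, A != fset0 ->
    m \in A /\ forall z, z \in A -> (z <= m)%N.
  have [->|/fset_max[m mA le_m]] := eqVneq A fset0; first by exists 0%N.
  by exists m.
pose F_ i := nth fset0 J i.
have FJ i : (i < size J)%N -> F_ i \in J by move=> ?; exact: mem_nth.
have mn_in i : (i < size J)%N -> mn (F_ i) \in F_ i /\ forall z, z \in F_ i -> (mn (F_ i) <= z)%N.
  by move=> /FJ/J0/mnP.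
have mx_in i : (i < size J)%N -> mx (F_ i) \in F_ i /\ forall z, z \in F_ i -> (z <= mx (F_ i))%N.
  by move=> /FJ/J0/mxP.
have [||||m [Mm mE Em]] := egP (mn \o F_) (mx \o F_) (size J).-1.
- by rewrite prednK.
- by have [mF _] := mn_in 0%N J_gt0; exact: (eJ _ (FJ _ J_gt0) _ mF).
- move=> i /= iJ; have iJ' : (i < size J)%N by lia.
  by have [mF _] := mn_in i iJ'; exact: ((mx_in i iJ').2 _ mF).
- move=> i /= iJ; have iJ' : (i.+1 < size J)%N by lia.
  have /(pairwiseP fset0)/(_ i i.+1 (ltnW iJ') iJ' (leqnn _))/allP := pJ.
  by move=> /(_ _ (mx_in i (ltnW iJ')).1)/allP/(_ _ (mn_in i.+1 iJ').1).
have aJ : admissible (M k) (fun i : 'I_(size J) => F_ i).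
  split=> [i|]; first exact: J0 (FJ _ (ltn_ord i)).
  exists (fun i => m i); split.
  - apply: hM Mm _; apply/fsubsetP => _ /imfsetP[i _ ->].
    rewrite in_fset; apply/mapP; exists (val i) => //.
    by rewrite mem_iota add0n prednK /=.
  - move=> i a aF; apply: leq_trans (mE i _) _; first by have := ltn_ord i; lia.
    exact: (mn_in i (ltn_ord i)).2.
  - move=> i j ji a aF; have iJ : (i < (size J).-1)%N by have := ltn_ord j; rewrite ji; lia.
    by rewrite ji; apply: leq_ltn_trans (Em i iJ); apply: (mx_in i (ltn_ord i)).2.
have [m' am'] := admissible_adm aJ.
have := nrm_adm theta01 (c00_restrict_fset S x) am'.
rewrite big_map big_enum /= => le_S; apply: le_trans le_S.
rewrite ler_wpM2l ?(ltW t0) // (big_nth fset0) big_mkord; apply: ler_sum => i _.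
rewrite restrict_restrict; suff -> : (F_ i `&` S)%fset = F_ i by [].
by apply/fsetIidPl; exact: JS (FJ _ (ltn_ord i)).
Qed.

End NormEstimates.

(** Young's inequality for the product of z^t and 1, with conjugate exponents 1/t and 1/(1-t). *)
Lemma powR_bernoulli (R : realType) (t z : R) : 0 < t < 1 -> 0 <= z ->
  z `^ t <= t * z + (1 - t).
Proof.
move=> /andP[t0 t1] z0; have t1' : 0 < 1 - t by lra.
have := @conjugate_powR _ (z `^ t) 1 t^-1 (1 - t)^-1.
rewrite mulr1 !invrK -powRrM mulfV ?gt_eqF // powRr1 // powR1 mul1r.
move=> /(_ (powR_ge0 _ _) ler01 ltac:(by rewrite invr_gt0) ltac:(by rewrite invr_gt0)).
by rewrite addrC subrK mulrC; apply.
Qed.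

(** Each w_i^t lies below the tangent at the mean [m = W / n], namely m^t (t w_i / m + 1 - t).
    Summing gives at most m^t n, since the constant part [1 - t] is nonnegative and occurs at most
    [n] times. *)
Lemma powR_concave_sum (R : realType) (I : Type) (s : seq I) (w : I -> R) n (t : R) :
  0 < t < 1 -> (forall i, 0 <= w i) -> (size s <= n)%N ->
  \sum_(i <- s) w i `^ t <= n%:R `^ (1 - t) * (\sum_(i <- s) w i) `^ t.
Proof.
move=> /[dup] t01 /andP[t0 t1] w0 sn; set W := \sum_(i <- s) w i.
have W0 : 0 <= W by apply: sumr_ge0.
case: (posnP n) sn => [->|n0] sn.
  move: sn; rewrite leqn0 => /nilP s0; rewrite s0 big_nil mulr_ge0 ?powR_ge0 //.
have n0' : 0 < n%:R :> R by rewrite ltr0n.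
have [W_eq0|Wn0] := eqVneq W 0.
  rewrite (_ : \sum_(i <- s) _ = 0) ?mulr_ge0 ?powR_ge0 //.
  move: W_eq0; rewrite {}/W in W0 *; elim: (s) => [|i r IH]; first by rewrite !big_nil.
  rewrite !big_cons => /eqP; rewrite paddr_eq0 ?sumr_ge0 // => /andP[/eqP-> /eqP/IH->].
  by rewrite powR0 ?addr0 // gt_eqF.
have {Wn0}Wgt : 0 < W by rewrite lt_def Wn0.
pose m := W / n%:R; have m0 : 0 < m by rewrite divr_gt0.
have le_i i : w i `^ t <= m `^ t * (t * (w i / m) + (1 - t)).
  rewrite -{1}(divfK (lt0r_neq0 m0) (w i)) powRM ?(ltW m0) ?divr_ge0 ?(ltW m0) //.
  rewrite mulrC ler_wpM2l ?powR_ge0 // powR_bernoulli // divr_ge0 // ltW //.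
apply: le_trans (ler_sum _ (fun i _ => le_i i)) _.
rewrite -mulr_sumr big_split /= -mulr_sumr -mulr_suml -/W.
have -> : W / m = n%:R by rewrite /m; field; rewrite !gt_eqF.
have -> : n%:R `^ (1 - t) * W `^ t = m `^ t * n%:R.
  rewrite /m powRM ?invr_ge0 // -powR_inv1 // -powRrM mulN1r.
  rewrite -[X in _ = _ * X](powRr1 (ltW n0')) -mulrA -powRD; last first.
    by apply/implyP => _; rewrite gt_eqF.
  by rewrite mulrC addrC.
rewrite ler_wpM2l ?powR_ge0 // big_const_seq count_predT iter_addr_0.
have : (1 - t) *+ size s <= (1 - t) * n%:R.
  by rewrite -mulr_natr ler_wpM2l ?ler_nat //; lra.
lra.
Qed.

(** * Upper estimates by the number of blocks, with strict contraction *)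

Section UpperBlocks.
Context (R : realType) (l : nat) (M : 'I_l -> set {fset nat}) (theta : 'I_l -> R)
  (n : 'I_l -> nat).
Hypothesis theta01 : forall k, 0 < theta k < 1.
Hypothesis hM : forall k, hereditary_family (M k).
Hypothesis iM : forall k, has_index (M k) (n k).

Lemma sum_card_images (beta : nat -> nat) (J : seq {fset nat}) (B : {fset nat}) :
  (forall F, F \in J -> forall i, i \in F -> beta i \in B) ->
  pairwise (fun F G : {fset nat} =>
    all (fun i => all (fun j => beta i < beta j)%N G) F) J ->
  (\sum_(F <- J) #|` [fset beta i | i in F]%fset| <= #|` B|)%N.
Proof.
elim: J B => [|F J IH] B JB /=; first by rewrite big_nil.
move=> /andP[FJ pJ]; rewrite big_cons; set bF := [fset beta i | i in F]%fset.
have bFB : (bF `<=` B)%fset.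
  by apply/fsubsetP => _ /imfsetP[i /= iF ->]; apply: JB iF; rewrite inE eqxx.
rewrite -(cardfsID bF B) (fsetIidPr bFB) leq_add2l; apply: IH => // G GJ i iG.
rewrite !inE (JB G) ?andbT //; last by rewrite inE GJ orbT.
apply/imfsetP => -[j /= jF bij].
by have /allP/(_ G GJ)/allP/(_ j jF)/allP/(_ i iG) := FJ; rewrite bij ltnn.
Qed.

(** Induction on the level, over all subsets of [S0]. The blocks of [H] cost at most 2 n_k. The sets
    of [J] meet disjoint collections of blocks, so concavity reproduces the bound with the factor
    theta_k n_k^(1-t) < 1, which leaves room for the first cost. *)
Lemma upper_blocks (t : R) : 0 < t < 1 ->
  (forall k, theta k * (n k)%:R `^ (1 - t) < 1) ->
  exists (g : nat -> nat) (C : R), forall (S : {fset nat}) (beta : nat -> nat),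
  (forall i j, i \in S -> j \in S -> (i <= j)%N -> (beta i <= beta j)%N) ->
  (forall i j, i \in S -> j \in S -> (beta i < beta j)%N -> (g i <= j)%N) ->
  forall x : nat -> R^o,
  (forall b, nrm M theta (restrict_to [fset i in S | beta i == b]%fset x) <= 1) ->
  nrm M theta (restrict_to S x) <= C * #|` [fset beta i | i in S]%fset|%:R `^ t.
Proof.
move=> /[dup] t01 /andP[t0 t1] contr; have [g gP] := up_step theta01 hM iM.
pose eta k := theta k * (n k)%:R `^ (1 - t).
have eta_lt k : 0 < 1 - eta k by rewrite subr_gt0 contr.
(* Chosen so that 2 n_k + C eta_k <= C for every [k]; the summand 1 covers level zero, where
   coordinates are at most 1. *)
pose C := 1 + \sum_(k < l) (n k).*2%:R / (1 - eta k).
have C1 : 1 <= C by rewrite lerDl sumr_ge0 // => k _; rewrite divr_ge0 // ltW.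
have CP k : (n k).*2%:R + C * eta k <= C.
  suff : (n k).*2%:R / (1 - eta k) <= C.
    by rewrite ler_pdivrMr // mulrBr mulr1; lra.
  rewrite /C (bigD1 k) //= addrCA lerDl addr_ge0 // sumr_ge0 // => i _.
  by rewrite divr_ge0 // ltW.
exists g, C => S0 beta mono0 spread0 x S0x.
pose D (S : {fset nat}) : R := #|` [fset beta i | i in S]%fset|%:R.
have D0 S : 0 <= D S by [].
have D1 (S : {fset nat}) i : i \in S -> 1 <= D S `^ t.
  move=> iS; have <- : (1 : R) `^ t = 1 by rewrite powR1.
  apply: ge0_ler_powR; rewrite ?nnegrE ?(ltW t0) //.
  rewrite ler1n cardfs_gt0; apply/fset0Pn; exists (beta i).
  by apply/imfsetP; exists i.
apply: (nrm_le theta01); first exact: c00_restrict_fset.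
suff main u S : (S `<=` S0)%fset -> nrms M theta u (restrict_to S x) <= C * D S `^ t.
  by move=> u; exact: main.
elim: u S => [|u IH] S SS0.
  apply: nrms0_le => //; first exact: c00_restrict_fset.
  move=> i; rewrite /restrict_to; case: ifP => [iS|_]; last first.
    by rewrite normr0 mulr_ge0 ?powR_ge0 // (le_trans ler01).
  apply: (@le_trans _ _ 1); last by apply: mulr_ege1 => //; exact: D1 iS.
  apply: le_trans (S0x (beta i)).
  have := @nrm_ge _ _ M _ theta01 _ i (c00_restrict_fset [fset j in S0 | beta j == beta i]%fset x).
  by rewrite {1}/restrict_to !inE eqxx (fsubsetP SS0 _ iS).
have inS0 i : i \in S -> i \in S0 by move/fsubsetP: SS0; exact.
apply: gP.
- by move=> i j /inS0 iS /inS0 jS; exact: mono0.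
- by move=> i j /inS0 iS /inS0 jS; exact: spread0.
- exact: IH.
move=> k H J sH HS sJ JS pJ; have /andP[th0 th1] := theta01 k.
have [S_eq0|[i0 i0S]] := fset_0Vmem S.
  case: H sH HS => [|b H] sH HS; last first.
    by have [i] := HS b (mem_head _ _); rewrite S_eq0 inE.
  rewrite big_nil add0r big1_seq ?mulr0 ?mulr_ge0 ?powR_ge0 ?(le_trans ler01 C1) //.
  move=> F /JS; rewrite S_eq0 fsubset0 => /eqP->; rewrite restrict0.
  exact: nrms_zero.
apply: le_trans (_ : (n k).*2%:R * D S `^ t + C * eta k * D S `^ t <= _); last first.
  by rewrite -mulrDl ler_wpM2r ?powR_ge0.
apply: lerD.
  apply: (@le_trans _ _ (\sum_(b <- H) 1)).
    apply: ler_sum => b _; apply: le_trans (S0x b); apply: nrm_sub => //.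
    by apply/fsubsetP => i; rewrite !inE => /andP[/inS0-> ->].
  rewrite big_const_seq count_predT iter_addr_0.
  apply: (@le_trans _ _ (n k).*2%:R); first by rewrite ler_nat.
  by rewrite ler_peMr // (D1 _ _ i0S).
rewrite /eta mulrCA -!mulrA ler_wpM2l ?(ltW th0) //.
apply: (@le_trans _ _ (\sum_(F <- J) C * D F `^ t)).
  rewrite !big_seq; apply: ler_sum => F /JS FS; apply: IH; exact: fsubset_trans SS0.
rewrite -mulr_sumr ler_wpM2l ?(le_trans ler01 C1) //.
apply: le_trans (powR_concave_sum t01 (fun F => D0 F) sJ) _.
rewrite ler_wpM2l ?powR_ge0 //; apply: ge0_ler_powR; rewrite ?nnegrE ?(ltW t0) //.
  exact: sumr_ge0.
rewrite /D -natr_sum ler_nat; apply: sum_card_images => // F /JS FS i iF.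
by apply/imfsetP; exists i => //; move/fsubsetP: FS; exact.
Qed.
End UpperBlocks.

(** * Lower estimates *)

(* Lower l_p estimate.  The masses p_b partition [0, 1]; every piece of length
   p_b contains an n-adic interval [k_b / n ^ d_b, (k_b + 1) / n ^ d_b] with
   n ^ - d_b >= p_b / 2n, and the n-ary tree of these intervals gives the
   functional that sums theta ^ d_b * a_b. *)
Section LowerEstimate.
Context (R : realType) (nu : {fset nat} -> R) (a : nat -> R) (B n : nat)
  (theta t : R).
Hypothesis n_gt1 : (1 < n)%N.
Hypothesis t01 : 0 < t < 1.
Hypothesis theta_gt0 : 0 < theta.
Hypothesis theta_t : n%:R `^ t = n%:R * theta.
Hypothesis nu_ge0 : forall S, 0 <= nu S.
Hypothesis a_ge0 : forall b, 0 <= a b.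
Hypothesis nu_ge : forall S b, b \in S -> a b <= nu S.
Hypothesis nu_mono : forall A S, (A `<=` S)%fset -> nu A <= nu S.
Hypothesis nu_split : forall (J : seq {fset nat}) S, (size J <= n)%N ->
  (forall F, F \in J -> (F `<=` S)%fset) ->
  pairwise (fun F G : {fset nat} =>
    all (fun i => all (fun j => i < j)%N G) F) J ->
  theta * \sum_(F <- J) nu F <= nu S.

Section Tree.
Variables d k : nat -> nat.
Hypothesis dk : forall b b', (b < b')%N -> (b' < B)%N -> 0 < a b -> 0 < a b' ->
  ((k b).+1 * n ^ d b' <= k b' * n ^ d b)%N.

(** Membership of [b] in a node of the n-ary tree: the interval from k_b / n^(d_b) to (k_b + 1) /
    n^(d_b) is contained in the one from q / n^e to (q + 1) / n^e. *)
Let inQ (e q b : nat) : bool := [&& 0 < a b, (e <= d b)%N & (k b %/ n ^ (d b - e))%N == q].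
Let Q (e q : nat) : {fset nat} := [fset b in [seq b <- iota 0 B | inQ e q b]]%fset.

Let n_gt0 : (0 < n)%N. Proof. exact: ltnW. Qed.

Let QP (e q b : nat) : (b \in Q e q) = (b < B)%N && inQ e q b.
Proof. by rewrite in_fset mem_filter mem_iota add0n /= andbC. Qed.

Let inQ_itv e q b : inQ e q b ->
  (q * n ^ (d b - e) <= k b < q.+1 * n ^ (d b - e))%N.
Proof.
move=> /and3P[_ _ /eqP<-]; rewrite leq_divM /= mulSn addnC.
rewrite {1}(divn_eq (k b) (n ^ (d b - e))) ltn_add2l.
by rewrite ltn_pmod // expn_gt0 n_gt0.
Qed.

(** The interval of [b] fills the whole node, so that of another member would lie inside it, against
    the disjointness expressed by [dk]. *)
Let Q_leaf e q b : b \in Q e q -> d b = e -> Q e q = [fset b]%fset.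
Proof.
rewrite QP => /andP[bB bQ] db; have /and3P[ab _ _] := bQ.
apply/fsetP => b'; rewrite inE; apply/idP/eqP => [|->]; last by rewrite QP bB.
rewrite QP => /andP[b'B b'Q]; have /and3P[ab' db' _] := b'Q.
have := inQ_itv bQ; have := inQ_itv b'Q.
rewrite db subnn expn0 !muln1 => /andP[le_k' lt_k'] /andP[le_k lt_k].
have Eq : k b = q by lia.
have En : (n ^ d b' = n ^ e * n ^ (d b' - e))%N by rewrite -expnD subnKC.
have ne : (0 < n ^ e)%N by rewrite expn_gt0 n_gt0.
have [bb'|b'b|//] := ltngtP b b'; exfalso.
  have := dk bb' b'B ab ab'; rewrite Eq db En mulnCA leqNgt => /negP; apply.
  by rewrite mulnC ltn_pmul2l.
have := dk b'b bB ab' ab; rewrite Eq db En mulnC mulnCA leq_pmul2l //; lia.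
Qed.

Let Q_before (e q r r' b b' : nat) : (r < r')%N ->
  b \in Q e.+1 (q * n + r)%N -> b' \in Q e.+1 (q * n + r')%N -> (b < b')%N.
Proof.
move=> rr'; rewrite !QP => /andP[bB bQ] /andP[b'B b'Q].
have /and3P[ab db _] := bQ; have /and3P[ab' db' _] := b'Q.
have /andP[_ lt_k] := inQ_itv bQ; have /andP[le_k' _] := inQ_itv b'Q.
have [//|b'b|Eb] := ltngtP b b'; exfalso; last first.
  move: lt_k le_k'; rewrite Eb => lt_k le_k'; have := leq_ltn_trans le_k' lt_k.
  by rewrite ltn_pmul2r ?expn_gt0 ?n_gt0 //; lia.
have := dk b'b bB ab' ab.
have En : (n ^ d b' = n ^ e.+1 * n ^ (d b' - e.+1))%N by rewrite -expnD subnKC.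
have En' : (n ^ d b = n ^ e.+1 * n ^ (d b - e.+1))%N by rewrite -expnD subnKC.
have p0 (c : nat) : (0 < n ^ c)%N by rewrite expn_gt0 n_gt0.
rewrite En En' !(mulnCA _ (expn n e.+1)) leq_pmul2l //.
move: lt_k le_k'; have := p0 (d b - e.+1)%N; have := p0 (d b' - e.+1)%N.
set u := expn n (d b - e.+1); set v := expn n (d b' - e.+1).
move=> v0 u0 lt_k le_k'; apply/negP; rewrite -ltnNge.
have h1 : (k b * v < ((q * n + r).+1 * u) * v)%N by rewrite ltn_pmul2r.
have h2 : ((q * n + r') * v * u <= k b' * u)%N by rewrite leq_pmul2r.
have h3 : ((q * n + r).+1 * u * v <= (q * n + r') * v * u)%N.
  by rewrite mulnAC leq_pmul2r // leq_pmul2r //; lia.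
rewrite mulSn; lia.
Qed.

(** Induction from the greatest depth upward: a node that is itself one of the intervals is a leaf,
    any other node splits into its [n] children at the cost of one factor [theta]. Indices with
    [a b = 0] belong to no node and add nothing to the sum. *)
Lemma tree_bound : (forall b, (b < B)%N -> 0 < a b -> ((k b).+1 <= n ^ d b)%N) ->
  \sum_(b < B) theta ^+ d b * a b <= nu [fset b in iota 0 B]%fset.
Proof.
move=> kd; have [D dD] := seq_bound d (iota 0 B).
have main j : forall e q, (e + j = D)%N ->
    \sum_(b < B | val b \in Q e q) theta ^+ (d b - e) * a b <= nu (Q e q).
  elim: j => [|j IH] e q eD.
    have [->|[b bQ]] := fset_0Vmem (Q e q).
      by rewrite big_pred0 // => b; rewrite inE.
    have db : d b = e.
      move: (bQ); rewrite QP => /andP[bB /and3P[_ ed _]]; apply/eqP.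
      by rewrite eqn_leq ed andbT -(addn0 e) eD dD // mem_iota.
    have bB : (b < B)%N by move: bQ; rewrite QP => /andP[].
    rewrite (Q_leaf bQ db) (bigD1 (Ordinal bB)) ?inE //= big_pred0.
      by rewrite addr0 db subnn expr0 mul1r nu_ge // inE.
    by move=> b'; rewrite inE; apply/negP => /andP[/eqP Eb /eqP[]]; apply: val_inj.
  have [[b bQ db]|no_leaf] := pselect (exists2 b, b \in Q e q & d b = e).
    have bB : (b < B)%N by move: bQ; rewrite QP => /andP[].
    rewrite (Q_leaf bQ db) (bigD1 (Ordinal bB)) ?inE //= big_pred0.
      by rewrite addr0 db subnn expr0 mul1r nu_ge // inE.
    by move=> b'; rewrite inE; apply/negP => /andP[/eqP Eb /eqP[]]; apply: val_inj.
  have Q_gt b : b \in Q e q -> (e < d b)%N.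
    move=> bQ; rewrite ltn_neqAle; apply/andP; split.
      by apply/eqP => db; apply: no_leaf; exists b.
    by move: bQ; rewrite QP => /andP[_ /and3P[]].
  have child b : (e < d b)%N -> (k b %/ n ^ (d b - e.+1) %/ n = k b %/ n ^ (d b - e))%N.
    by move=> ed; rewrite -divnMA -expnSr -subSn.
  pose J := [seq Q e.+1 (q * n + r)%N | r <- index_iota 0 n].
  apply: le_trans (nu_split (J := J) (S := Q e q) _ _ _).
  - pose p b := Ordinal (ltn_pmod (k b %/ n ^ (d b - e.+1)) n_gt0).
    rewrite big_map big_mkord mulr_sumr (partition_big (fun b : 'I_B => p b) xpredT) //=.
    apply: ler_sum => r _; apply: (@le_trans _ _ (theta *
        \sum_(b < B | val b \in Q e.+1 (q * n + r)%N) theta ^+ (d b - e.+1) * a b)).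
      rewrite mulr_sumr le_eqVlt; apply/orP; left; apply/eqP; apply: eq_big => b.
        rewrite -(inj_eq val_inj) /= !QP /inQ ltn_ord /=; case: (ltnP e (d b)) => [ed|].
          rewrite (ltnW ed) /= -child //.
          case: (0 < a b) => //=.
          rewrite {3}(divn_eq (k b %/ n ^ (d b - e.+1)) n).
          apply/andP/eqP => [[/eqP-> /eqP->]//|].
          have := ltn_pmod (k b %/ n ^ (d b - e.+1)) n_gt0; have := ltn_ord r.
          set u := (_ %/ n)%N; set v := (_ %% n)%N => rn vn Euv; split.
            have := congr1 (divn^~ n) Euv.
            by rewrite !divnMDl // (divn_small vn) (divn_small rn) !addn0 => ->.
          have := congr1 (modn^~ n) Euv.
          by rewrite !modnMDl (modn_small vn) (modn_small rn) => ->.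
        rewrite andbF /= => ed; apply/negP => /andP[bQ _].
        have := Q_gt b; rewrite QP ltn_ord => /(_ bQ); lia.
      move=> /andP[/Q_gt ed _]; rewrite mulrA -exprS; congr (_ ^+ _ * _); lia.
    by rewrite ler_wpM2l ?(ltW theta_gt0) //; apply: IH; lia.
  - by rewrite size_map size_iota subn0.
  - move=> _ /mapP[r + ->]; rewrite mem_index_iota /= => rn.
    apply/fsubsetP => b; rewrite !QP => /andP[-> /and3P[ab ed /eqP kr]] /=.
    by rewrite /inQ ab ltnW //= -child // kr divnMDl // divn_small ?addn0.
  - rewrite pairwise_map; apply: (@sub_pairwise _ ltn).
      move=> r r' rr'; apply/allP => b bQ; apply/allP => b' b'Q.
      exact: Q_before rr' bQ b'Q.
    by rewrite -sorted_pairwise; [exact: iota_ltn_sorted|exact: ltn_trans].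
apply: le_trans (_ : nu (Q 0 0) <= _); last first.
  apply: nu_mono; apply/fsubsetP => b; rewrite QP => /andP[bB _].
  by rewrite in_fset mem_iota.
apply: le_trans (main D 0%N 0%N (add0n D)).
rewrite [leLHS](bigID (fun b : 'I_B => val b \in Q 0 0)) /= [X in _ + X]big1 ?addr0.
  by apply: ler_sum => b _; rewrite subn0.
move=> b; rewrite QP ltn_ord /= /inQ leq0n subn0 /=.
have [ab|] := boolP (0 < a b); last by rewrite lt_def a_ge0 andbT negbK => /eqP->; rewrite mulr0.
by rewrite divn_small ?kd.
Qed.
End Tree.

(** Take the least [d] with p n^d >= 2. At this scale the piece has length at least 2, so it
    contains the unit interval that starts at the first integer above c n^d. Minimality gives p
    n^(d-1) < 2, whence the bound 2n. *)
Lemma nadic_subinterval (c p : R) : 0 <= c -> 0 < p <= 1 -> exists dk : nat * nat,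
  [/\ c * n%:R ^+ dk.1 <= dk.2%:R, dk.2.+1%:R <= (c + p) * n%:R ^+ dk.1 &
      p * n%:R ^+ dk.1 <= n.*2%:R].
Proof.
move=> c0 /andP[p0 p1]; have n0 : 0 < n%:R :> R by rewrite ltr0n ltnW.
have exd : exists d, 2 <= p * n%:R ^+ d.
  exists (Num.bound (2 / p)); rewrite mulrC -ler_pdivrMr // -natrX.
  have : (2 / p) < (Num.bound (2 / p))%:R by apply: archi_boundP; rewrite divr_ge0 // ltW.
  move=> /ltW/le_trans; apply; rewrite ler_nat; apply: ltnW; exact: ltn_expl.
have [d d2 min_d] := ex_minnP exd.
have xd : 0 <= c * n%:R ^+ d by rewrite mulr_ge0 // exprn_ge0 // ltW.
exists (d, (Num.truncn (c * n%:R ^+ d)).+1); split=> /=.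
- by have /andP[_ /ltW] := truncn_itv xd.
- rewrite mulrDl -addn2 natrD; apply: lerD => //.
  by have /andP[] := truncn_itv xd.
- case: d d2 min_d {xd} => [|d] d2 min_d.
    by rewrite expr0 mulr1; apply: le_trans p1 _; rewrite ler1n double_gt0 ltnW.
  have : ~~ (2 <= p * n%:R ^+ d) by apply/negP => /min_d; rewrite ltnn.
  rewrite -ltNge exprSr mulrA -muln2 natrM => /ltW h.
  by rewrite [leRHS]mulrC ler_wpM2r // ltW.
Qed.

Lemma lower_estimate :
  (\sum_(b < B) a b `^ t^-1) `^ t <= n.*2%:R `^ (1 - t) * nu [fset b in iota 0 B]%fset.
Proof.
have /andP[t0 t1] := t01; have n0 : 0 < n%:R :> R by rewrite ltr0n ltnW.
pose w b := a b `^ t^-1; pose W := \sum_(b < B) w b.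
have w0 b : 0 <= w b by exact: powR_ge0.
have W0 : 0 <= W by exact: sumr_ge0.
rewrite -/W; have [W_eq0|Wn0] := eqVneq W 0.
  by rewrite W_eq0 powR0 ?gt_eqF // mulr_ge0 ?powR_ge0.
have Wgt : 0 < W by rewrite lt_def Wn0.
pose p b := w b / W; have p0 b : 0 <= p b by rewrite divr_ge0.
pose C b := \sum_(0 <= i < b) p i.
have C0 b : 0 <= C b by exact: sumr_ge0.
have CS b : C b.+1 = C b + p b by rewrite /C big_nat_recr.
have Cle b b' : (b <= b')%N -> C b <= C b'.
  move=> /subnK <-; elim: (b' - b)%N => [//|j IH]; rewrite addSn CS.
  by apply: le_trans IH _; rewrite lerDl.
have CB : C B = 1 by rewrite /C big_mkord -mulr_suml -/W divff.
have pgt b : 0 < a b -> 0 < p b by move=> ab; rewrite divr_gt0 // powR_gt0.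
have ex_dk b : exists dk : nat * nat, (b < B)%N -> 0 < a b ->
    [/\ C b * n%:R ^+ dk.1 <= dk.2%:R, dk.2.+1%:R <= C b.+1 * n%:R ^+ dk.1 &
      p b * n%:R ^+ dk.1 <= n.*2%:R].
  have [/andP[bB ab]|no] := boolP ((b < B)%N && (0 < a b)); last first.
    by exists (0, 0)%N => bB ab; rewrite bB ab in no.
  have [|dk dkP] := @nadic_subinterval (C b) (p b) (C0 b).
    rewrite pgt //= -CB; apply: le_trans (Cle b.+1 B bB); rewrite CS.
    by rewrite lerDr.
  by exists dk => _ _; rewrite CS.
have /boolp.choice[dk dkP] := ex_dk.
have le_nu := @tree_bound (fun b => (dk b).1) (fun b => (dk b).2) _ _.
have {}le_nu : \sum_(b < B) theta ^+ (dk b).1 * a b <= nu [fset b in iota 0 B]%fset.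
  apply: le_nu => [b b' bb' b'B ab ab'|b bB ab].
    have [_ h _] := dkP b (ltn_trans bb' b'B) ab; have [h' _ _] := dkP b' b'B ab'.
    rewrite -(ler_nat R) !natrM !natrX.
    apply: (@le_trans _ _ (C b.+1 * n%:R ^+ (dk b).1 * n%:R ^+ (dk b').1)).
      by rewrite ler_wpM2r // exprn_ge0 // ltW.
    rewrite mulrAC ler_wpM2r ?exprn_ge0 ?(ltW n0) //; apply: le_trans h'.
    by rewrite ler_wpM2r ?exprn_ge0 ?(ltW n0) // Cle.
  have [_ h _] := dkP b bB ab; rewrite -(ler_nat R) natrX; apply: le_trans h _.
  by rewrite ler_piMl ?exprn_ge0 ?(ltW n0) // -CB Cle.
apply: le_trans (_ : n.*2%:R `^ (1 - t) * \sum_(b < B) theta ^+ (dk b).1 * a b <= _); last first.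
  by rewrite ler_wpM2l ?powR_ge0.
(* The masses [p b] add up to 1, so they distribute W^t over the indices and the comparison can be
   made term by term. *)
have -> : W `^ t = \sum_(b < B) W `^ t * p b.
  by rewrite -mulr_sumr /p -mulr_suml -/W divff // mulr1.
rewrite mulr_sumr; apply: ler_sum => b _.
have [ab|] := boolP (0 < a b); last first.
  rewrite lt_def a_ge0 andbT negbK => /eqP ab.
  by rewrite /p /w ab powR0 ?invr_eq0 ?gt_eqF // mul0r !mulr0.
have [_ _ pd] := dkP b (ltn_ord b) ab.
have Ea : a b = W `^ t * p b `^ t.
  rewrite -powRM // /p mulrC divfK // /w -powRrM mulVf ?gt_eqF // powRr1 //.
rewrite Ea (_ : _ * (_ * _) = W `^ t * (n.*2%:R `^ (1 - t) * theta ^+ (dk b).1 * p b `^ t));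
  last by ring.
rewrite ler_wpM2l ?powR_ge0 //.
rewrite -{1}(powRr1 (p0 b)) -{1}(subrK t 1) powRD; last first.
  by apply/implyP => _; rewrite gt_eqF // pgt.
rewrite ler_wpM2r ?powR_ge0 //.
(* Since theta = n^(t-1), the d-th power of [theta] is (n^(-d))^(1-t). The inequality for index [b]
   thus becomes p_b <= 2n / n^d raised to the power [1 - t]. *)
have Et : theta ^+ (dk b).1 = (n%:R ^+ (dk b).1)^-1 `^ (1 - t).
  have -> : theta = n%:R `^ (t - 1).
    rewrite powRB ?theta_t ?powRr1 ?(ltW n0) //; last first.
      by apply/implyP => _; rewrite gt_eqF.
    by rewrite mulrC mulKf ?gt_eqF.
  rewrite -[in RHS]powR_inv1 ?exprn_ge0 ?(ltW n0) // -powRrM mulN1r opprB.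
  rewrite -[LHS]powR_mulrn; last exact: powR_ge0.
  by rewrite -powRrM mulrC powRrM powR_mulrn // ltW.
rewrite Et -powRM ?invr_ge0 ?exprn_ge0 ?(ltW n0) //.
apply: ge0_ler_powR; rewrite ?nnegrE ?mulr_ge0 ?invr_ge0 ?exprn_ge0 ?(ltW n0) //.
  by rewrite subr_ge0 ltW.
by rewrite ler_pdivlMr // exprn_gt0.
Qed.
End LowerEstimate.

(** * Block sequences and their combinations *)

Definition comb (R : realType) (a : nat -> R) (u : nat -> nat -> R^o) B : nat -> R^o :=
  fun i => \sum_(b < B) a b * u b i.

Definition block_seq (R : realType) (g : nat -> nat) (u : nat -> nat -> R^o) : Prop :=
  (forall b, c00 (u b)) /\
  forall b b' i j, (b < b')%N -> u b i != 0 -> u b' j != 0 -> (i < j)%N /\ (g i <= j)%N.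

Section Blocks.
Context (R : realType) (g : nat -> nat) (u : nat -> nat -> R^o).
Hypothesis gu : block_seq g u.

Lemma block_uniq b b' i : u b i != 0 -> u b' i != 0 -> b = b'.
Proof.
by have [bb'|b'b|//] := ltngtP b b' => h h';
  [have [] := gu.2 b b' i i bb' h h'|have [] := gu.2 b' b i i b'b h' h]; rewrite ltnn.
Qed.

Lemma block_support B : exists (S : {fset nat}) (beta : nat -> nat),
  [/\ forall i, i \in S -> (beta i < B)%N /\ u (beta i) i != 0,
      forall b i, (b < B)%N -> u b i != 0 -> i \in S /\ beta i = b,
      forall i j, i \in S -> j \in S -> (i <= j)%N -> (beta i <= beta j)%N &
      forall i j, i \in S -> j \in S -> (beta i < beta j)%N -> (i < j)%N /\ (g i <= j)%N].
Proof.
have /boolp.choice[K KP] b : exists K, forall i, (K <= i)%N -> u b i = 0 by exact: (gu.1 b).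
have [L KL] := seq_bound K (iota 0 B).
(* When no block is nonzero at [i], [find] returns the length [B]; therefore [beta i < B] says
   exactly that [i] is in one of the first [B] supports. *)
pose beta i := find (fun b => u b i != 0) (iota 0 B).
have betaP b i : (b < B)%N -> u b i != 0 -> beta i = b.
  move=> bB ubi; have hs : has (fun b => u b i != 0) (iota 0 B).
    by apply/hasP; exists b => //; rewrite mem_iota.
  have := nth_find 0%N hs; rewrite nth_iota; last by rewrite -{2}(size_iota 0 B) -has_find.
  by rewrite add0n => /block_uniq; apply.
pose S := [fset i in [seq i <- iota 0 L | beta i < B]%N]%fset.
have SP i : (i \in S) = ((i < L)%N && (beta i < B)%N).
  by rewrite in_fset mem_filter mem_iota add0n /= andbC.
have inS b i : (b < B)%N -> u b i != 0 -> i \in S /\ beta i = b.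
  move=> bB ubi; rewrite SP (betaP b) // bB andbT; split=> //.
  rewrite ltnNge; apply: contra ubi => Li; rewrite KP //.
  by apply: leq_trans Li; apply: KL; rewrite mem_iota.
have Sbeta i : i \in S -> (beta i < B)%N /\ u (beta i) i != 0.
  rewrite SP => /andP[_ bB]; split=> //.
  have hs : has (fun b => u b i != 0) (iota 0 B) by rewrite has_find size_iota.
  by have := nth_find 0%N hs; rewrite nth_iota ?add0n.
have spread i j : i \in S -> j \in S -> (beta i < beta j)%N -> (i < j)%N /\ (g i <= j)%N.
  by move=> /Sbeta[_ ui] /Sbeta[_ uj] /gu.2; apply.
exists S, beta; split=> // i j iS jS ij; rewrite leqNgt; apply/negP => ji.
by have [] := spread j i jS iS ji; lia.
Qed.

Lemma comb_in a B b i : (b < B)%N -> u b i != 0 -> comb a u B i = a b * u b i.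
Proof.
move=> bB ubi; rewrite /comb (bigD1 (Ordinal bB)) //= big1 ?addr0 // => b' ne.
have [->|ub'] := eqVneq (u b' i) 0; first by rewrite mulr0.
by case/eqP: ne; apply: val_inj; exact: block_uniq ub' ubi.
Qed.

End Blocks.

Lemma c00_comb (R : realType) (a : nat -> R) (u : nat -> nat -> R^o) B :
  (forall b, c00 (u b)) -> c00 (comb a u B).
Proof.
move=> cu; elim: B => [|B IH].
  by exists 0%N => i _; rewrite /comb big_ord0.
have [K xK] := IH; have [L uL] := cu B; exists (maxn K L) => i.
rewrite geq_max => /andP[Ki Li]; rewrite /comb big_ord_recr /= uL // mulr0 addr0.
exact: xK.
Qed.

Section BlockNorms.
Context (R : realType) (l : nat) (M : 'I_l -> set {fset nat}) (theta : 'I_l -> R)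
  (n : 'I_l -> nat).
Hypothesis theta01 : forall k, 0 < theta k < 1.
Hypothesis hM : forall k, hereditary_family (M k).
Hypothesis n_gt0 : forall k, (0 < n k)%N.
Hypothesis iM : forall k, has_index (M k) (n k).
Implicit Types (x y : nat -> R^o) (k : 'I_l) (S F A : {fset nat}).

Notation nrms := (nrms M theta).
Notation nrm := (nrm M theta).

Lemma c00Z (c : R) x : c00 x -> c00 (fun i => c * x i : R^o).
Proof. by move=> [K xK]; exists K => i /xK->; rewrite mulr0. Qed.

Lemma nrm_scale (c : R) x : c00 x -> nrm (fun i => c * x i) = `|c| * nrm x.
Proof.
have le (d : R) y : c00 y -> nrm (fun i => d * y i) <= `|d| * nrm y.
  move=> cy; apply: (nrm_le theta01) => [|t]; first exact: c00Z.
  apply: le_trans (_ : `|d| * nrms t y <= _); last by rewrite ler_wpM2l ?nrms_nrm.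
  elim: t y cy => [|t IH] y cy.
    apply: nrms0_le => //; first exact: c00Z.
    by move=> i; rewrite normrM ler_wpM2l ?nrms_ge.
  apply: nrmsS_le => //; first exact: c00Z.
    by apply: le_trans (IH _ cy) _; rewrite ler_wpM2l ?nrmsS.
  move=> k s as_; have /andP[t0 _] := theta01 k.
  apply: le_trans (_ : `|d| * (theta k * \sum_(a <- s) nrms t (restrict_to a.2 y)) <= _).
    rewrite mulrCA ler_wpM2l ?(ltW t0) // mulr_sumr; apply: ler_sum => a _.
    apply: le_trans (IH _ (c00_restrict _ cy)); rewrite le_eqVlt; apply/orP; left.
    apply/eqP; congr nrms; apply/funext => i; rewrite /restrict_to.
    by case: ifP; rewrite ?mulr0.
  by rewrite ler_wpM2l // nrms_adm.
move=> cx; apply/le_anti; rewrite le //=.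
have [->|c0] := eqVneq c 0.
  by rewrite normr0 mul0r nrm_ge0 //; exact: c00Z.
rewrite mulrC -ler_pdivlMr ?normr_gt0 // mulrC -normfV.
apply: le_trans (le _ _ (c00Z c cx)); rewrite le_eqVlt; apply/orP; left; apply/eqP.
by congr nrm; apply/funext => i; rewrite mulKf.
Qed.

Lemma nrm_block g (u : nat -> nat -> R^o) (a : nat -> R) B b : block_seq g u -> (b < B)%N ->
  `|a b| * nrm (u b) <= nrm (comb a u B).
Proof.
move=> gu bB; rewrite -nrm_scale; last exact: gu.1.
apply: nrm_mono => //; first by apply: c00_comb; exact: gu.1.
move=> i; have [->|ubi] := eqVneq (u b i) 0; first by rewrite mulr0 normr0.
by rewrite (comb_in gu a bB ubi).
Qed.

(** [lower_estimate] is applied to the set function [nu A], the norm of the part of the combination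
    carried by the blocks indexed by [A]. The splitting inequality is [low_step], whose position and
    gap requirements are met by [e] and [block_seq g u]. *)
Lemma lower_blocks k (t : R) : (1 < n k)%N -> 0 < t < 1 ->
  (n k)%:R `^ t = (n k)%:R * theta k ->
  exists (e : nat) (g : nat -> nat) (c : R), 0 < c /\ forall u : nat -> nat -> R^o, block_seq g u ->
  (forall b i, u b i != 0 -> (e <= i)%N) -> forall (a : nat -> R) B,
  c * (\sum_(b < B) (`|a b| * nrm (u b)) `^ t^-1) `^ t <= nrm (comb a u B).
Proof.
move=> n1 t01 nt; have [e [g egP]] := low_step theta01 hM n_gt0 iM k.
have n2_gt0 : 0 < (n k).*2%:R `^ (1 - t) :> R.
  by rewrite powR_gt0 // ltr0n double_gt0.
exists e, g, ((n k).*2%:R `^ (1 - t))^-1; split; first by rewrite invr_gt0.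
move=> u gu ue a B; rewrite ler_pdivrMl //.
have [S [beta [Sb bS mono spread]]] := block_support gu B.
pose x := comb a u B; have cx : c00 x by apply: c00_comb; exact: gu.1.
pose Sof A := [fset i in S | beta i \in A]%fset.
have SofP A i : (i \in Sof A) = (i \in S) && (beta i \in A) by rewrite !inE.
pose nu A := nrm (restrict_to (Sof A) x).
have Sof_mono A A' : (A `<=` A')%fset -> (Sof A `<=` Sof A')%fset.
  move=> /fsubsetP AA'; apply/fsubsetP => i; rewrite !SofP => /andP[-> /AA'].
  by rewrite /=.
have /andP[th0 th1] := theta01 k.
(* Cut off at [B] because [lower_estimate] requires [nu_ge] for every index, also beyond the blocks
   that occur in [x]. *)
pose al b := `|if (b < B)%N then a b else 0| * nrm (u b).
have nu_ge0 A : 0 <= nu A by apply: nrm_ge0 => //; exact: c00_restrict_fset.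
have al_ge0 b : 0 <= al b by rewrite mulr_ge0 // nrm_ge0 //; exact: gu.1.
have nu_ge A b : b \in A -> al b <= nu A.
  rewrite /al => bA; case: ifP => [bB|_]; last by rewrite normr0 mul0r.
  rewrite -nrm_scale; last exact: gu.1.
  apply: nrm_mono => //; first exact: c00_restrict_fset.
  move=> i; have [->|ubi] := eqVneq (u b i) 0; first by rewrite mulr0 normr0.
  have [iS bi] := bS b i bB ubi.
  by rewrite /restrict_to SofP iS bi bA /= /x (comb_in gu a bB ubi).
have nu_mono A A' : (A `<=` A')%fset -> nu A <= nu A'.
  by move=> AA'; apply: nrm_sub => //; exact: Sof_mono.
have nu_split (J : seq {fset nat}) A : (size J <= n k)%N ->
    (forall F, F \in J -> (F `<=` A)%fset) ->
    pairwise (fun F G : {fset nat} =>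
      all (fun i => all (fun j => i < j)%N G) F) J ->
    theta k * \sum_(F <- J) nu F <= nu A.
  move=> sJ JA pJ; have := egP (map Sof J) (Sof A) x; rewrite big_map; apply.
  - by rewrite size_map.
  - by move=> _ /mapP[F FJ ->]; apply: Sof_mono; exact: JA.
  - by move=> _ /mapP[F FJ ->] i; rewrite SofP => /andP[/Sb[_ /ue]].
  - rewrite pairwise_map; apply: sub_pairwise pJ => F G /allP FG.
    apply/allP => i; rewrite SofP => /andP[iS iF].
    apply/allP => j; rewrite SofP => /andP[jS jG].
    by have [] := spread i j iS jS (allP (FG _ iF) _ jG).
have := lower_estimate B n1 t01 th0 nt nu_ge0 al_ge0 nu_ge nu_mono nu_split.
rewrite (eq_bigr (fun b : 'I_B => (`|a b| * nrm (u b)) `^ t^-1)); last first.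
  by move=> b _; rewrite /al ltn_ord.
move=> le_nu; apply: le_trans le_nu _.
rewrite ler_wpM2l ?powR_ge0 //; apply: nrm_mono => // i.
exact: normr_restrict.
Qed.

Lemma upper_flat (t : R) : 0 < t < 1 ->
  (forall k, theta k * (n k)%:R `^ (1 - t) < 1) ->
  exists (g : nat -> nat) (C : R), forall u : nat -> nat -> R^o, block_seq g u ->
  (forall b, nrm (u b) <= 1) -> forall B,
  nrm (comb (fun _ => 1) u B) <= C * B%:R `^ t.
Proof.
move=> /[dup] t01 /andP[t0 t1] ht; have [g [C gC]] := upper_blocks theta01 hM iM t01 ht.
exists g, (Num.max C 0) => u gu u1 B; have [S [beta [Sb bS mono spread]]] := block_support gu B.
have -> : comb (fun _ => 1) u B = restrict_to S (comb (fun _ => 1) u B).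
  apply/funext => i; rewrite /restrict_to; case: ifP => // iS.
  rewrite /comb big1 // => b _; have [->|ubi] := eqVneq (u b i) 0.
    by rewrite mulr0.
  by have [] := bS b i (ltn_ord b) ubi; rewrite iS.
apply: le_trans (gC S beta mono _ _ _) _.
- by move=> i j iS jS /(spread i j iS jS)[].
- move=> b; apply: le_trans (u1 b); apply: nrm_mono => //; first exact: gu.1.
  move=> i; rewrite /restrict_to !inE; case: ifP => [/andP[iS /eqP bi]|_].
    have [bB ui] := Sb i iS; rewrite (comb_in gu _ bB ui) mul1r bi //.
  by rewrite normr0.
- apply: (@le_trans _ _ (Num.max C 0 * #|` [fset beta i | i in S]%fset|%:R `^ t)).
    by rewrite ler_wpM2r ?powR_ge0 // le_max lexx.
  apply: ler_wpM2l; first by rewrite le_max lexx orbT.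
  apply: ge0_ler_powR; rewrite ?nnegrE ?(ltW t0) // ler_nat.
  apply: leq_trans (_ : #|` [fset b in iota 0 B]%fset| <= _)%N.
    apply: fsubset_leq_card; apply/fsubsetP => _ /imfsetP[i /= /Sb[iB _] ->].
    by rewrite in_fset mem_iota.
  by rewrite card_fseq undup_id ?iota_uniq // size_iota.
Qed.
End BlockNorms.

(** * Sequences equivalent to the unit basis of l_p *)

Section SumsOverFsets.
Context (R : realType).
Implicit Types (f : nat -> R) (A S : {fset nat}).

Lemma sum_fsub f A S : (A `<=` S)%fset ->
  \sum_(i <- A) f i = \sum_(i <- S | i \in A) f i.
Proof.
move=> /fsubsetP AS; rewrite -[RHS]big_filter; apply: perm_big.
apply: uniq_perm; rewrite ?filter_uniq ?fset_uniq // => i.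
by rewrite mem_filter; apply/idP/andP => [iA|[]//]; split=> //; exact: AS.
Qed.

Lemma sum_disjoint f (J : seq {fset nat}) S : (forall i, 0 <= f i) ->
  (forall F, F \in J -> (F `<=` S)%fset) ->
  pairwise (fun F G : {fset nat} =>
    all (fun i => all (fun j => i < j)%N G) F) J ->
  \sum_(F <- J) \sum_(i <- F) f i <= \sum_(i <- S) f i.
Proof.
move=> f0 JS pJ.
have -> : \sum_(F <- J) \sum_(i <- F) f i =
    \sum_(F <- J) \sum_(i <- S) if i \in F then f i else 0.
  rewrite big_seq [RHS]big_seq; apply: eq_bigr => F /JS FS.
  by rewrite (sum_fsub f FS) big_mkcond.
rewrite exchange_big /=; apply: ler_sum => i _.
have -> : \sum_(F <- J) (if i \in F then f i else 0) =
    f i *+ count (fun F : {fset nat} => i \in F) J.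
  by rewrite -iter_addr_0 -big_const_seq [RHS]big_mkcond.
suff : (count (fun F : {fset nat} => i \in F) J <= 1)%N.
  by case: (count _ _) => [|[|//]] _; rewrite ?mulr0n ?mulr1n.
elim: J pJ {JS} => [//|F J IH] /= /andP[/allP FJ pJ].
have [iF|iF] := boolP (i \in F); last exact: IH.
rewrite (_ : count _ J = 0)%N //; apply/eqP; rewrite -leqn0 leqNgt -has_count.
apply/negP => /hasP[G GJ iG].
by have /allP/(_ i iF)/allP/(_ i iG) := FJ G GJ; rewrite ltnn.
Qed.

End SumsOverFsets.

(* The l_p norm with p = 1 / t, where t = 0 stands for the sup norm. *)
Definition lpn (R : realType) (t : R) (c : nat -> R) (S : {fset nat}) : R :=
  if t == 0 then \big[Num.max/0]_(i <- S) `|c i|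
  else (\sum_(i <- S) `|c i| `^ t^-1) `^ t.

Section Lpn.
Context (R : realType) (t : R).
Hypothesis t01 : 0 <= t < 1.
Implicit Types (c : nat -> R) (A S : {fset nat}).

Let t_pos : t != 0 -> 0 < t < 1.
Proof. by move=> tn0; have /andP[t0 t1] := t01; rewrite lt_def tn0 t0. Qed.

Lemma lpn_ge0 c S : 0 <= lpn t c S.
Proof.
rewrite /lpn; case: ifP => _; last exact: powR_ge0.
by elim/big_ind: _ => // x y x0 y0; rewrite le_max x0.
Qed.

Lemma max_le c S B : 0 <= B -> (forall i, i \in S -> `|c i| <= B) ->
  \big[Num.max/0]_(i <- S) `|c i| <= B.
Proof.
move=> B0 cB; rewrite big_seq; elim/big_ind: _ => // x y xB yB.
by rewrite ge_max xB.
Qed.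

Lemma max_ge c S i : i \in S -> `|c i| <= \big[Num.max/0]_(i <- S) `|c i|.
Proof.
have : i \in S -> i \in enum_fset S by [].
move=> /[apply]; elim: (enum_fset S) => [//|j s IH]; rewrite inE big_cons le_max.
by move=> /orP[/eqP->|/IH->]; rewrite ?lexx ?orbT.
Qed.

Lemma powR_invK (x : R) : t != 0 -> 0 <= x -> (x `^ t^-1) `^ t = x.
Proof. by move=> tn0 x0; rewrite -powRrM mulVf // powRr1. Qed.

Lemma powRK (x : R) : t != 0 -> 0 <= x -> (x `^ t) `^ t^-1 = x.
Proof. by move=> tn0 x0; rewrite -powRrM mulfV // powRr1. Qed.

Lemma mass_ge0 c (s : seq nat) : 0 <= \sum_(i <- s) `|c i| `^ t^-1.
Proof. by apply: sumr_ge0 => i _; exact: powR_ge0. Qed.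

Lemma lpn_ge c S i : i \in S -> `|c i| <= lpn t c S.
Proof.
move=> iS; rewrite /lpn; case: ifPn => [_|tn0]; first exact: max_ge.
have /andP[t0 _] := t_pos tn0.
rewrite -{1}(powR_invK tn0 (normr_ge0 (c i))).
apply: ge0_ler_powR; rewrite ?nnegrE ?(ltW t0) ?powR_ge0 ?mass_ge0 //.
by rewrite (big_fsetD1 i) //= lerDl sumr_ge0 // => j _; exact: powR_ge0.
Qed.

Lemma lpn1 (c : nat -> R) i : lpn t c [fset i]%fset = `|c i|.
Proof.
apply/le_anti; rewrite lpn_ge ?inE // andbT /lpn.
case: ifPn => [_|t0]; last by rewrite big_seq_fset1 powR_invK.
by apply: max_le => // j; rewrite inE => /eqP->.
Qed.

Lemma lpn_sub c A S : (A `<=` S)%fset -> lpn t c A <= lpn t c S.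
Proof.
move=> AS; rewrite /lpn; case: ifPn => [t0|tn0].
  apply: max_le => [|i iA].
    by elim/big_ind: _ => // x y x0 y0; rewrite le_max x0.
  by apply: max_ge; move/fsubsetP: AS; apply.
have /andP[t0 _] := t_pos tn0.
apply: ge0_ler_powR; rewrite ?nnegrE ?(ltW t0) ?mass_ge0 //.
rewrite (sum_fsub _ AS) [leRHS](bigID (fun i => i \in A)) /= lerDl.
by apply: sumr_ge0 => i _; exact: powR_ge0.
Qed.

Lemma eq_lpn c c' S : (forall i, i \in S -> `|c i| = `|c' i|) -> lpn t c S = lpn t c' S.
Proof.
move=> cc'; rewrite /lpn; case: (t == 0).
  by rewrite big_seq [RHS]big_seq; apply: eq_bigr => i /cc'.
by congr powR; rewrite big_seq [RHS]big_seq; apply: eq_bigr => i /cc' ->.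
Qed.

Lemma lpn_scale (a : R) c S : lpn t (fun i => a * c i) S = `|a| * lpn t c S.
Proof.
rewrite /lpn; have [_|tn0] := boolP (t == 0).
  elim: (enum_fset S) => [|i s IH]; first by rewrite !big_nil mulr0.
  by rewrite !big_cons IH normrM maxr_pMr.
have /andP[t0 _] := t_pos tn0.
rewrite -{1}(powR_invK tn0 (normr_ge0 a)) -powRM ?powR_ge0 ?mass_ge0 //.
congr powR; rewrite mulr_sumr; apply: eq_bigr => i _.
by rewrite normrM powRM.
Qed.

(** By concavity, [n] successive pieces have l_p norms summing to at most n^(1-t) times the whole;
    for [t = 0] each piece is at most the maximum. At the critical exponent the l_p norm thus
    survives an induction step without loss, though also without gain. *)
Lemma lpn_split (theta : R) n c (J : seq {fset nat}) S : 0 <= theta ->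
  theta * n%:R `^ (1 - t) <= 1 -> (size J <= n)%N ->
  (forall F, F \in J -> (F `<=` S)%fset) ->
  pairwise (fun F G : {fset nat} =>
    all (fun i => all (fun j => i < j)%N G) F) J ->
  theta * \sum_(F <- J) lpn t c F <= lpn t c S.
Proof.
move=> th0 thn sJ JS pJ; apply: (@le_trans _ _ (theta * (n%:R `^ (1 - t) * lpn t c S))).
  rewrite ler_wpM2l //; rewrite /lpn; case: ifPn => [/eqP t0|tn0].
    apply: (@le_trans _ _ (\sum_(F <- J) \big[Num.max/0]_(i <- S) `|c i|)).
      rewrite big_seq [leRHS]big_seq; apply: ler_sum => F /JS FS.
      by have := lpn_sub c FS; rewrite /lpn t0 eqxx.
    rewrite big_const_seq count_predT iter_addr_0 t0 subr0 powRr1 // -[leLHS]mulr_natl.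
    rewrite ler_wpM2r ?ler_nat //.
    by elim/big_ind: _ => // x y x0 y0; rewrite le_max x0.
  have t01' := t_pos tn0; have /andP[t0 _] := t01'.
  have := @powR_concave_sum R {fset nat} J (fun F => \sum_(i <- F) `|c i| `^ t^-1) n t
    t01' (fun F => mass_ge0 c F) sJ.
  move=> /le_trans; apply.
  rewrite ler_wpM2l ?powR_ge0 //; apply: ge0_ler_powR; rewrite ?nnegrE ?(ltW t0) ?mass_ge0 //.
    by apply: sumr_ge0 => F _; exact: mass_ge0.
  by apply: sum_disjoint => // i; exact: powR_ge0.
by rewrite mulrA ler_piMl // lpn_ge0.
Qed.

Lemma lpn_blocks c (a : nat -> R) (beta : nat -> nat) S B :
  (forall i, i \in S -> (beta i < B)%N) ->
  (forall b, lpn t c [fset i in S | beta i == b]%fset <= `|a b|) ->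
  lpn t c S <= lpn t a [fset b in iota 0 B]%fset.
Proof.
move=> SB ca; have memB b : (b \in [fset b in iota 0 B]%fset) = (b < B)%N.
  by rewrite in_fset mem_iota.
rewrite /lpn; have [t0|tn0] := boolP (t == 0).
  apply: max_le => [|i iS].
    by elim/big_ind: _ => // x y x0 y0; rewrite le_max x0.
  apply: le_trans (max_ge _ _); last by rewrite memB; exact: SB iS.
  apply: le_trans (ca (beta i)); apply: lpn_ge.
  by rewrite !inE iS eqxx.
have t01' := t_pos tn0; have /andP[t0 _] := t01'.
apply: ge0_ler_powR; rewrite ?nnegrE ?(ltW t0) ?mass_ge0 //.
have -> : \sum_(i <- S) `|c i| `^ t^-1 =
    \sum_(b <- [fset b in iota 0 B]%fset) \sum_(i <- [fset i in S | beta i == b]%fset) `|c i| `^ t^-1.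
  rewrite [RHS](eq_bigr (fun b => \sum_(i <- S) if beta i == b then `|c i| `^ t^-1 else 0)).
    rewrite exchange_big /= big_seq [RHS]big_seq; apply: eq_bigr => i iS.
    rewrite (big_fsetD1 (beta i)) ?memB ?SB //= eqxx big1_fset ?addr0 // => b.
    by rewrite !inE => /andP[/negbTE + _] _; rewrite eq_sym => ->.
  move=> b _; rewrite -big_mkcond (@sum_fsub _ _ _ S).
    by rewrite big_seq_cond [RHS]big_seq_cond; apply: eq_bigl => i; rewrite !inE; case: (i \in S).
  by apply/fsubsetP => i; rewrite !inE => /andP[].
apply: ler_sum => b _; have := ca b; rewrite /lpn (negbTE tn0) => le_b.
rewrite -[leLHS](powRK tn0) ?mass_ge0 //; apply: ge0_ler_powR; rewrite ?nnegrE ?powR_ge0 //.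
by rewrite invr_ge0 ltW.
Qed.

End Lpn.

(** [N_ b] is the frontier reached before block [b]; each choice may depend on it and moves it
    forward. Every gliding-hump construction below is an instance. *)
Lemma dependent_sequence (T : Type) (P : nat -> nat -> T -> nat -> Prop) :
  (forall N b, exists a : T, exists N', P N b a N' /\ (N <= N')%N) ->
  exists (a_ : nat -> T) (N_ : nat -> nat),
    (forall b, P (N_ b) b (a_ b) (N_ b.+1)) /\
    forall b b', (b <= b')%N -> (N_ b <= N_ b')%N.
Proof.
move=> ex; have /boolp.choice[f fP] (p : nat * nat) :
    exists q : T * nat, P p.1 p.2 q.1 q.2 /\ (p.1 <= q.2)%N.
  by have [a [N' h]] := ex p.1 p.2; exists (a, N').
pose N_ := fix N_ b := if b is b'.+1 then (f (N_ b', b')).2 else 0%N.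
exists (fun b => (f (N_ b, b)).1), N_; split=> [b|b b'].
  by have [] := fP (N_ b, b).
move=> /subnK <-; elim: (b' - b)%N => [//|j IH]; rewrite addSn.
by apply: leq_trans IH _; have [_] := fP (N_ (j + b)%N, (j + b)%N).
Qed.

Lemma seq_argmax (R : realType) (T : eqType) (f : T -> R) (s : seq T) :
  s != [::] -> exists2 a, a \in s & forall b, b \in s -> f b <= f a.
Proof.
elim: s => [//|a s IH] _; have [->|/IH[c cs cmax]] := eqVneq s [::].
  by exists a; rewrite ?mem_head // => b; rewrite inE => /eqP->.
have [le|lt] := leP (f a) (f c).
  by exists c; [rewrite inE cs orbT|move=> b; rewrite inE => /orP[/eqP->//|/cmax]].
exists a; rewrite ?mem_head // => b; rewrite inE => /orP[/eqP->//|/cmax le].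
exact: le_trans le (ltW lt).
Qed.

Definition crosses (beta : nat -> nat) (b : nat) (F : {fset nat}) : bool :=
  has (fun i => beta i <= b)%N F && has (fun i => b < beta i)%N F.

(** Once [F] has a point past block [b], all later sets are entirely past [b]. Hence a boundary is
    straddled by at most one of the sets, and charges attached to boundaries do not multiply when a
    set is split. *)
Lemma sum_crosses (beta : nat -> nat) b (S : {fset nat}) (J : seq {fset nat}) :
  (forall i j, i \in S -> j \in S -> (i <= j)%N -> (beta i <= beta j)%N) ->
  (forall F, F \in J -> (F `<=` S)%fset) ->
  pairwise (fun F G : {fset nat} =>
    all (fun i => all (fun j => i < j)%N G) F) J ->
  (\sum_(F <- J) crosses beta b F <= crosses beta b S)%N.
Proof.
move=> mono; have crossS F : (F `<=` S)%fset -> crosses beta b F -> crosses beta b S.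
  move=> /fsubsetP FS /andP[/hasP[i iF bi] /hasP[j jF bj]].
  by apply/andP; split; apply/hasP; [exists i|exists j]; rewrite ?FS.
elim: J => [|F J IH] JS /=; first by rewrite big_nil.
move=> /andP[/allP FJ pJ]; rewrite big_cons.
have {IH}IH : (\sum_(F0 <- J) crosses beta b F0 <= crosses beta b S)%N.
  by apply: IH pJ => G GJ; apply: JS; rewrite inE GJ orbT.
have FS := JS F (mem_head _ _).
have [Fb|_] := boolP (crosses beta b F); last by rewrite add0n.
rewrite (crossS F) // big1_seq // => G /= GJ; apply/eqP; rewrite eqb0.
have GS : (G `<=` S)%fset by apply: JS; rewrite inE GJ orbT.
apply/negP => /andP[/hasP[j jG bj] _].
move: Fb => /andP[_ /hasP[i iF bi]].
have /allP/(_ i iF)/allP/(_ j jG)/ltnW ij := FJ G GJ.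
by have := mono i j (fsubsetP FS _ iF) (fsubsetP GS _ jG) ij; lia.
Qed.

Section LpBlocks.
Context (R : realType) (l : nat) (M : 'I_l -> set {fset nat}) (theta : 'I_l -> R)
  (n : 'I_l -> nat) (t : R).
Hypothesis theta01 : forall k, 0 < theta k < 1.
Hypothesis hM : forall k, hereditary_family (M k).
Hypothesis iM : forall k, has_index (M k) (n k).
Hypothesis t01 : 0 <= t < 1.
Hypothesis ht : forall k, theta k * (n k)%:R `^ (1 - t) <= 1.
Implicit Types (x y : nat -> R^o) (k : 'I_l) (S F A : {fset nat}).

Notation nrms := (nrms M theta).
Notation nrm := (nrm M theta).
Notation lpn := (lpn t).

Lemma nrm_restrict1 x i : nrm (restrict_to [fset i]%fset x) = `|x i|.
Proof.
rewrite (@nrm_unit _ _ M _ theta01 _ i) => [|j ji]; rewrite /restrict_to inE.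
  by rewrite eqxx.
by rewrite (negbTE ji).
Qed.

Lemma nrm_restrict_zero x S : lpn x S = 0 -> nrm (restrict_to S x) = 0.
Proof.
move=> x0; have -> : restrict_to S x = (fun _ => 0).
  apply/funext => i; rewrite /restrict_to; case: ifP => // iS.
  by apply/eqP; rewrite -normr_le0 -x0; exact: lpn_ge.
have c0 : c00 (fun _ : nat => 0 : R^o) by exists 0%N.
apply/le_anti; rewrite nrm_ge0 // andbT; apply: (nrm_le theta01) => // u.
by rewrite nrms_zero.
Qed.

(* If no multiple of the l_p norm dominates the norm on a tail of D, then a
   subset maximizing the ratio of the two norms yields a normalized vector all
   of whose pieces are controlled by their small l_p masses. *)
Lemma good_block (D : nat -> Prop) (eps : R) : 0 < eps ->
  (exists x S, (forall i, i \in S -> D i) /\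
    eps^-1 * lpn x S < nrm (restrict_to S x)) ->
  exists v S kappa, [/\ forall i, i \in S -> D i,
    forall i, v i != 0 -> i \in S, nrm v = 1 /\ c00 v, 0 < kappa <= eps &
    lpn v S = kappa /\ forall F, (F `<=` S)%fset ->
      nrm (restrict_to F v) <= kappa^-1 * lpn v F].
Proof.
move=> eps0 [x [S0 [S0D lt_x]]].
have lpn_gt S : (0 < lpn x S) = (lpn x S != 0) by rewrite lt_def lpn_ge0 // andbT.
have lpnS0 : 0 < lpn x S0.
  rewrite lpn_gt; apply/eqP => z; move: lt_x.
  by rewrite nrm_restrict_zero // z mulr0 ltxx.
pose s := [seq A <- fpowerset S0 | 0 < lpn x A].
have S0s : S0 \in s by rewrite mem_filter lpnS0 fpowersetE fsubset_refl.
have s0 : s != [::] by apply: contraTneq S0s => ->.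
have [S Ss Smax] := seq_argmax (fun A => nrm (restrict_to A x) / lpn x A) s0.
move: Ss; rewrite mem_filter => /andP[lS]; rewrite fpowersetE => SS0.
have lt_S : eps^-1 * lpn x S < nrm (restrict_to S x).
  rewrite -ltr_pdivlMr //; apply: lt_le_trans (Smax _ S0s).
  by rewrite ltr_pdivlMr.
have nS : 0 < nrm (restrict_to S x).
  by apply: le_lt_trans lt_S; rewrite mulr_ge0 ?invr_ge0 ?(ltW eps0) // ltW.
pose c := (nrm (restrict_to S x))^-1; have c0 : 0 < c by rewrite invr_gt0.
pose v : nat -> R^o := fun i => c * restrict_to S x i.
have lv F : (F `<=` S)%fset -> lpn v F = c * lpn x F.
  move=> /fsubsetP FS; have -> : lpn v F = lpn (fun i => c * x i) F.
    by apply: eq_lpn => i /FS iS; rewrite /v /restrict_to iS.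
  by rewrite lpn_scale // (gtr0_norm c0).
have nv F : (F `<=` S)%fset -> nrm (restrict_to F v) = c * nrm (restrict_to F x).
  move=> /fsubsetP FS.
  have -> : restrict_to F v = (fun i => c * restrict_to F x i).
    apply/funext => i; rewrite /v /restrict_to; case: ifP; last by rewrite mulr0.
    by move=> /FS ->.
  by rewrite nrm_scale ?(gtr0_norm c0) //; exact: c00_restrict_fset.
exists v, S, (lpn v S); rewrite lv //; split.
- by move=> i iS; apply: S0D; move/fsubsetP: SS0; apply.
- by move=> i; apply: contraNT => iS; rewrite /v /restrict_to (negbTE iS) mulr0.
- split; last by apply: c00Z; exact: c00_restrict_fset.
  by rewrite nrm_scale ?gtr0_norm ?mulVf ?gt_eqF //; exact: c00_restrict_fset.
- rewrite mulr_gt0 //= mulrC ler_pdivrMr // -ler_pdivrMl //; exact: ltW.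
- split=> // F FS; rewrite nv // lv // invfM mulrACA mulVf ?gt_eqF // mul1r.
  have [l0|] := eqVneq (lpn x F) 0.
    by rewrite l0 nrm_restrict_zero // !mulr0.
  rewrite -lpn_gt => lF; have : F \in s.
    by rewrite mem_filter lF fpowersetE; exact: fsubset_trans SS0.
  move=> /Smax; rewrite ler_pdivrMr // => le_F.
  by rewrite /c ler_pdivrMl // mulrA.
Qed.

Lemma theta_bound : exists2 th : R, 0 <= th < 1 & forall k, theta k <= th.
Proof.
exists (\big[Num.max/0]_(k < l) theta k) => [|k]; last exact: le_bigmax.
apply/andP; split; first exact: bigmax_ge_id.
by apply: bigmax_lt => // k _; have /andP[] := theta01 k.
Qed.

Lemma sum_geometric B : \sum_(b < B) 2^-1 ^+ b <= 2 :> R.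
Proof.
suff -> : \sum_(b < B) 2^-1 ^+ b = 2 - 2 * 2^-1 ^+ B :> R.
  by rewrite gerBl mulr_ge0 // exprn_ge0.
elim: B => [|B IH]; first by rewrite big_ord0 expr0 mulr1 subrr.
by rewrite big_ord_recr /= IH exprS; lra.
Qed.

(** Every coordinate of [v b] is at most [kappa b], hence at most 2^(-b), as the case of singletons
    shows, so cutting at single coordinates is cheap. The spreading hypothesis concerns coordinates
    and not just blocks, which allows [up_step] to take coordinates as its blocks. *)
Lemma good_upper : exists (g : nat -> nat) (C : R),
  forall (v : nat -> nat -> R^o) (kappa : nat -> R), block_seq g v ->
  (forall b b' i j, v b i != 0 -> v b' j != 0 -> (i < j)%N -> (g i <= j)%N) ->
  (forall b, 0 < kappa b <= 2^-1 ^+ b) ->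
  (forall b F, (forall i, i \in F -> v b i != 0) -> lpn (v b) F <= kappa b /\
    nrm (restrict_to F (v b)) <= (kappa b)^-1 * lpn (v b) F) ->
  forall (a : nat -> R) B,
  nrm (comb a v B) <= C * lpn a [fset b in iota 0 B]%fset.
Proof.
have [g gP] := up_step theta01 hM iM.
have [th /andP[th0 th1] le_th] := theta_bound.
have [m le_m] := seq_bound (fun k => (n k).*2) (enum 'I_l).
have {}le_m k : ((n k).*2 <= m)%N by apply: le_m; rewrite mem_enum.
(* The solution of m 2^(-b) + th delta_b = delta_b: one part pays for the cuts of the present level,
   the other is passed on to the pieces. *)
pose delta b : R := m%:R / (1 - th) * 2^-1 ^+ b.
have th1' : 0 < 1 - th by rewrite subr_gt0.
have delta0 b : 0 <= delta b by rewrite mulr_ge0 ?divr_ge0 ?exprn_ge0 // ltW.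
exists g, (1 + m%:R / (1 - th) * 2) => v kappa gv spread0 kap good a B.
have kap0 b : 0 < kappa b by have /andP[] := kap b.
have [S [beta [Sb bS mono spread]]] := block_support gv B.
set A := lpn a _; have A0 : 0 <= A by exact: lpn_ge0.
have aA b : (b < B)%N -> `|a b| <= A.
  by move=> bB; apply: lpn_ge => //; rewrite in_fset mem_iota.
pose x := comb a v B.
(* With this rescaling the l_p norm of [y] dominates the norm of [x] on subsets of a single block,
   and is still at most [|a b|] there. *)
pose y : nat -> R := fun i => (kappa (beta i))^-1 * x i.
have xE i : i \in S -> x i = a (beta i) * v (beta i) i.
  by move=> /Sb[bB vi]; rewrite /x (comb_in gv a bB vi).
have single b F : (F `<=` S)%fset -> (forall i, i \in F -> beta i = b) ->
    [/\ lpn y F <= `|a b|, nrm (restrict_to F x) <= lpn y F & F != fset0 -> (b < B)%N].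
  move=> /fsubsetP FS Fb.
  have vF i : i \in F -> v b i != 0 by move=> iF; rewrite -(Fb i iF); case: (Sb i (FS i iF)).
  have [lv nv] := good b F vF.
  have -> : lpn y F = `|a b| * ((kappa b)^-1 * lpn (v b) F).
    have -> : lpn y F = lpn (fun i => a b * (kappa b)^-1 * v b i) F.
      by apply: eq_lpn => i iF; rewrite /y xE ?FS // Fb // mulrA [_ * a b]mulrC.
    have kV : 0 < (kappa b)^-1 by rewrite invr_gt0.
    by rewrite lpn_scale // normrM (gtr0_norm kV) mulrA.
  split.
  - by rewrite ler_piMr // ler_pdivrMl // mulr1.
  - rewrite -[leLHS]/(nrm _) (_ : restrict_to F x = (fun i => a b * restrict_to F (v b) i)).
      by rewrite nrm_scale ?ler_wpM2l //; exact: c00_restrict_fset.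
    apply/funext => i; rewrite /restrict_to; case: ifP => [iF|_]; last by rewrite mulr0.
    by rewrite xE ?FS // Fb.
  - by move=> /fset0Pn[i iF]; rewrite -(Fb i iF); case: (Sb i (FS i iF)).
pose W F : R := \sum_(b < B) delta b * (crosses beta b F)%:R.
have W0 F : 0 <= W F by apply: sumr_ge0 => b _; rewrite mulr_ge0.
have cross_or F : (F `<=` S)%fset -> (exists b, forall i, i \in F -> beta i = b) \/
    exists i0, [/\ i0 \in F, forall i, i \in F -> (beta i0 <= beta i)%N &
      crosses beta (beta i0) F].
  move=> /fsubsetP FS; have [->|F0] := eqVneq F fset0; first by left; exists 0%N.
  have [i0 i0F min_i0] := fset_min F0.
  have le_beta i : i \in F -> (beta i0 <= beta i)%N.
    by move=> iF; apply: mono (min_i0 _ iF); exact: FS.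
  have [hs|hs] := boolP (has (fun i => beta i0 < beta i)%N F).
    right; exists i0; split=> //; rewrite /crosses hs andbT.
    by apply/hasP; exists i0.
  left; exists (beta i0) => i iF; apply/eqP; rewrite eqn_leq le_beta // andbT leqNgt.
  by apply: contra hs => lt_i; apply/hasP; exists i.
(* The l_p term handles sets inside one block; [A * W F] pays for cutting, with the amount
   [A * delta b] for each boundary after a block [b] that [F] straddles. *)
have main u F : (F `<=` S)%fset -> nrms u (restrict_to F x) <= lpn y F + A * W F.
  elim: u F => [|u IH] F FS; have [[b Fb]|[i0 [i0F min_i0 cr]]] := cross_or F FS.
  - have [_ h _] := single b F FS Fb; apply: le_trans (nrms_nrm M theta01 _ (c00_restrict_fset _ _)) _.
    by apply: le_trans h _; rewrite lerDl mulr_ge0.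
  - apply: nrms0_le => //; first exact: c00_restrict_fset.
    move=> i; rewrite /restrict_to; case: ifP => [iF|_]; last first.
      by rewrite normr0 addr_ge0 ?lpn_ge0 ?mulr_ge0.
    apply: le_trans (_ : lpn y F <= _); last by rewrite lerDl mulr_ge0.
    apply: le_trans (lpn_ge t01 y iF); rewrite /y normrM ler_peMl //.
    rewrite gtr0_norm ?invr_gt0 // invf_ge1 //; have /andP[_ h] := kap (beta i).
    by apply: le_trans h _; rewrite exprn_ile1 ?invr_ge0 // invf_le1 // ler1n.
  - have [_ h _] := single b F FS Fb; apply: le_trans (nrms_nrm M theta01 _ (c00_restrict_fset _ _)) _.
    by apply: le_trans h _; rewrite lerDl mulr_ge0.
  have inS i : i \in F -> i \in S by move/fsubsetP: FS; apply.
  (* With [beta = id] the members of [H] are single coordinates: at most [m] of them, each of size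
     at most A 2^(-beta i0). As [F] straddles the boundary after its first block, the share [1 - th]
     of its charge covers them; the share [th] covers the sets of [J]. *)
  apply: (gP F id) => //.
    by move=> i j /inS/Sb[_ vi] /inS/Sb[_ vj]; exact: spread0 vi vj.
  - exact: IH.
  move=> k H J sH HF sJ JF pJ; have /andP[thk0 thk1] := theta01 k.
  have i0B : (beta i0 < B)%N by have [] := Sb i0 (inS _ i0F).
  have HS : \sum_(b <- H) nrm (restrict_to [fset i in F | i == b]%fset x) <=
      A * ((1 - th) * W F).
    apply: (@le_trans _ _ (A * ((1 - th) * delta (beta i0)))); last first.
      rewrite ler_wpM2l // ler_wpM2l ?(ltW th1') //.
      rewrite /W (bigD1 (Ordinal i0B)) //= cr mulr1 lerDl.
      by apply: sumr_ge0 => b _; rewrite mulr_ge0.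
    have -> : A * ((1 - th) * delta (beta i0)) = (A * 2^-1 ^+ beta i0) *+ m.
      by rewrite /delta -mulr_natr; field; rewrite gt_eqF.
    apply: (@le_trans _ _ (\sum_(b <- H) A * 2^-1 ^+ beta i0)).
      rewrite big_seq [leRHS]big_seq; apply: ler_sum => _ /HF[j jF <-].
      have -> : [fset i in F | i == j]%fset = [fset j]%fset.
        apply/fsetP => i; rewrite !inE; case: eqP => [->|_]; last by rewrite andbF.
        by rewrite jF.
      have [bB vj] := Sb j (inS _ jF).
      rewrite nrm_restrict1 // (xE j (inS _ jF)) normrM; apply: ler_pM => //; first exact: aA.
      have vj1 i : i \in [fset j]%fset -> v (beta j) i != 0 by rewrite inE => /eqP->.
      have [lv _] := good (beta j) [fset j]%fset vj1.
      apply: le_trans (le_trans (lpn_ge t01 (v (beta j)) (fset11 j)) lv) _.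
      have /andP[_ h] := kap (beta j); apply: le_trans h _.
      rewrite ler_wiXn2l ?min_i0 ?invr_ge0 // invf_le1 // ler1n //.
    rewrite big_const_seq count_predT iter_addr_0; apply: ler_wpMn2l.
      by rewrite mulr_ge0 // exprn_ge0.
    exact: leq_trans sH (le_m k).
  have JS : theta k * \sum_(F0 <- J) nrms u (restrict_to F0 x) <= lpn y F + A * (th * W F).
    apply: (@le_trans _ _ (theta k * \sum_(F0 <- J) (lpn y F0 + A * W F0))).
      rewrite ler_wpM2l ?(ltW thk0) // big_seq [leRHS]big_seq; apply: ler_sum => G GJ.
      by apply: IH; apply: fsubset_trans FS; exact: JF.
    rewrite big_split /= mulrDr; apply: lerD.
      by apply: lpn_split (ht k) sJ JF pJ => //; exact: ltW.
    rewrite -mulr_sumr mulrCA ler_wpM2l //.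
    have sumW : \sum_(G <- J) W G <= W F.
      rewrite /W exchange_big /=; apply: ler_sum => b _; rewrite -mulr_sumr ler_wpM2l //.
      rewrite -natr_sum ler_nat; apply: sum_crosses => // i j /inS iS /inS jS.
      exact: mono.
    apply: ler_pM => //; first exact: ltW.
    by apply: sumr_ge0.
  by apply: le_trans (lerD HS JS) _; rewrite addrCA lerD2l -mulrDr -mulrDl subrK mul1r.
have xS : x = restrict_to S x.
  apply/funext => i; rewrite /restrict_to; case: ifP => // iS.
  rewrite /x /comb big1 // => b _; have [->|vbi] := eqVneq (v b i) 0.
    by rewrite mulr0.
  by have [] := bS b i (ltn_ord b) vbi; rewrite iS.
rewrite -/x xS; apply: (nrm_le theta01) => [|u]; first exact: c00_restrict_fset.
apply: le_trans (main u S (fsubset_refl _)) _.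
rewrite mulrDl mul1r; apply: lerD.
  apply: (lpn_blocks t01 (beta := beta)) => [i iS|b].
    by have [] := Sb i iS.
  have [||h _ _] := single b [fset i in S | beta i == b]%fset; last exact: h.
    by apply/fsubsetP => i; rewrite !inE => /andP[].
  by move=> i; rewrite !inE => /andP[_ /eqP].
rewrite mulrC ler_wpM2r //.
apply: (@le_trans _ _ (\sum_(b < B) delta b)).
  by apply: ler_sum => b _; rewrite ler_piMr // lern1 leq_b1.
by rewrite -mulr_sumr ler_wpM2l ?sum_geometric // divr_ge0 // ltW.
Qed.

(** [e0] and [g0] are free so that the requirements of the lower estimate can be imposed on the same
    sequence. *)
Lemma lp_blocks (e0 : nat) (g0 : nat -> nat) :
  exists (v : nat -> nat -> R^o) (C : R), [/\ block_seq g0 v,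
    forall b i, v b i != 0 -> (e0 <= i)%N, forall b, nrm (v b) = 1 &
    forall (a : nat -> R) B,
      nrm (comb a v B) <= C * lpn a [fset b in iota 0 B]%fset].
Proof.
have [g [C gC]] := good_upper.
(* Iterating [G] from [e0] produces the sparse set [D], any two points of which are a gap apart for
   both [g] and [g0]. *)
pose G (i : nat) := maxn (maxn (g i) (g0 i)) i.+1.
pose L := fix L j := if j is j'.+1 then G (L j') else e0.
have LG i j : (i < j)%N -> (G (L i) <= L j)%N.
  move=> /subnK <-; elim: (j - i.+1)%N => [//|d IH]; rewrite addSn /=.
  by apply: leq_trans IH _; rewrite leq_max leqnSn orbT.
have L_lt i j : (i < j)%N -> (L i < L j)%N.
  by move=> /LG; apply: leq_trans; rewrite leq_max leqnn orbT.
have L_le i j : (i <= j)%N -> (L i <= L j)%N.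
  by rewrite leq_eqVlt => /orP[/eqP->//|/L_lt/ltnW].
have L_ge j : (j <= L j)%N.
  by elim: j => [//|j IH]; apply: leq_ltn_trans IH (L_lt _ _ _).
pose D i := exists j, i = L j.
have Dgap i j : D i -> D j -> (i < j)%N -> (g i <= j)%N /\ (g0 i <= j)%N.
  move=> [p ->] [q ->] pq; have {}pq : (p < q)%N.
    by rewrite ltnNge; apply: contraTN pq => /L_le; rewrite -leqNgt.
  have := LG p q pq; rewrite !geq_max => /andP[/andP[-> ->] _].
  by [].
have De i : D i -> (e0 <= i)%N by move=> [j ->]; exact: (L_le 0%N).
(* In the first case unit vectors at the positions [L (N + b)] suffice, the shift by [N] placing
   them in the dominated tail. In the second, [good_block] applies beyond every frontier and with
   every [eps], here 2^(-b). *)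
have [[N [K NK]]|no] := EM (exists N K, forall x S,
    (forall i, i \in S -> D i /\ (N <= i)%N) -> nrm (restrict_to S x) <= K * lpn x S).
  pose v b : nat -> R^o := fun i => (i == L (N + b)%N)%:R.
  have vL b i : v b i != 0 -> i = L (N + b)%N.
    apply: contraNeq => ne; by rewrite /v (negbTE ne).
  have v1 b : v b (L (N + b)%N) = 1 by rewrite /v eqxx.
  have gv : block_seq g0 v.
    split=> [b|b b' i j bb' /vL-> /vL->].
      exists (L (N + b)).+1 => i; rewrite /v; case: eqP => // ->.
      by rewrite ltnn.
    have lt_bb' : (L (N + b) < L (N + b'))%N by apply: L_lt; rewrite ltn_add2l.
    by split=> //; case: (Dgap (L (N + b)%N) (L (N + b')%N)) => //; eexists.
  exists v, (Num.max K 0); split=> //.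
  - by move=> b i /vL->; apply: De; eexists.
  - move=> b; rewrite (@nrm_unit _ _ M _ theta01 _ (L (N + b)%N)) ?v1 ?normr1 //.
    by move=> j; apply: contraNeq => /vL->.
  - move=> a B; have [S [beta [Sb bS mono spread]]] := block_support gv B.
    have xS : comb a v B = restrict_to S (comb a v B).
      apply/funext => i; rewrite /restrict_to; case: ifP => // iS.
      rewrite /comb big1 // => b _; have [->|vbi] := eqVneq (v b i) 0.
        by rewrite mulr0.
      by have [] := bS b i (ltn_ord b) vbi; rewrite iS.
    rewrite xS; apply: le_trans (NK _ _ _) _.
      move=> i /Sb[_ /vL->]; split; first by eexists.
      by apply: leq_trans (L_ge _); exact: leq_addr.
    apply: (@le_trans _ _ (Num.max K 0 * lpn (comb a v B) S)).
      by rewrite ler_wpM2r ?lpn_ge0 // le_max lexx.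
    apply: ler_wpM2l; first by rewrite le_max lexx orbT.
    apply: (lpn_blocks t01 (beta := beta)) => [i iS|b].
      by have [] := Sb i iS.
    have -> : lpn (comb a v B) [fset i in S | beta i == b]%fset =
        lpn (fun i => a b * v b i) [fset i in S | beta i == b]%fset.
      apply: eq_lpn => i; rewrite !inE => /andP[iS /eqP bi].
      by have [bB vi] := Sb i iS; rewrite (comb_in gv a bB vi) bi.
    rewrite lpn_scale // ler_piMr //.
    apply: (@le_trans _ _ (lpn (v b) [fset L (N + b)%N]%fset)); last first.
      by rewrite (lpn1 t01) v1 normr1.
    apply: lpn_sub => //; apply/fsubsetP => i; rewrite !inE => /andP[iS /eqP bi].
    by have [_ /vL ->] := Sb i iS; rewrite bi.
pose P N b (vk : (nat -> R^o) * R) N' := [/\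
  forall i, vk.1 i != 0 -> D i /\ (N <= i < N')%N, nrm vk.1 = 1, c00 vk.1,
  0 < vk.2 <= 2^-1 ^+ b &
  forall F, (forall i, i \in F -> vk.1 i != 0) -> lpn vk.1 F <= vk.2 /\
    nrm (restrict_to F vk.1) <= vk.2^-1 * lpn vk.1 F].
have [|vk [N_ [vkP N_le]]] := @dependent_sequence _ P.
  move=> N b; have eps0 : 0 < 2^-1 ^+ b :> R by rewrite exprn_gt0.
  have ex_x : exists x S, (forall i, i \in S -> D i /\ (N <= i)%N) /\
      (2^-1 ^+ b)^-1 * lpn x S < nrm (restrict_to S x).
    apply: contrapT => nex; apply: no; exists N, (2^-1 ^+ b)^-1 => x S SD.
    by rewrite leNgt; apply/negP => lt_x; apply: nex; exists x, S.
  have [v [S [kap [SD vS [nv cv] kapb [lv Fv]]]]] := good_block eps0 ex_x.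
  have [N' SN'] := seq_bound id S; exists (v, kap), (maxn N N'.+1).
  split; last by rewrite leq_maxl.
  split=> //= [i /vS iS|F vF].
    have [Di Ni] := SD i iS; split=> //; rewrite Ni /= leq_max ltnS.
    by have -> := SN' i iS; rewrite orbT.
  have FS : (F `<=` S)%fset by apply/fsubsetP => i /vF/vS.
  by split; [rewrite -lv; exact: lpn_sub|exact: Fv].
pose v b := (vk b).1; pose kappa b := (vk b).2.
have vsucc b b' i j : (b < b')%N -> v b i != 0 -> v b' j != 0 -> (i < j)%N.
  move=> bb' vi vj; have [/(_ i vi)[_ /andP[_ h]] _ _ _ _] := vkP b.
  have [/(_ j vj)[_ /andP[h' _]] _ _ _ _] := vkP b'.
  by apply: leq_trans h (leq_trans (N_le _ _ bb') h').
have vD b i : v b i != 0 -> D i by move=> vi; have [/(_ i vi)[]] := vkP b.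
have gv g1 : (forall i j, D i -> D j -> (i < j)%N -> (g1 i <= j)%N) -> block_seq g1 v.
  move=> Dg1; split=> [b|b b' i j bb' vi vj]; first by have [] := vkP b.
  have ij := vsucc b b' i j bb' vi vj; split=> //; apply: Dg1 => //.
    exact: vD vi.
  exact: vD vj.
exists v, C; split.
- by apply: gv => i j Di Dj /(Dgap i j Di Dj)[].
- by move=> b i /vD/De.
- by move=> b; have [] := vkP b.
- apply: (gC v kappa).
  + by apply: gv => i j Di Dj /(Dgap i j Di Dj)[].
  + by move=> b b' i j /vD Di /vD Dj /(Dgap i j Di Dj)[].
  + by move=> b; have [] := vkP b.
  + by move=> b F vF; have [_ _ _ _ /(_ F vF)] := vkP b.
Qed.

End LpBlocks.

(** * Subspaces spanned by equivalent sequences *)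

Lemma norm_cauchy_cvg (R : realType) (X : completeNormedModType R) (u : nat -> X) :
  (forall e : R, 0 < e -> exists N, forall m, (N <= m)%N -> `|u N - u m| < e) ->
  exists q, forall e : R, 0 < e -> exists N, forall m, (N <= m)%N -> `|q - u m| < e.
Proof.
move=> cu; have /cauchy_cvgP : cauchy (u @ \oo).
  apply/cauchyP => e e0; have [N Nu] := cu e e0; exists (u N).
  by exists N => // m /= Nm; rewrite -ball_normE /=; exact: Nu.
move=> /cvg_ex[q uq]; exists q => e e0.
have /uq[N _ Nu] : nbhs q (ball q e) by exact: nbhsx_ballx.
by exists N => m Nm; have := Nu m Nm; rewrite -ball_normE.
Qed.

Lemma ler_addgt0_mul (R : realType) (x y K : R) : 0 <= K ->
  (forall e, 0 < e -> x <= y + K * e) -> x <= y.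
Proof.
move=> K0 xy; apply/ler_addgt0Pr => e e0.
have K1 : 0 < K + 1 by rewrite ltr_wpDl.
apply: le_trans (xy (e / (K + 1)) _) _; first by rewrite divr_gt0.
by rewrite lerD2l mulrCA ler_piMr ?(ltW e0) // ler_pdivrMr // mul1r lerDl.
Qed.

Lemma closure_norm (R : realType) (X : completeNormedModType R) (A : set X) p :
  closure A p -> forall e : R, 0 < e -> exists2 q, A q & `|p - q| < e.
Proof.
move=> clp e e0; have [q [Aq]] := clp _ (nbhsx_ballx p e e0).
by rewrite -ball_normE /=; exists q.
Qed.

(** If [n] vectors spanned [V], the coefficient matrix of [n.+1] of the [x b] would have a nonzero
    row kernel, a linear relation that the bound on coefficients forbids. *)
Lemma not_finite_dimensional (R : realType) (X : completeNormedModType R) (V : set X)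
    (x : nat -> X) (K : R) : (forall b, V (x b)) ->
  (forall (a : nat -> R) B b, (b < B)%N -> `|a b| <= K * `|\sum_(b < B) a b *: x b|) ->
  ~ finite_dimensional V.
Proof.
move=> Vx x_ge [n [v Vv]].
have /boolp.choice[A AP] (b : 'I_n.+1) : exists a : 'I_n -> R, x b = \sum_(i < n) a i *: v i.
  by have := Vx b; rewrite Vv.
pose m := \matrix_(b < n.+1, i < n) A b i.
have : kermx m != 0.
  rewrite kermx_eq0 /row_free neq_ltn; apply/orP; left.
  by rewrite ltnS rank_leq_col.
move=> /matrix0Pn[b0 [b1 nz]]; pose u b := kermx m b0 (inord b).
have su : \sum_(b < n.+1) u b *: x b = 0.
  rewrite (eq_bigr (fun b : 'I_n.+1 => \sum_(i < n) (u b * A b i) *: v i)); last first.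
    by move=> b _; rewrite AP scaler_sumr; apply: eq_bigr => i _; rewrite scalerA.
  rewrite exchange_big /= big1 // => i _; rewrite -scaler_suml.
  have /matrixP/(_ b0 i) := mulmx_ker m; rewrite [LHS]mxE [RHS]mxE => ker0.
  rewrite (_ : \sum_(b < n.+1) _ = 0) ?scale0r // -[RHS]ker0; apply: eq_bigr => b _.
  by rewrite /u inord_val; congr (_ * _); rewrite mxE.
have := x_ge u n.+1 b1 (ltn_ord b1); rewrite su normr0 mulr0 normr_le0.
by rewrite /u inord_val (negbTE nz).
Qed.

(** The closure of the graph of x_b -> y_b on finite combinations. For equivalent sequences it is
    the graph of an isomorphism of the closed spans, symmetric in the two spaces. *)
Definition joint_limit (R : realType) (X Y : completeNormedModType R) (x : nat -> X)
    (y : nat -> Y) (p : X) (q : Y) : Prop :=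
  forall e : R, 0 < e -> exists (a : nat -> R) B,
    `|p - \sum_(b < B) a b *: x b| <= e /\ `|q - \sum_(b < B) a b *: y b| <= e.

Section EquivalentSequences.
Context (R : realType) (X Y : completeNormedModType R) (x : nat -> X) (y : nat -> Y)
  (K : R).
Implicit Types (a : nat -> R) (B : nat).

Let Lx a B := \sum_(b < B) a b *: x b.
Let Ly a B := \sum_(b < B) a b *: y b.

Hypothesis K_gt0 : 0 < K.
Hypothesis xy : forall a B, `|Lx a B| <= K * `|Ly a B|.
Hypothesis yx : forall a B, `|Ly a B| <= K * `|Lx a B|.

Let Rel := joint_limit x y.

Let trunc a B b := if (b < B)%N then a b else 0.

Let truncx a B B' : (B <= B')%N -> Lx (trunc a B) B' = Lx a B.
Proof.
move=> BB'; rewrite /Lx (big_ord_widen B' (fun b => a b *: x b) BB') [RHS]big_mkcond /=.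
by apply: eq_bigr => b _; rewrite /trunc; case: ifP => // _; rewrite scale0r.
Qed.

Let truncy a B B' : (B <= B')%N -> Ly (trunc a B) B' = Ly a B.
Proof.
move=> BB'; rewrite /Ly (big_ord_widen B' (fun b => a b *: y b) BB') [RHS]big_mkcond /=.
by apply: eq_bigr => b _; rewrite /trunc; case: ifP => // _; rewrite scale0r.
Qed.

Let L_lin (c : R) a B a' B' : exists a2 B2, Lx a2 B2 = c *: Lx a B + Lx a' B' /\
  Ly a2 B2 = c *: Ly a B + Ly a' B'.
Proof.
exists (fun b => c * trunc a B b + trunc a' B' b), (maxn B B').
rewrite -(truncx a (leq_maxl B B')) -(truncx a' (leq_maxr B B')).
rewrite -(truncy a (leq_maxl B B')) -(truncy a' (leq_maxr B B')).
rewrite /Lx /Ly !scaler_sumr -!big_split /=; split; apply: eq_bigr => b _;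
  by rewrite scalerDl scalerA.
Qed.

Lemma joint_limit_lin (c : R) p q p' q' : Rel p q -> Rel p' q' -> Rel (c *: p + p') (c *: q + q').
Proof.
move=> pq pq' e e0; have c1 : 0 < `|c| + 1 by rewrite ltr_wpDl.
have e1 : 0 < e / 2 / (`|c| + 1) by rewrite !divr_gt0.
have [a [B [pa qa]]] := pq _ e1; have [a' [B' [pa' qa']]] := pq' (e / 2) ltac:(by rewrite divr_gt0).
have [a2 [B2 [E2 E2']]] := L_lin c a B a' B'; exists a2, B2.
rewrite -/(Lx a2 B2) -/(Ly a2 B2) E2 E2'.
have small (V : normedModType R) (z z' w w' : V) : `|z - z'| <= e / 2 / (`|c| + 1) ->
    `|w - w'| <= e / 2 -> `|c *: z + w - (c *: z' + w')| <= e.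
  move=> zz' ww'; rewrite opprD addrACA -scalerBr.
  apply: le_trans (ler_normD _ _) _; rewrite normrZ [leRHS]splitr lerD //.
  apply: le_trans (_ : (`|c| + 1) * `|z - z'| <= _).
    by rewrite ler_wpM2r // lerDl.
  by rewrite mulrC -ler_pdivlMr.
by split; exact: small.
Qed.

Lemma joint_limit_zero : Rel 0 0.
Proof.
move=> e /ltW e0; exists (fun _ => 0), 0%N.
by rewrite /Lx /Ly !big_ord0 !subr0 !normr0.
Qed.

Lemma joint_limit_le p q : Rel p q -> `|q| <= K * `|p| /\ `|p| <= K * `|q|.
Proof.
move=> pq; have K0 := ltW K_gt0.
split; (apply: (@ler_addgt0_mul _ _ _ (K + 1)); first exact: addr_ge0) => e e0;
  have [a [B [pa qa]]] := pq e e0.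
- have h1 : `|q| <= `|Ly a B| + e.
    by rewrite -[q](subrK (Ly a B)) (le_trans (ler_normD _ _)) // addrC lerD2l.
  have h2 : `|Lx a B| <= `|p| + e.
    rewrite -[Lx a B](subrK p) (le_trans (ler_normD _ _)) // addrC lerD2l.
    by rewrite distrC.
  apply: le_trans h1 _; apply: le_trans (lerD (yx a B) (lexx e)) _.
  by have := ler_wpM2l K0 h2; rewrite mulrDr; lra.
- have h1 : `|p| <= `|Lx a B| + e.
    by rewrite -[p](subrK (Lx a B)) (le_trans (ler_normD _ _)) // addrC lerD2l.
  have h2 : `|Ly a B| <= `|q| + e.
    rewrite -[Ly a B](subrK q) (le_trans (ler_normD _ _)) // addrC lerD2l.
    by rewrite distrC.
  apply: le_trans h1 _; apply: le_trans (lerD (xy a B) (lexx e)) _.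
  by have := ler_wpM2l K0 h2; rewrite mulrDr; lra.
Qed.

Let Rel_sub p q p' q' : Rel p q -> Rel p' q' -> Rel (p - p') (q - q').
Proof.
move=> pq pq'; have := joint_limit_lin (-1) pq' pq.
by rewrite !scaleN1r ![- _ + _]addrC.
Qed.

Lemma joint_limit_funl p q q' : Rel p q -> Rel p q' -> q = q'.
Proof.
move=> pq pq'; have [h _] := joint_limit_le (Rel_sub pq pq').
by apply/eqP; rewrite -subr_eq0 -normr_le0; rewrite subrr normr0 mulr0 in h.
Qed.

Lemma joint_limit_funr p p' q : Rel p q -> Rel p' q -> p = p'.
Proof.
move=> pq pq'; have [_ h] := joint_limit_le (Rel_sub pq pq').
by apply/eqP; rewrite -subr_eq0 -normr_le0; rewrite subrr normr0 mulr0 in h.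
Qed.

Let L_sub a B a' B' : exists a2 B2, Lx a2 B2 = Lx a B - Lx a' B' /\
  Ly a2 B2 = Ly a B - Ly a' B'.
Proof.
have [a2 [B2 [E E']]] := L_lin (-1) a' B' a B; exists a2, B2.
by rewrite E E' !scaleN1r ![- _ + _]addrC.
Qed.

Let inv_lt (e : R) : 0 < e -> exists N : nat, forall m, (N <= m)%N -> m.+1%:R^-1 < e.
Proof.
move=> e0; exists (Num.bound e^-1) => m Nm; rewrite -[ltRHS]invrK ltf_pV2 ?posrE ?invr_gt0 //.
apply: lt_le_trans (archi_boundP _) _; first by rewrite invr_ge0 ltW.
by rewrite ler_nat; apply: leq_trans Nm _.
Qed.

(** Combinations of the [x b] converging to [p] form a Cauchy sequence; by [yx] so do the same
    combinations of the [y b], whose limit is [q]. *)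
Lemma joint_limit_total p : (forall e : R, 0 < e -> exists a B, `|p - Lx a B| <= e) -> exists q, Rel p q.
Proof.
move=> clp; have /boolp.choice[aB aBP] (m : nat) : exists aB : (nat -> R) * nat,
    `|p - Lx aB.1 aB.2| <= m.+1%:R^-1.
  by have [a [B h]] := clp m.+1%:R^-1 ltac:(by rewrite invr_gt0); exists (a, B).
pose u m := Ly (aB m).1 (aB m).2.
have [|q uq] := @norm_cauchy_cvg _ _ u.
  move=> e e0; have eK : 0 < e / (K * 2) by rewrite divr_gt0 // mulr_gt0.
  have [N Ne] := inv_lt eK; exists N => m Nm.
  have [a2 [B2 [E E']]] := L_sub (aB N).1 (aB N).2 (aB m).1 (aB m).2.
  rewrite /u -E'; apply: le_lt_trans (yx _ _) _; rewrite E.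
  have := aBP N; have := aBP m; have := Ne N (leqnn _); have := Ne m Nm.
  move=> h1 h2 h3 h4; rewrite -ltr_pdivlMl //.
  have -> : K^-1 * e = e / (K * 2) + e / (K * 2) by field; rewrite gt_eqF.
  rewrite -[Lx (aB N).1 _ - _](subrKA p); apply: le_lt_trans (ler_normD _ _) _.
  apply: ltrD; last exact: le_lt_trans h1.
  by rewrite distrC; exact: le_lt_trans h2.
exists q => e e0; have [N1 N1e] := inv_lt e0; have [N2 N2e] := uq e e0.
exists (aB (maxn N1 N2)).1, (aB (maxn N1 N2)).2; split.
  by apply: le_trans (aBP _) (ltW (N1e _ (leq_maxl _ _))).
exact: ltW (N2e _ (leq_maxr _ _)).
Qed.

End EquivalentSequences.

Lemma joint_limit_sym (R : realType) (X Y : completeNormedModType R) (x : nat -> X)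
  (y : nat -> Y) p q : joint_limit x y p q -> joint_limit y x q p.
Proof. by move=> pq e /pq[a [B []]]; exists a, B. Qed.

Section EquivalentSpans.
Context (R : realType) (X Y : completeNormedModType R) (x : nat -> X) (y : nat -> Y)
  (K : R).
Hypothesis K_gt0 : 0 < K.
Hypothesis yx : forall (a : nat -> R) B,
  `|\sum_(b < B) a b *: y b| <= K * `|\sum_(b < B) a b *: x b|.
Hypothesis x_ge : forall (a : nat -> R) B b, (b < B)%N ->
  `|a b| <= K * `|\sum_(b < B) a b *: x b|.

Lemma joint_limit_subspace : banach_subspace [set p | exists q, joint_limit x y p q].
Proof.
split.
- split; first by exists 0; exact: joint_limit_zero.
  move=> a p p' [q pq] [q' pq']; exists (a *: q + q').
  exact: joint_limit_lin.
- move=> p clp; apply: (joint_limit_total K_gt0 yx) => e e0.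
  have e2 : 0 < e / 2 by rewrite divr_gt0.
  have [p' [q p'q] pp'] := closure_norm clp e2; have [a [B [h _]]] := p'q _ e2.
  exists a, B; rewrite -(subrKA p') [leRHS]splitr.
  by apply: le_trans (ler_normD _ _) _; apply: lerD => //; exact: ltW.
- apply: (@not_finite_dimensional _ _ _ x K) => // b; exists (y b) => e e0.
  exists (fun i => (i == b)%:R), b.+1.
  have sumE (V : lmodType R) (z : nat -> V) : \sum_(i < b.+1) (val i == b)%:R *: z i = z b.
    rewrite (bigD1 ord_max) //= eqxx scale1r big1 ?addr0 // => i ne.
    rewrite (_ : (val i == b) = false) ?scale0r //.
    by apply: contraNF ne => /eqP ib; apply/eqP/val_inj.
  by rewrite !sumE !subrr !normr0 ltW.
Qed.

End EquivalentSpans.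

Lemma equivalent_sequences (R : realType) (X Y : completeNormedModType R) (x : nat -> X)
    (y : nat -> Y) (K : R) : 0 < K ->
  (forall (a : nat -> R) B,
    `|\sum_(b < B) a b *: x b| <= K * `|\sum_(b < B) a b *: y b|) ->
  (forall (a : nat -> R) B,
    `|\sum_(b < B) a b *: y b| <= K * `|\sum_(b < B) a b *: x b|) ->
  (forall (a : nat -> R) B b, (b < B)%N -> `|a b| <= K * `|\sum_(b < B) a b *: x b|) ->
  ~ totally_incomparable X Y.
Proof.
move=> K0 xy yx x_ge; pose V := [set p | exists q, joint_limit x y p q].
pose W := [set q | exists p, joint_limit y x q p].
move=> /(_ V W); apply.
- exact: joint_limit_subspace x_ge.
- apply: (@joint_limit_subspace _ _ _ _ _ (Num.max K (K * K))).
  + by rewrite lt_max K0.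
  + by move=> a B; apply: le_trans (xy a B) _; rewrite ler_wpM2r // le_max lexx.
  + move=> a B b bB; apply: le_trans (x_ge a B b bB) _.
    apply: le_trans (_ : K * (K * `|\sum_(b < B) a b *: y b|) <= _).
      by rewrite ler_wpM2l // ltW.
    by rewrite mulrA ler_wpM2r // le_max lexx orbT.
have /boolp.choice[T TP] p : exists q, V p -> joint_limit x y p q.
  by have [[q pq]|nV] := EM (V p); [exists q|exists 0 => /nV].
exists T; split.
- move=> a p p' Vp Vp'; apply: (joint_limit_funl K0 xy yx (p := a *: p + p')).
    apply: TP; have [q pq] := Vp; have [q' pq'] := Vp'; exists (a *: q + q').
    exact: joint_limit_lin.
  by apply: joint_limit_lin; exact: TP.
- split.
  + by move=> p Vp; exists p; apply: joint_limit_sym; exact: TP.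
  + move=> p p' /set_mem Vp /set_mem Vp' E; apply: (joint_limit_funr K0 xy yx (TP p Vp)).
    by rewrite E; exact: TP.
  + move=> q [p qp]; have pq := joint_limit_sym qp; exists p; first by exists q.
    by apply: (joint_limit_funl K0 xy yx (TP p _) pq); exists q.
- by exists K => p /TP/(joint_limit_le K0 xy yx)[].
- by exists K => p /TP/(joint_limit_le K0 xy yx)[].
Qed.

(** * Incomparability *)

Section FiniteCodimension.
Context (R : realType) (X : lmodType R).
Implicit Types (V : set X) (f : X -> R).

Definition linear_form_on V f : Prop :=
  forall (a : R) p q, V p -> V q -> f (a *: p + q) = a * f p + f q.

Lemma finite_dimensional_ker V f : linear_subspace V -> linear_form_on V f ->
  finite_dimensional (V `&` [set p | f p = 0]) -> finite_dimensional V.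
Proof.
move=> [V0 Vl] fl [n [v Ev]].
have [[p0 Vp0 fp0]|no] := EM (exists2 p, V p & f p <> 0); last first.
  exists n, v; rewrite -Ev; apply/seteqP; split=> [p Vp|p []//].
  by split=> //; apply: contrapT => fp; apply: no; exists p.
pose w (i : 'I_n.+1) := if unlift ord0 i is Some j then v j else p0.
exists n.+1, w; apply/seteqP; split=> [p Vp|_ [a ->]] /=.
  pose c := f p / f p0.
  have : (V `&` [set p | f p = 0]) ((- c) *: p0 + p).
    split; first exact: Vl.
    by rewrite /= fl // /c mulNr divfK ?addNr //; apply/eqP.
  rewrite Ev => -[a Ea]; exists (fun i => if unlift ord0 i is Some j then a j else c).
  rewrite big_ord_recl /w unlift_none.
  under eq_bigr do rewrite liftK.
  by rewrite -Ea scaleNr addNKr.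
have Vsum (u : 'I_n -> X) (a' : 'I_n -> R) : (forall i, V (u i)) -> V (\sum_(i < n) a' i *: u i).
  move=> Vu; elim/big_ind: _ => // [q q' Vq Vq'|i _].
    by rewrite -[q]scale1r; exact: Vl.
  by rewrite -[_ *: _]addr0; exact: Vl.
have Vv j : V (v j).
  suff : (V `&` [set p | f p = 0]) (v j) by case.
  rewrite Ev; exists (fun i => (i == j)%:R); rewrite (bigD1 j) //= eqxx scale1r.
  by rewrite big1 ?addr0 // => i /negbTE->; rewrite scale0r.
rewrite big_ord_recl; apply: Vl; first by rewrite /w unlift_none.
by apply: Vsum => i; rewrite /w liftK.
Qed.

Lemma kernel_vector V (f : nat -> X -> R) K : linear_subspace V ->
  ~ finite_dimensional V -> (forall i, linear_form_on V (f i)) ->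
  exists p, [/\ V p, p != 0 & forall i, (i < K)%N -> f i p = 0].
Proof.
move=> Vl nfd fl; pose U K' := V `&` [set p | forall i, (i < K')%N -> f i p = 0].
have Ul K' : linear_subspace (U K').
  have [V0 VL] := Vl; split.
    split=> // i _; have := fl i 1 0 0 V0 V0.
    by rewrite scaler0 addr0 mul1r => /esym/(canRL (addrK _)); rewrite subrr.
  move=> a p q [Vp fp] [Vq fq]; split; first exact: VL.
  by move=> i iK; rewrite fl // fp // fq // mulr0 addr0.
have Unfd K' : ~ finite_dimensional (U K').
  elim: K' => [|K' IH].
    rewrite (_ : U 0%N = V) //; apply/seteqP; split=> [p []//|p Vp].
    by split.
  move=> fd; apply: IH; apply: (finite_dimensional_ker (f := f K')) => //.
    by move=> a p q [Vp _] [Vq _]; exact: fl.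
  rewrite (_ : _ `&` _ = U K'.+1) //; apply/seteqP; split=> p.
    move=> [[Vp fp] fK]; split=> // i; rewrite ltnS leq_eqVlt.
    by move=> /orP[/eqP->|/fp].
  by move=> [Vp fp]; split; [split=> // i /ltnW; exact: fp|exact: fp].
apply: contrapT => no; apply: (Unfd K); exists 0%N, (fun _ => 0).
apply/seteqP; split=> [p [Vp fp]|_ [a ->]].
  exists (fun _ => 0); rewrite big_ord0; apply: contrapT => p0.
  by apply: no; exists p; split=> //; apply/eqP.
by rewrite big_ord0; case: (Ul K).
Qed.

End FiniteCodimension.

(** * Coordinate functionals on the completion *)

Section Completion.
Context (R : realType) (l : nat) (M : 'I_l -> set {fset nat}) (theta : 'I_l -> R).
Hypothesis theta01 : forall k, 0 < theta k < 1.
Context (X : completeNormedModType R) (iota : (nat -> R^o) -> X).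
Hypothesis iota_lin : linear_on (@c00 R) iota.
Hypothesis iota_norm : forall x, c00 x -> (`|iota x|)%:E = mt_norm M theta x.
Hypothesis iota_dense : dense (iota @` @c00 R).

Notation nrm := (nrm M theta).

Lemma norm_iota x : c00 x -> `|iota x| = nrm x.
Proof. by move=> cx; apply: EFin_inj; rewrite iota_norm // nrmE. Qed.

Lemma c00_zero : c00 (0 : nat -> R^o).
Proof. by exists 0%N. Qed.

Lemma c00_lin (c : R) (x y : nat -> R^o) : c00 x -> c00 y -> c00 (c *: x + y).
Proof.
move=> [K xK] [L yL]; exists (maxn K L) => i; rewrite geq_max => /andP[Ki Li].
have -> : (c *: x + y) i = c *: x i + y i by [].
by rewrite xK // yL // scaler0 addr0.
Qed.

Lemma iota0 : iota 0 = 0.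
Proof.
have := iota_lin 1 c00_zero c00_zero; rewrite scaler0 addr0 scale1r.
by move=> /esym/(canRL (addrK _)); rewrite subrr.
Qed.

Lemma iotaB x y : c00 x -> c00 y -> iota x - iota y = iota (- 1 *: y + x).
Proof. by move=> cx cy; rewrite iota_lin // scaleN1r addrC. Qed.

Lemma iota_comb (a : nat -> R) (u : nat -> nat -> R^o) B : (forall b, c00 (u b)) ->
  iota (comb a u B) = \sum_(b < B) a b *: iota (u b).
Proof.
move=> cu; elim: B => [|B IH].
  rewrite big_ord0 -iota0; congr iota; apply/funext => i.
  by rewrite /comb big_ord0.
rewrite big_ord_recr /= -IH addrC -iota_lin //; last exact: c00_comb.
congr iota; apply/funext => i; rewrite [LHS]/comb big_ord_recr /= addrC.
by [].
Qed.

Lemma iota_approx p (e : R) : 0 < e -> exists2 x, c00 x & `|p - iota x| < e.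
Proof.
move=> e0; have [||q [pq [x cx xq]]] := iota_dense (O := ball p e).
- by exists p; exact: ballxx.
- exact: ball_open.
by move: pq; rewrite -xq -ball_normE /=; exists x.
Qed.

Let subE (x y : nat -> R^o) i : (- 1 *: y + x) i = x i - y i.
Proof.
have -> : (- 1 *: y + x) i = - 1 * y i + x i :> R by [].
by rewrite mulN1r addrC.
Qed.

Lemma coord_le x y i : c00 x -> c00 y -> `|x i - y i| <= `|iota x - iota y|.
Proof.
move=> cx cy; rewrite iotaB // norm_iota; last exact: c00_lin.
have := @nrm_ge _ _ M _ theta01 _ i (c00_lin (-1) cy cx).
by rewrite subE.
Qed.

(** The McShane-Whitney extension of x -> x_i, which is 1-Lipschitz on the dense image of [c00] by
    [coord_le]. Linearity then follows by approximation. *)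
Definition coordinate i p : R :=
  sup [set r | exists2 x, c00 x & r = x i - `|p - iota x|].

Lemma coordinateP i p x : c00 x -> `|coordinate i p - x i| <= `|p - iota x|.
Proof.
move=> cx; have ub y : c00 y -> y i - `|p - iota y| <= x i + `|p - iota x|.
  move=> cy; rewrite lerBlDr -addrA -lerBlDl; apply: le_trans (ler_norm _) _.
  apply: le_trans (coord_le i cy cx) _; rewrite -(subrKA p).
  by apply: le_trans (ler_normD _ _) _; rewrite distrC addrC lerD2l distrC.
rewrite ler_distl; apply/andP; split.
  apply: ub_le_sup; last by exists x.
  by exists (x i + `|p - iota x|) => _ [y cy ->]; exact: ub.
by apply: ge_sup => [|_ [y cy ->]]; [exists (x i - `|p - iota x|), x|exact: ub].
Qed.

Lemma coordinate_lin i (c : R) p q :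
  coordinate i (c *: p + q) = c * coordinate i p + coordinate i q.
Proof.
apply/eqP; rewrite -subr_eq0 -normr_le0.
apply: (@ler_addgt0_mul _ _ _ (2 * (`|c| + 1))) => [|e e0].
  by rewrite mulr_ge0 // addr_ge0.
have [x cx px] := iota_approx p e0; have [y cy qy] := iota_approx q e0.
have h1 := coordinateP i p cx; have h2 := coordinateP i q cy.
have h3 := coordinateP i (c *: p + q) (c00_lin c cx cy).
have Exy : (c *: x + y) i = c * x i + y i by [].
rewrite Exy in h3.
have h4 : `|c *: p + q - iota (c *: x + y)| <= `|c| * e + e.
  rewrite iota_lin // opprD addrACA -scalerBr; apply: le_trans (ler_normD _ _) _.
  by rewrite normrZ lerD ?ler_wpM2l // ltW.
rewrite add0r.
have -> : coordinate i (c *: p + q) - (c * coordinate i p + coordinate i q) =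
    (coordinate i (c *: p + q) - (c * x i + y i)) -
    (c * (coordinate i p - x i) + (coordinate i q - y i)) by ring.
apply: le_trans (ler_normB _ _) _.
have h5 : `|c * (coordinate i p - x i) + (coordinate i q - y i)| <= `|c| * e + e.
  apply: le_trans (ler_normD _ _) _; rewrite normrM lerD ?ler_wpM2l //.
    exact: le_trans h1 (ltW px).
  exact: le_trans h2 (ltW qy).
have := le_trans h3 h4; nra.
Qed.

Lemma nrm_sum x K : (forall i, (K <= i)%N -> x i = 0) -> nrm x <= \sum_(i < K) `|x i|.
Proof.
move=> xK; have cx : c00 x by exists K.
apply: (nrm_le theta01) => // t; rewrite -lee_fin nrmsE //.
exact: mt_step_sum.
Qed.

(** An approximant within e / (N + 1) has its first [N] coordinates that small too, so deleting them
    changes the norm by at most N e / (N + 1), and the two errors add up to [e]. *)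
Lemma tail_approx p N (e : R) : 0 < e -> (forall i, (i < N)%N -> coordinate i p = 0) ->
  exists x, [/\ c00 x, forall i, x i != 0 -> (N <= i)%N & `|p - iota x| <= e].
Proof.
move=> e0 p0; have d0 : 0 < e / N.+1%:R by rewrite divr_gt0.
have [x cx px] := iota_approx p d0.
pose y : nat -> R^o := fun i => if (i < N)%N then x i else 0.
have y0 i : (N <= i)%N -> y i = 0 by rewrite /y ltnNge => ->.
have cy : c00 y by exists N.
exists (- 1 *: y + x); split; first exact: c00_lin.
  by move=> i; apply: contraNT; rewrite -ltnNge subE /y => ->; apply/eqP; exact: subrr.
rewrite -iotaB // opprB addrCA addrC.
have ny : `|iota y| <= N%:R * (e / N.+1%:R).
  rewrite norm_iota //; apply: le_trans (nrm_sum y0) _.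
  apply: (@le_trans _ _ (\sum_(i < N) e / N.+1%:R)).
    apply: ler_sum => i _; rewrite /y ltn_ord.
    have := coordinateP i p cx; rewrite p0 // sub0r normrN.
    by move=> /le_trans; apply; exact: ltW.
  by rewrite big_const_ord iter_addr_0 mulr_natl.
apply: le_trans (ler_normD _ _) _; apply: le_trans (lerD (ltW px) ny) _.
by rewrite -{1}[e / _]mul1r -mulrDl -natr1 addrC mulrCA divff ?mulr1.
Qed.

End Completion.

Section Incomparability.
Context (R : realType) (l l' : nat)
  (theta : 'I_l -> R) (M : 'I_l -> set {fset nat}) (n : 'I_l -> nat)
  (theta' : 'I_l' -> R) (M' : 'I_l' -> set {fset nat}) (n' : 'I_l' -> nat).
Hypothesis theta01 : forall k, 0 < theta k < 1.
Hypothesis hM : forall k, hereditary_family (M k).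
Hypothesis n_gt0 : forall k, (0 < n k)%N.
Hypothesis iM : forall k, has_index (M k) (n k).
Hypothesis theta'01 : forall k, 0 < theta' k < 1.
Hypothesis hM' : forall k, hereditary_family (M' k).
Hypothesis iM' : forall k, has_index (M' k) (n' k).
Context (X X' : completeNormedModType R).
Hypothesis X_mt : is_mixed_tsirelson M theta X.
Hypothesis X'_mt : is_mixed_tsirelson M' theta' X'.

Lemma linear_on_sum (V : set X) (T : X -> X') (v : nat -> X) B :
  linear_subspace V -> linear_on V T -> (forall b, V (v b)) ->
  T (\sum_(b < B) v b) = \sum_(b < B) T (v b) /\ V (\sum_(b < B) v b).
Proof.
move=> [V0 VL] TL Vv; elim: B => [|B [IH VB]].
  rewrite !big_ord0; split=> //; have := TL 1 0 0 V0 V0.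
  by rewrite scaler0 addr0 scale1r => /esym/(canRL (addrK _)); rewrite subrr.
rewrite !big_ord_recr /= -IH addrC -[v B]scale1r; split; last exact: VL.
by rewrite TL // !scale1r addrC.
Qed.

(* Gliding hump, run simultaneously in a subspace V and in its image: finitely
   many coordinates of p and of T p can be made to vanish at once. *)
Lemma incomparable_spaces k (s t : R) : (1 < n k)%N -> 0 < s < 1 ->
  (n k)%:R `^ s = (n k)%:R * theta k -> 0 < t < s ->
  (forall k', theta' k' * (n' k')%:R `^ (1 - t) < 1) ->
  forall (V : set X) (W : set X'), banach_subspace V -> ~ isomorphic_subspaces V W.
Proof.
move=> n1 s01 ns /andP[t0 ts] ht V W [Vl _ nfd] [T [TL _ [C1 TC1] [C2 TC2]]].
have /andP[s0 s1] := s01.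
have [J [iota_lin iota_norm iota_dense]] := X_mt.
have [J' [iota'_lin iota'_norm iota'_dense]] := X'_mt.
have [e [g1 [c [c0 low]]]] := lower_blocks theta01 hM n_gt0 iM n1 s01 ns.
have [|g2 [C up]] := upper_flat theta'01 hM' iM' _ ht.
  by rewrite t0 (lt_trans ts s1).
(* [K1] exceeds [C1 + d], so the approximants of the images [T (v b)] have norm at most 1 after
   division by [K1], as [upper_flat] requires. *)
pose K1 := Num.max C1 0 + 1; pose K2 := Num.max C2 0.
have K1_ge1 : 1 <= K1 by rewrite lerDr le_max lexx orbT.
have K1_gt0 : 0 < K1 by apply: lt_le_trans K1_ge1.
have K2_ge0 : 0 <= K2 by rewrite le_max lexx orbT.
have TK2 p : V p -> `|p| <= K2 * `|T p|.
  by move=> /TC2/le_trans; apply; rewrite ler_wpM2r // le_max lexx.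
have crd := coordinate_lin theta01 iota_lin iota_norm iota_dense.
have crd' := coordinate_lin theta'01 iota'_lin iota'_norm iota'_dense.
have hump (d : R) N : 0 < d -> exists p x x', [/\ V p, `|p| = 1,
    c00 x /\ (forall i, x i != 0 -> (N <= i)%N) /\ `|p - J x| <= d &
    c00 x' /\ (forall i, x' i != 0 -> (N <= i)%N) /\ `|T p - J' x'| <= d].
  (* Indices below [N] read coordinates of [p] in [X], those from [N] to [2N - 1] read coordinates
     of [T p] in [X']; a common zero of all [2N] forms starts late in both spaces. *)
  move=> d0; pose f i p := if (i < N)%N then coordinate J i p else coordinate J' (i - N) (T p).
  have [i|p [Vp p0 fp]] := kernel_vector (f := f) (N + N) Vl nfd.
    move=> a p q Vp Vq; rewrite /f; case: ifP => _; first exact: crd.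
    by rewrite TL // crd'.
  have np : 0 < `|p| by rewrite normr_gt0.
  have [V0 VL] := Vl; pose q := `|p|^-1 *: p.
  have Vq : V q by rewrite /q -[_ *: _]addr0; exact: VL.
  have fq i : (i < N + N)%N -> f i q = 0.
    move=> iN; have := fp i iN; rewrite /f; have T0 : T q = `|p|^-1 *: T p + T 0.
      by rewrite -TL // addr0.
    have T00 : T 0 = 0.
      have := TL 1 0 0 V0 V0.
      by rewrite scaler0 addr0 scale1r => /esym/(canRL (addrK _)); rewrite subrr.
    have co0 i0 : coordinate J i0 0 = 0.
      have := crd i0 1 0 0.
      by rewrite scaler0 addr0 mul1r => /esym/(canRL (addrK _)); rewrite subrr.
    have co0' i0 : coordinate J' i0 0 = 0.
      have := crd' i0 1 0 0.
      by rewrite scaler0 addr0 mul1r => /esym/(canRL (addrK _)); rewrite subrr.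
    case: ifP => _ E.
      by rewrite -[q]addr0 crd E mulr0 co0 addr0.
    by rewrite T0 crd' E mulr0 T00 co0' addr0.
  have [|x [cx xN px]] := tail_approx theta01 iota_lin iota_norm iota_dense (N := N) d0 (p := q).
    by move=> i iN; have := fq i (ltn_addr _ iN); rewrite /f iN.
  have [|x' [cx' xN' px']] :=
      tail_approx theta'01 iota'_lin iota'_norm iota'_dense (N := N) d0 (p := T q).
    move=> i iN; have := fq (N + i)%N; rewrite ltn_add2l => /(_ iN).
    by rewrite /f ltnNge leq_addr /= addKn.
  exists q, x, x'; split=> //.
  by rewrite normrZ gtr0_norm ?invr_gt0 // mulVf ?gt_eqF.
have main B : (0 < B)%N ->
    c / 2 * B%:R `^ s <= K2 * (K1 * Num.max C 0) * B%:R `^ t + (K2 + 1).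
  (* With [B] humps the total error is at most 1/2, and each approximant keeps norm at least 1/2,
     whence the constant [c / 2]. *)
  move=> B0; pose d : R := (B%:R * 2)^-1.
  have B0' : 0 < B%:R :> R by rewrite ltr0n.
  have d0 : 0 < d by rewrite invr_gt0 mulr_gt0.
  have Bd : B%:R * d = 2^-1 by rewrite /d invfM mulrA divff ?mul1r // gt_eqF.
  have d_le : d <= 2^-1.
    by rewrite -Bd ler_peMl ?(ltW d0) // ler1n.
  pose P N (b : nat) (q : X * (nat -> R^o) * (nat -> R^o)) N' :=
    [/\ V q.1.1, `|q.1.1| = 1,
      c00 q.1.2 /\ (forall i, q.1.2 i != 0 -> (maxn e N <= i < N')%N /\ (g1 i <= N')%N) /\
        `|q.1.1 - J q.1.2| <= d &
      c00 q.2 /\ (forall i, q.2 i != 0 -> (maxn e N <= i < N')%N /\ (g2 i <= N')%N) /\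
        `|T q.1.1 - J' q.2| <= d].
  have [|q [N_ [qP N_le]]] := @dependent_sequence _ P.
    move=> N b; have [p [x [x' [Vp p1 [cx [xN px]] [cx' [xN' px']]]]]] := hump d (maxn e N) d0.
    have [L Lx] := cx; have [L' Lx'] := cx'.
    have [G1 G1P] := seq_bound g1 (iota 0 L); have [G2 G2P] := seq_bound g2 (iota 0 L').
    pose N' := maxn (maxn N (maxn L L')) (maxn G1 G2).
    have ltL (z : nat -> R^o) K i : (forall i, (K <= i)%N -> z i = 0) -> z i != 0 -> (i < K)%N.
      by move=> zK; rewrite ltnNge; apply: contra => /zK->.
    exists (p, x, x'), N'; split; last by rewrite !leq_max leqnn.
    split=> //=; split=> //; split=> // i xi.
      have iL := ltL x L i Lx xi; have := G1P i; rewrite mem_iota /= => /(_ iL) gi.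
      by rewrite xN //= !leq_max iL gi !orbT.
    have iL := ltL x' L' i Lx' xi; have := G2P i; rewrite mem_iota /= => /(_ iL) gi.
    by rewrite xN' //= !leq_max iL gi !orbT.
  pose v b := (q b).1.1; pose a b := (q b).1.2; pose a' b := (q b).2.
  have Vv b : V (v b) by have [] := qP b.
  have v1 b : `|v b| = 1 by have [] := qP b.
  have ca b : c00 (a b) by have [_ _ []] := qP b.
  have ca' b : c00 (a' b) by have [_ _ _ []] := qP b.
  have va b : `|v b - J (a b)| <= d by have [_ _ [_ []]] := qP b.
  have va' b : `|T (v b) - J' (a' b)| <= d by have [_ _ _ [_ []]] := qP b.
  have aN b i : a b i != 0 -> (maxn e (N_ b) <= i < N_ b.+1)%N /\ (g1 i <= N_ b.+1)%N.
    by move=> ai; have [_ _ [_ [/(_ i ai)]]] := qP b.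
  have aN' b i : a' b i != 0 -> (maxn e (N_ b) <= i < N_ b.+1)%N /\ (g2 i <= N_ b.+1)%N.
    by move=> ai; have [_ _ _ [_ [/(_ i ai)]]] := qP b.
  have ga : block_seq g1 a.
    split=> // b b' i j bb' /aN[/andP[_ ai] gi] /aN[/andP[+ _] _].
    rewrite geq_max => /andP[_ aj]; have Nj := leq_trans (N_le b.+1 b' bb') aj.
    by split; [exact: leq_trans ai Nj|exact: leq_trans gi Nj].
  have d_ge0 := ltW d0.
  have close (Y : completeNormedModType R) (y z : nat -> Y) : (forall b, `|y b - z b| <= d) ->
      `|\sum_(b < B) y b - \sum_(b < B) z b| <= 2^-1.
    move=> yz; rewrite -sumrB; apply: le_trans (ler_norm_sum _ _ _) _.
    apply: (@le_trans _ _ (\sum_(b < B) d)); first exact: ler_sum.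
    by rewrite big_const_ord iter_addr_0 -[leLHS]mulr_natl Bd.
  have normD (Y : normedModType R) (y z : Y) (r : R) : `|y - z| <= r -> `|y| <= `|z| + r.
    move=> yz; rewrite -[y](subrK z) (le_trans (ler_normD _ _)) //.
    by rewrite addrC lerD2l.
  have low_a : c / 2 * B%:R `^ s <= nrm M theta (comb (fun _ => 1) a B).
    apply: le_trans (low a ga _ (fun _ => 1) B); last first.
      by move=> b i /aN[/andP[+ _] _]; rewrite geq_max => /andP[].
    rewrite -mulrA ler_wpM2l ?(ltW c0) //.
    have -> : 2^-1 * B%:R `^ s = (\sum_(b < B) 2^-1 `^ s^-1) `^ s :> R.
      have -> : \sum_(b < B) 2^-1 `^ s^-1 = B%:R * 2^-1 `^ s^-1 :> R.
        by rewrite big_const_ord iter_addr_0 -[LHS]mulr_natl.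
      rewrite powRM ?powR_ge0 // -powRrM.
      by rewrite mulVf ?gt_eqF // powRr1 ?invr_ge0 // mulrC.
    apply: ge0_ler_powR; rewrite ?nnegrE ?(ltW s0) //.
    - by apply: sumr_ge0 => b _; exact: powR_ge0.
    - by apply: sumr_ge0 => b _; exact: powR_ge0.
    apply: ler_sum => b _; apply: ge0_ler_powR; rewrite ?nnegrE ?invr_ge0 ?(ltW s0) //.
      by rewrite mulr_ge0 // nrm_ge0.
    rewrite normr1 mul1r -(norm_iota theta01 iota_norm) //.
    have := normD _ _ _ _ (va b); rewrite v1; lra.
  have ca'u b : c00 (fun i => K1^-1 * a' b i : R^o) by exact: c00Z.
  have gu : block_seq g2 (fun b i => K1^-1 * a' b i : R^o).
    split=> // b b' i j bb' ui uj.
    have /aN'[/andP[_ ai] gi] : a' b i != 0 by apply: contraNneq ui => ->; rewrite mulr0.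
    have /aN'[/andP[+ _] _] : a' b' j != 0 by apply: contraNneq uj => ->; rewrite mulr0.
    rewrite geq_max => /andP[_ aj]; have Nj := leq_trans (N_le b.+1 b' bb') aj.
    by split; [exact: leq_trans ai Nj|exact: leq_trans gi Nj].
  have up_a : nrm M' theta' (comb (fun _ => 1) a' B) <= K1 * (Num.max C 0 * B%:R `^ t).
    have -> : comb (fun _ => 1) a' B =
        (fun i => K1 * comb (fun _ => 1) (fun b i => K1^-1 * a' b i : R^o) B i).
      apply/funext => i; rewrite /comb mulr_sumr; apply: eq_bigr => b _.
      by rewrite !mul1r mulVKf // gt_eqF.
    rewrite nrm_scale // ?gtr0_norm //; last exact: c00_comb.
    rewrite ler_wpM2l ?(ltW K1_gt0) //; apply: le_trans (up _ gu _ B) _.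
      move=> b; rewrite nrm_scale // gtr0_norm ?invr_gt0 // ler_pdivrMl // mulr1.
      rewrite -(norm_iota theta'01 iota'_norm) //.
      have h := va' b; rewrite distrC in h; apply: le_trans (normD _ _ _ _ h) _.
      rewrite /K1; apply: lerD; last by apply: le_trans d_le _; lra.
      apply: le_trans (TC1 _ (Vv b)) _; rewrite v1 mulr1 le_max lexx //.
    by rewrite ler_wpM2r ?powR_ge0 // le_max lexx.
  have [Tsum Vsum] := linear_on_sum B Vl TL Vv.
  have sum1 (u : nat -> nat -> R^o) (Y : completeNormedModType R) (j : (nat -> R^o) -> Y) :
      \sum_(b < B) (1 : R) *: j (u b) = \sum_(b < B) j (u b).
    by apply: eq_bigr => b _; rewrite scale1r.
  have h1 : nrm M theta (comb (fun _ => 1) a B) <= `|\sum_(b < B) v b| + 2^-1.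
    rewrite -(norm_iota theta01 iota_norm); last exact: c00_comb.
    rewrite (iota_comb iota_lin) // sum1; apply: normD; rewrite distrC.
    exact: (close _ v (fun b => J (a b)) va).
  have h2 : `|T (\sum_(b < B) v b)| <= nrm M' theta' (comb (fun _ => 1) a' B) + 2^-1.
    rewrite -(norm_iota theta'01 iota'_norm); last exact: c00_comb.
    rewrite (iota_comb iota'_lin) // sum1 Tsum; apply: normD.
    exact: (close _ (fun b => T (v b)) (fun b => J' (a' b)) va').
  apply: le_trans low_a _; apply: le_trans h1 _.
  apply: le_trans (lerD (TK2 _ Vsum) (lexx _)) _.
  apply: (@le_trans _ _ (K2 * (K1 * (Num.max C 0 * B%:R `^ t) + 2^-1) + 2^-1)).
    by rewrite lerD2r ler_wpM2l // (le_trans h2) // lerD2r.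
  rewrite mulrDr -!mulrA -addrA lerD2l; apply: lerD; last by lra.
  by rewrite ler_piMr //; lra.
set A := K2 * _ in main.
have A0 : 0 <= A by rewrite mulr_ge0 // mulr_ge0 ?(ltW K1_gt0) // le_max lexx orbT.
(* [B] is taken so large that B^(s-t) exceeds [Z]; as B^t >= 1, the additive constant [K2 + 1] is
   absorbed into the term in B^t. *)
pose Z := (A + (K2 + 1)) / (c / 2); have c2 : 0 < c / 2 by rewrite divr_gt0.
have Z0 : 0 <= Z by rewrite divr_ge0 ?(ltW c2) // !addr_ge0.
have st : 0 < s - t by rewrite subr_gt0.
pose B := (Num.bound (Z `^ (s - t)^-1)).+1.
have BZ : Z < B%:R `^ (s - t).
  have -> : Z = (Z `^ (s - t)^-1) `^ (s - t) by rewrite -powRrM mulVf ?gt_eqF // powRr1.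
  apply: gt0_ltr_powR; rewrite ?nnegrE ?powR_ge0 //.
  apply: lt_le_trans (archi_boundP (powR_ge0 _ _)) _.
  by rewrite ler_nat.
have Bt1 : 1 <= B%:R `^ t :> R.
  apply: (@le_trans _ _ ((1 : R) `^ t)); first by rewrite powR1.
  have B1 : (1 : R) <= B%:R by rewrite (ler_nat R 1).
  by apply: ge0_ler_powR; rewrite ?nnegrE ?(ltW t0).
have := main B (ltn0Sn _); rewrite leNgt => /negP; apply.
apply: (@le_lt_trans _ _ ((A + (K2 + 1)) * B%:R `^ t)).
  by rewrite mulrDl lerD2l ler_peMr // addr_ge0.
have -> : B%:R `^ s = B%:R `^ (s - t) * B%:R `^ t :> R.
  rewrite -powRD ?subrK //; by apply/implyP => _; rewrite pnatr_eq0.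
rewrite mulrA ltr_pM2r; last exact: lt_le_trans Bt1.
by rewrite -ltr_pdivrMl // mulrC.
Qed.

End Incomparability.

Lemma isomorphic_subspaces_sym (R : realType) (X Y : completeNormedModType R)
    (V : set X) (W : set Y) : linear_subspace V ->
  isomorphic_subspaces V W -> isomorphic_subspaces W V.
Proof.
move=> [_ VL] [T [TL [TV Tinj Tsurj] [C1 TC1] [C2 TC2]]].
have /boolp.choice[S SP] q : exists p, W q -> V p /\ T p = q.
  by have [/Tsurj[p Vp <-]|nW] := EM (W q); [exists p|exists 0 => /nW].
have TS q : W q -> T (S q) = q by move=> /SP[].
have VS q : W q -> V (S q) by move=> /SP[].
have inj p p' : V p -> V p' -> T p = T p' -> p = p'.
  by move=> Vp Vp'; apply: Tinj; rewrite inE.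
exists S; split.
- move=> a q q' Wq Wq'; have Vl : V (a *: S q + S q') by apply: VL; exact: VS.
  have E : T (a *: S q + S q') = a *: q + q' by rewrite TL ?TS //; exact: VS.
  have W2 : W (a *: q + q') by rewrite -E; exact: TV.
  by apply: inj => //; [exact: VS|rewrite TS].
- split.
  + by move=> q /VS.
  + move=> q q' /set_mem Wq /set_mem Wq' E.
    by rewrite -(TS q Wq) E TS.
  + move=> p Vp; have Wp : W (T p) by exact: TV.
    by exists (T p) => //; apply: inj => //; [exact: VS|rewrite TS].
- by exists C2 => q Wq; rewrite -{2}(TS q Wq); apply: TC2; exact: VS.
- by exists C1 => q Wq; rewrite -{1}(TS q Wq); apply: TC1; exact: VS.
Qed.

(** * Exponents *)

Lemma sum_fset_iota (R : realType) (f : nat -> R) B :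
  \sum_(b <- [fset b in iota 0 B]%fset) f b = \sum_(b < B) f b.
Proof.
rewrite -(big_mkord xpredT f); apply: perm_big; apply: uniq_perm => [||i].
- exact: fset_uniq.
- exact: iota_uniq.
- by rewrite in_fset mem_index_iota mem_iota.
Qed.

(** The lower estimate is fixed first, because its position and gap are then handed to [lp_blocks].
    For [t = 0] it is the trivial bound by a single block; otherwise it uses a [k] attaining the
    exponent. *)
Lemma lp_sequence (R : realType) (l : nat) (theta : 'I_l -> R)
    (M : 'I_l -> set {fset nat}) (n : 'I_l -> nat) (t : R)
    (X : completeNormedModType R) :
  (forall k, 0 < theta k < 1) -> (forall k, hereditary_family (M k)) ->
  (forall k, (0 < n k)%N) -> (forall k, has_index (M k) (n k)) ->
  is_mixed_tsirelson M theta X -> 0 <= t < 1 ->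
  (forall k, theta k * (n k)%:R `^ (1 - t) <= 1) ->
  (t != 0 -> exists2 k, (1 < n k)%N & (n k)%:R `^ t = (n k)%:R * theta k) ->
  exists (x : nat -> X) (K : R), 0 < K /\ forall (a : nat -> R) B,
    `|\sum_(b < B) a b *: x b| <= K * lpn t a [fset b in iota 0 B]%fset /\
    lpn t a [fset b in iota 0 B]%fset <= K * `|\sum_(b < B) a b *: x b|.
Proof.
move=> theta01 hM n_gt0 iM [J [J_lin J_norm _]] t01 ht tk.
have [e [g [c [c0 low]]]] : exists (e : nat) (g : nat -> nat) (c : R), 0 < c /\
    forall v : nat -> nat -> R^o, block_seq g v -> (forall b i, v b i != 0 -> (e <= i)%N) ->
    (forall b, nrm M theta (v b) = 1) -> forall (a : nat -> R) B,
    c * lpn t a [fset b in iota 0 B]%fset <= nrm M theta (comb a v B).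
  have [t_eq0|tn0] := eqVneq t 0.
    exists 0%N, id, 1; split=> // v gv _ v1 a B.
    rewrite mul1r t_eq0 /lpn eqxx; apply: max_le.
      by apply: nrm_ge0 => //; apply: c00_comb; exact: gv.1.
    move=> b; rewrite in_fset mem_iota /= => bB.
    by have := nrm_block M theta01 a gv bB; rewrite v1 mulr1.
  have [k n1 nt] := tk tn0; have t01' : 0 < t < 1.
    by have /andP[t0 t1] := t01; rewrite lt_def tn0 t0.
  have [e [g [c [c0 low]]]] := lower_blocks theta01 hM n_gt0 iM n1 t01' nt.
  exists e, g, c; split=> // v gv ve v1 a B.
  have := low v gv ve a B; rewrite /lpn (negbTE tn0) sum_fset_iota.
  have -> : \sum_(b < B) (`|a b| * nrm M theta (v b)) `^ t^-1 = \sum_(b < B) `|a b| `^ t^-1.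
    by apply: eq_bigr => b _; rewrite v1 mulr1.
  exact.
have [v [C [gv ve v1 up]]] := lp_blocks theta01 hM iM t01 ht e g.
have cv b : c00 (v b) by exact: gv.1.
exists (fun b => J (v b)), (Num.max (Num.max C c^-1) 1).
have K1 : 0 < Num.max (Num.max C c^-1) 1 by rewrite lt_max ltr01 orbT.
split=> // a B; rewrite -(iota_comb J_lin) // (norm_iota theta01 J_norm); last exact: c00_comb.
have l0 : 0 <= lpn t a [fset b in iota 0 B]%fset by exact: lpn_ge0.
have n0 : 0 <= nrm M theta (comb a v B) by apply: nrm_ge0 => //; exact: c00_comb.
split; first by apply: le_trans (up a B) _; rewrite ler_wpM2r // !le_max lexx.
apply: (@le_trans _ _ (c^-1 * nrm M theta (comb a v B))).
  by rewrite ler_pdivlMl // low.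
by rewrite ler_wpM2r // !le_max lexx orbT.
Qed.

Section Exponents.
Context (R : realType).

(** For [n > 1] this is the [t] with n^t = n theta, see [powR_exponent]; its reciprocal is what
    [min_exponent] minimizes. *)
Definition exponent (n : nat) (theta : R) : R := 1 - log_base n%:R (1 / theta).

Lemma index_gt1 n (theta : R) : 0 < theta < 1 -> 1 < n%:R * theta -> (1 < n)%N.
Proof.
move=> /andP[t0 t1] nt; rewrite ltnNge; apply: contraL nt => n1; rewrite -leNgt.
case: n n1 => [|[|//]] _; first by rewrite mul0r ler01.
by rewrite mul1r ltW.
Qed.

Lemma powR_exponent n (theta : R) : 0 < theta < 1 -> (1 < n)%N ->
  n%:R `^ exponent n theta = n%:R * theta.
Proof.
move=> /andP[t0 t1] n1; have n0 : 0 < n%:R :> R by rewrite ltr0n ltnW.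
have ln0 : 0 < ln n%:R :> R by rewrite ln_gt0 // ltr1n.
rewrite /exponent powRB; last by apply/implyP => _; rewrite gt_eqF.
rewrite powRr1 ?(ltW n0) //; congr (_ * _).
rewrite /log_base {1}/powR gt_eqF // divfK ?gt_eqF // lnK ?posrE ?divr_gt0 //.
by rewrite div1r invrK.
Qed.

Lemma exponent_itv n (theta : R) : 0 < theta < 1 -> 1 < n%:R * theta ->
  0 < exponent n theta < 1.
Proof.
move=> t01 nt; have n1 := index_gt1 t01 nt; have /andP[t0 t1] := t01.
have nR1 : 1 < n%:R :> R by rewrite ltr1n.
have pE := powR_exponent t01 n1; apply/andP; split; rewrite ltNge; apply/negP => h.
  have := ler_powR (ltW nR1) h; rewrite pE powRr0.
  by rewrite leNgt nt.
have := ler_powR (ltW nR1) h; rewrite pE powRr1 ?(le_trans ler01 (ltW nR1)) //.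
by rewrite leNgt gtr_pMr ?t1 ?(lt_trans ltr01).
Qed.

(** The left side is n theta times n^(-t), that is n^(exponent - t) when n theta > 1, and at most
    n^(-t) otherwise. For [n = 1], where the logarithm to base [n] is meaningless, it is [theta]. *)
Lemma contraction_lt n (theta t : R) : 0 < theta < 1 -> (0 < n)%N -> 0 < t ->
  (1 < n%:R * theta -> exponent n theta < t) -> theta * n%:R `^ (1 - t) < 1.
Proof.
move=> t01 n0 tp ht; have /andP[t0 t1] := t01.
have [n1|n1] := ltnP 1 n; last first.
  have -> : n = 1%N by apply/eqP; rewrite eqn_leq n1 n0.
  by rewrite powR1 mulr1.
have nR1 : 1 < n%:R :> R by rewrite ltr1n.
have nR0 : 0 < n%:R :> R by apply: lt_trans nR1.
have E : theta * n%:R `^ (1 - t) = (n%:R * theta) * n%:R `^ (- t).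
  rewrite powRD; last by apply/implyP => _; rewrite gt_eqF.
  by rewrite powRr1 ?(ltW nR0) // mulrA [theta * _]mulrC.
have lt_pow (u w : R) : u < w -> n%:R `^ u < n%:R `^ w.
  have ln0 : 0 < ln n%:R :> R by exact: ln_gt0.
  by move=> uw; rewrite /powR (gt_eqF nR0) ltr_expR ltr_pM2r.
rewrite E; have [nt|nt] := ltP 1 (n%:R * theta).
  rewrite -(powR_exponent t01 n1) -powRD; last by apply/implyP => _; rewrite gt_eqF.
  by rewrite -[ltRHS](powRr0 n%:R) lt_pow // subr_lt0 ht.
apply: le_lt_trans (_ : 1 * n%:R `^ (- t) < 1).
  by rewrite ler_wpM2r ?powR_ge0.
by rewrite mul1r -[ltRHS](powRr0 n%:R) lt_pow // oppr_lt0.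
Qed.

Lemma contraction_le n (theta t : R) : 0 < theta < 1 -> (0 < n)%N -> 0 <= t ->
  (1 < n%:R * theta -> exponent n theta <= t) -> theta * n%:R `^ (1 - t) <= 1.
Proof.
move=> t01 n0 tp ht; have /andP[t0 t1] := t01.
have [n1|n1] := ltnP 1 n; last first.
  have -> : n = 1%N by apply/eqP; rewrite eqn_leq n1 n0.
  by rewrite powR1 mulr1 ltW.
have nR1 : 1 < n%:R :> R by rewrite ltr1n.
have nR0 : 0 < n%:R :> R by apply: lt_trans nR1.
have E : theta * n%:R `^ (1 - t) = (n%:R * theta) * n%:R `^ (- t).
  rewrite powRD; last by apply/implyP => _; rewrite gt_eqF.
  by rewrite powRr1 ?(ltW nR0) // mulrA [theta * _]mulrC.
have le_pow (u w : R) : u <= w -> n%:R `^ u <= n%:R `^ w by exact: ler_powR (ltW nR1) _ _.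
rewrite E; have [nt|nt] := ltP 1 (n%:R * theta).
  rewrite -(powR_exponent t01 n1) -powRD; last by apply/implyP => _; rewrite gt_eqF.
  by rewrite -[leRHS](powRr0 n%:R) le_pow // subr_le0 ht.
apply: le_trans (_ : 1 * n%:R `^ (- t) <= 1).
  by rewrite ler_wpM2r ?powR_ge0.
by rewrite mul1r -[leRHS](powRr0 n%:R) le_pow // oppr_le0.
Qed.

Lemma gt_inv_index n (theta : R) : (0 < n)%N -> (1 / n%:R < theta) = (1 < n%:R * theta).
Proof. by move=> n0; rewrite ltr_pdivrMr ?ltr0n // mulrC. Qed.

Lemma max_exponent (l : nat) (theta : 'I_l -> R) (n : 'I_l -> nat) :
  (forall k, 0 < theta k < 1) -> (exists k, 1 < (n k)%:R * theta k) ->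
  exists k, [/\ 1 < (n k)%:R * theta k,
    forall j, 1 < (n j)%:R * theta j -> exponent (n j) (theta j) <= exponent (n k) (theta k) &
    min_exponent theta n = (1 / exponent (n k) (theta k))%:E].
Proof.
move=> theta01 [k1 k1P].
pose s := [seq k <- enum 'I_l | 1 < (n k)%:R * theta k].
have k1s : k1 \in s by rewrite mem_filter k1P mem_enum.
have s0 : s != [::] by apply: contraTneq k1s => ->.
have [k ks kmax] := seq_argmax (fun k => exponent (n k) (theta k)) s0.
have kP : 1 < (n k)%:R * theta k by move: ks; rewrite mem_filter => /andP[].
have {}kmax j : 1 < (n j)%:R * theta j -> exponent (n j) (theta j) <= exponent (n k) (theta k).
  by move=> jP; apply: kmax; rewrite mem_filter jP mem_enum.
exists k; split=> //; rewrite /min_exponent; apply/le_anti/andP; split.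
  by rewrite (bigD1 k) //= ge_min lexx.
elim/big_ind: _ => [|x y hx hy|j jP]; first exact: leey.
  by rewrite le_min hx hy.
have /andP[ej _] := exponent_itv (theta01 j) jP.
have ek := lt_le_trans ej (kmax j jP).
suff : 1 / exponent (n k) (theta k) <= 1 / exponent (n j) (theta j) by rewrite lee_fin.
by rewrite !div1r lef_pV2 ?posrE // kmax.
Qed.

End Exponents.

Lemma lp_sequences_comparable (R : realType) (X X' : completeNormedModType R) (t : R) :
  (exists (x : nat -> X) (K : R), 0 < K /\ forall (a : nat -> R) B,
    `|\sum_(b < B) a b *: x b| <= K * lpn t a [fset b in iota 0 B]%fset /\
    lpn t a [fset b in iota 0 B]%fset <= K * `|\sum_(b < B) a b *: x b|) ->
  (exists (x : nat -> X') (K : R), 0 < K /\ forall (a : nat -> R) B,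
    `|\sum_(b < B) a b *: x b| <= K * lpn t a [fset b in iota 0 B]%fset /\
    lpn t a [fset b in iota 0 B]%fset <= K * `|\sum_(b < B) a b *: x b|) ->
  0 <= t < 1 -> ~ totally_incomparable X X'.
Proof.
move=> [x [K [K0 xK]]] [y [L [L0 yL]]] t01.
pose C := Num.max (K * L) K; have C0 : 0 < C by rewrite lt_max K0 orbT.
have CE (Y : normedModType R) (z : Y) : K * (L * `|z|) <= C * `|z|.
  by rewrite mulrA ler_wpM2r // le_max lexx.
apply: (@equivalent_sequences _ _ _ x y C) => // a B.
- apply: le_trans (xK a B).1 _; apply: le_trans (CE _ _).
  by rewrite ler_wpM2l ?(ltW K0) // (yL a B).2.
- apply: le_trans (yL a B).1 _; apply: le_trans (CE _ _); rewrite mulrCA.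
  by rewrite ler_wpM2l ?(ltW L0) // (xK a B).2.
- move=> b bB; apply: le_trans (_ : lpn t a [fset b in iota 0 B]%fset <= _).
    by apply: lpn_ge => //; rewrite in_fset mem_iota.
  by apply: le_trans (xK a B).2 _; rewrite ler_wpM2r // le_max lexx orbT.
Qed.

Theorem theorem3 (R : realType) (l l' : nat)
  (l_gt0 : (0 < l)%N) (l'_gt0 : (0 < l')%N)
  (theta : 'I_l -> R) (M : 'I_l -> set {fset nat}) (n : 'I_l -> nat)
  (theta01 : forall k, 0 < theta k < 1)
  (M_compact : forall k, compact_family (M k))
  (M_hereditary : forall k, hereditary_family (M k))
  (n_gt0 : forall k, (0 < n k)%N)
  (M_index : forall k, has_index (M k) (n k))
  (theta' : 'I_l' -> R) (M' : 'I_l' -> set {fset nat}) (n' : 'I_l' -> nat)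
  (theta'01 : forall k, 0 < theta' k < 1)
  (M'_compact : forall k, compact_family (M' k))
  (M'_hereditary : forall k, hereditary_family (M' k))
  (n'_gt0 : forall k, (0 < n' k)%N)
  (M'_index : forall k, has_index (M' k) (n' k))
  (X X' : completeNormedModType R)
  (X_mt : is_mixed_tsirelson M theta X)
  (X'_mt : is_mixed_tsirelson M' theta' X') :
  totally_incomparable X X' <->
  [\/ (forall k, theta k <= 1 / (n k)%:R) /\
        (exists k, theta' k > 1 / (n' k)%:R),
      (forall k, theta' k <= 1 / (n' k)%:R) /\
        (exists k, theta k > 1 / (n k)%:R) |
      [/\ exists k, theta k > 1 / (n k)%:R,
          exists k, theta' k > 1 / (n' k)%:R &
          min_exponent theta n <> min_exponent theta' n']].
Proof.
have big_index (m : nat) (th : 'I_m -> R) (N : 'I_m -> nat) : (forall k, (0 < N k)%N) ->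
    (exists k, th k > 1 / (N k)%:R) = (exists k, 1 < (N k)%:R * th k).
  by move=> N0; apply/propext; split=> -[k kP]; exists k; move: kP; rewrite gt_inv_index.
have small_index (m : nat) (th : 'I_m -> R) (N : 'I_m -> nat) : (forall k, (0 < N k)%N) ->
    (forall k, th k <= 1 / (N k)%:R) = ~ (exists k, 1 < (N k)%:R * th k).
  move=> N0; rewrite -big_index //; apply/propext; split=> [h [k]|h k]; first by rewrite ltNge h.
  by rewrite leNgt; apply/negP => lt_k; apply: h; exists k.
rewrite (small_index _ theta n) // (small_index _ theta' n') //.
rewrite (big_index _ theta n) // (big_index _ theta' n') //.
(* [t = 0] is allowed, for the case in which the second space has no exponent. The midpoint of [t]
   and the exponent of [k] is positive and makes all contractions of the second space strict. *)
have TI_lr k t : 1 < (n k)%:R * theta k -> 0 <= t -> t < exponent (n k) (theta k) ->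
    (forall j, 1 < (n' j)%:R * theta' j -> exponent (n' j) (theta' j) <= t) ->
    totally_incomparable X X'.
  move=> kP t0 ts tmax V W bV _; have n1 := index_gt1 (theta01 k) kP.
  apply: (incomparable_spaces theta01 M_hereditary n_gt0 M_index theta'01 M'_hereditary
    M'_index X_mt X'_mt n1 (exponent_itv (theta01 k) kP) (powR_exponent (theta01 k) n1)
    (t := (t + exponent (n k) (theta k)) / 2)) => // [|j].
    by apply/andP; split; lra.
  apply: contraction_lt => // [|/tmax]; lra.
have TI_rl k t : 1 < (n' k)%:R * theta' k -> 0 <= t -> t < exponent (n' k) (theta' k) ->
    (forall j, 1 < (n j)%:R * theta j -> exponent (n j) (theta j) <= t) ->
    totally_incomparable X X'.
  move=> kP t0 ts tmax V W [Vl _ _] bW; have n1 := index_gt1 (theta'01 k) kP.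
  (* [incomparable_spaces] needs the larger exponent in the domain of the isomorphism, so the
     isomorphism is inverted. *)
  move=> /(isomorphic_subspaces_sym Vl).
  apply: (incomparable_spaces theta'01 M'_hereditary n'_gt0 M'_index theta01 M_hereditary
    M_index X'_mt X_mt n1 (exponent_itv (theta'01 k) kP) (powR_exponent (theta'01 k) n1)
    (t := (t + exponent (n' k) (theta' k)) / 2)) => // [|j].
    by apply/andP; split; lra.
  apply: contraction_lt => // [|/tmax]; lra.
have [A|nA] := EM (exists k, 1 < (n k)%:R * theta k);
  have [A'|nA'] := EM (exists k, 1 < (n' k)%:R * theta' k).
- have [k [kP kmax Ek]] := max_exponent theta01 A.
  have [k' [kP' kmax' Ek']] := max_exponent theta'01 A'.
  set s := exponent (n k) (theta k) in kmax Ek; set s' := exponent _ _ in kmax' Ek'.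
  have /andP[s0 s1] : 0 < s < 1 by apply: exponent_itv.
  have /andP[s'0 s'1] : 0 < s' < 1 by apply: exponent_itv.
  have [Ess'|ne] := eqVneq s s'.
    have nTI : ~ totally_incomparable X X'.
      apply: (@lp_sequences_comparable _ _ _ s).
      - apply: (lp_sequence theta01 M_hereditary n_gt0 M_index X_mt).
        + by rewrite s1 ltW.
        + by move=> j; apply: contraction_le => //; [exact: ltW|exact: kmax].
        + by exists k; [exact: index_gt1 kP|apply: powR_exponent => //; exact: index_gt1 kP].
      - apply: (lp_sequence theta'01 M'_hereditary n'_gt0 M'_index X'_mt).
        + by rewrite s1 ltW.
        + by move=> j; apply: contraction_le => //; [exact: ltW|rewrite Ess'; exact: kmax'].
        + exists k'; first exact: index_gt1 kP'.
          by rewrite Ess'; apply: powR_exponent => //; exact: index_gt1 kP'.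
      - by rewrite s1 ltW.
    split=> [/nTI[]|[[[]//]|[[]//]|[_ _]]].
    by rewrite Ek Ek' Ess'.
  split=> [_|_].
    apply: Or33; split=> //; rewrite Ek Ek' => -[] /eqP.
    by rewrite !div1r (inj_eq invr_inj) (negbTE ne).
  have [lt_s|le_s] := ltP s' s.
    by apply: (TI_lr k s' kP) => //; exact: ltW.
  have lt_s : s < s' by rewrite lt_def eq_sym ne.
  by apply: (TI_rl k' s kP') => //; exact: ltW.
- have [k [kP kmax _]] := max_exponent theta01 A.
  split=> [_|_]; first by apply: Or32.
  apply: (TI_lr k 0 kP) => // [|j jP]; last by case: nA'; exists j.
  by have /andP[] := exponent_itv (theta01 k) kP.
- have [k [kP kmax _]] := max_exponent theta'01 A'.
  split=> [_|_]; first by apply: Or31.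
  apply: (TI_rl k 0 kP) => // [|j jP]; last by case: nA; exists j.
  by have /andP[] := exponent_itv (theta'01 k) kP.
- split=> [|[[_]//|[_]//|[]//]] TI; exfalso; move: TI.
  apply: (@lp_sequences_comparable _ _ _ 0) => //; last by rewrite lexx ltr01.
    apply: (lp_sequence theta01 M_hereditary n_gt0 M_index X_mt).
    + by rewrite lexx ltr01.
    + by move=> j; apply: contraction_le => // jP; case: nA; exists j.
    + by rewrite eqxx.
  apply: (lp_sequence theta'01 M'_hereditary n'_gt0 M'_index X'_mt).
  + by rewrite lexx ltr01.
  + by move=> j; apply: contraction_le => // jP; case: nA'; exists j.
  + by rewrite eqxx.
Qed.
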